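(* Let $(M,\mathcal{C})$ be a Hausdorff differential space and let $\mathcal{G}$ be a family of bounded generators of $\mathcal{C}$, with $|g|\le 1$ for all $g\in\mathcal{G}$. Let $\eta$ be a smooth skew-symmetric point $k$-form on $(M,\mathcal{C})$ and let $\Phi$ be a smooth generalized $n$-dimensional chain on $(M,\mathcal{C})$. Assume that both $\eta$ and $\Phi$ are smoothly extendable with respect to $\mathcal{G}$. Then $$\int_{\partial_{\mathcal{G}}\Phi}\eta=\int_{\Phi}d\tilde\eta ,$$ where $\tilde\eta$ is an arbitrary smooth extension of $\eta$ to a smooth skew-symmetric point $k$-form on the differential space $([-1,1]^{\mathcal{G}},C^\infty([-1,1]^{\mathcal{G}}))$ and $d$ is the exterior derivative operator on that space.
   Context: **Differential spaces.** A differential space $(M,\mathcal{C})$ is a nonempty set $M$ with a family $\mathcal{C}$ of real functions on $M$ (a differential structure) such that, with $M$ given the weakest topology making all functions of $\mathcal{C}$ continuous: (a) $\sigma(f_1,\ldots,f_r)\in\mathcal{C}$ for all $f_i\in\mathcal{C}$, $\sigma\in C^\infty(\mathbb{R}^r)$; (b) any function that near each point coincides with some element of $\mathcal{C}$ belongs to $\mathcal{C}$. $\mathcal{C}$ is generated by $\mathcal{G}$ if it is the smallest differential structure containing $\mathcal{G}$ (equivalently, $f\in\mathcal{C}$ iff locally $f=\sigma(g_1,\ldots,g_r)$ with $g_i\in\mathcal{G}$, $\sigma\in C^\infty(\mathbb{R}^r)$). For $A\subset M$, $\mathcal{C}_A$ is the structure on $A$ generated by restrictions of elements of $\mathcal{C}$.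 A map $F:(M,\mathcal{C})\to(N,\mathcal{D})$ is smooth if $f\circ F\in\mathcal{C}$ for all $f\in\mathcal{D}$. Subsets of $\mathbb{R}^n$ carry $C^\infty(\mathbb{R}^n)_D$, and $C^\infty([-1,1]^{\mathcal{G}})$ is the structure on $[-1,1]^{\mathcal{G}}$ generated by the coordinate projections. **Tangent space, forms.** $T_mM$ is the space of linear maps $v:\mathcal{C}\to\mathbb{R}$ with $v(\alpha\beta)=\alpha(m)v(\beta)+\beta(m)v(\alpha)$; $TM=\bigsqcup_m T_mM$, $\pi:TM\to M$ the projection, $d\alpha(v)=v(\alpha)$. $TM$ has the structure $\mathcal{T}\mathcal{C}$ generated by $\{\alpha\circ\pi,\ d\alpha:\alpha\in\mathcal{C}\}$. $T^kM=\{(v_1,\ldots,v_k)\in (TM)^k:\pi(v_1)=\cdots=\pi(v_k)\}$ ($k\ge1$) has the structure $\tau^k\mathcal{C}$ induced from the product structure on $(TM)^k$ (generated by the $f\circ\mathrm{pr}_i$, $f\in\mathcal{T}\mathcal{C}$). A point $k$-form is a map $\omega:T^kM\to\mathbb{R}$ that is $k$-linear on $(T_mM)^k$ for each $m$; it is smooth if $\omega\in\tau^k\mathcal{C}$. For smooth $F:M\to N$, $(TFv)(f)=v(f\circ F)$ and $(F^*\omega)(v_1,\ldots,v_k)=\omega(TFv_1,\ldots,TFv_k)$. **Completion.** $\mathcal{U}_{\mathcal{G}}$ is the weakest uniform structure on $M$ making all $g\in\mathcal{G}$ uniformly continuous; ''uniform'' means uniformly continuous. $compl_{\mathcal{G}}M$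 is the (Hausdorff) completion of $(M,\mathcal{U}_{\mathcal{G}})$, with the differential structure $compl_{\mathcal{G}}\mathcal{C}$ generated by the continuous extensions $\tilde g$ of $g\in\mathcal{G}$; $\iota:M\to compl_{\mathcal{G}}M$ is the natural embedding. When all $|g|\le1$, $compl_{\mathcal{G}}M$ is identified with the closure of the image of $e:M\to[-1,1]^{\mathcal{G}}$, $e(p)=(g(p))_{g\in\mathcal{G}}$, with the induced differential structure. Put $\mathcal{T}\mathcal{G}_0=\{g\circ\pi,\ dg: g\in\mathcal{G}\}$, a family of generators of $\mathcal{T}\mathcal{C}$; $compl_{\mathcal{T}\mathcal{G}_0}TM$ and its structure $compl_{\mathcal{T}\mathcal{G}_0}\mathcal{T}\mathcal{C}$ are defined analogously. **Cubes and chains.** A generalized $n$-dimensional smooth cube on $(M,\mathcal{C})$ is a smooth map $\varphi:(D,C^\infty(\mathbb{R}^n)_D)\to(M,\mathcal{C})$ with $D$ dense in $[0,1]^n$. Here $TD$ is identified with $D\times\mathbb{R}^n$ with its standard uniform structure. A smooth $n$-dimensional chain is a finite formal real linear combination $\Phi=\sum_j c_j\varphi_j$ of distinct generalized smooth cubes with $c_j\neq0$, and $supp\,\Phi=\{\varphi_j\}$. The cube $\varphi$ is smoothly extendable with respect to $\mathcal{G}$ if $T\varphi:TD\to TM$ is uniform with respect to $\mathcal{U}_{\mathcal{T}\mathcal{G}_0}$ and its continuous extension $[0,1]^n\times\mathbb{R}^n\to compl_{\mathcal{T}\mathcal{G}_0}TM$ is smooth; then $\varphi$ extends to a smooth cube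 $\tilde\varphi:[0,1]^n\to compl_{\mathcal{G}}M$. A chain is smoothly extendable if every cube in its support is. A smooth point $k$-form $\eta$ on $M$ is smoothly extendable with respect to $\mathcal{G}$ if $\eta=\iota^*\eta'$ for some smooth point $k$-form $\eta'$ on $compl_{\mathcal{G}}M$. A smooth extension $\tilde\eta$ of $\eta$ to $[-1,1]^{\mathcal{G}}$ is a smooth form with $e^*\tilde\eta=\eta$. **Boundary.** $\partial_{\mathcal{G}}\varphi=\sum_{i=1}^n\sum_{\alpha=0,1}(-1)^{i+\alpha}\tilde\varphi\circ I^n_{(i,\alpha)}$, where $I^n_{(i,\alpha)}(x^1,\ldots,x^{n-1})=(x^1,\ldots,x^{i-1},\alpha,x^i,\ldots,x^{n-1})$; this is a smooth $(n-1)$-dimensional chain on $compl_{\mathcal{G}}M$. For $\Phi=\sum_jc_j\varphi_j$, $\partial_{\mathcal{G}}\Phi=\sum_jc_j\partial_{\mathcal{G}}\varphi_j$. **Integrals.** For a smooth $n$-form $\omega$ on $M$ and a cube $\varphi:D\to M$, write $\varphi^*\omega=\omega_0\,dt^1\wedge\cdots\wedge dt^n$; if $\omega_0$ has a (unique) continuous extension $\tilde\omega_0$ to $[0,1]^n$, then $\int_\varphi\omega=\int_{[0,1]^n}\tilde\omega_0\,dt$. Integrals extend linearly to chains. By convention the integral of a $k$-form over an $n$-dimensional cube or chain is $0$ if $k\ne n$. In the formula of the theorem, $\int_\Phi d\tilde\eta$ means $\int_\Phi e^*(d\tilde\eta)$, and $\int_{\partial_{\mathcal{G}}\Phi}\eta$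 means the integral over $\partial_{\mathcal{G}}\Phi$ (a chain on $compl_{\mathcal{G}}M\subset[-1,1]^{\mathcal{G}}$) of the restriction (pullback) of $\tilde\eta$ to $compl_{\mathcal{G}}M$. **Exterior derivative on $[-1,1]^{\mathcal{G}}$.** For a smooth skew-symmetric point $k$-form $\omega$ and $v_1,\ldots,v_{k+1}\in T_p([-1,1]^{\mathcal{G}})\cong\mathbb{R}^{\mathcal{G}}$, $$(d\omega)(v_1,\ldots,v_{k+1})=\sum_{i=1}^{k+1}(-1)^{i+1}X_i(\omega(X_1,\ldots,\hat X_i,\ldots,X_{k+1}))(p)+\sum_{i<j}(-1)^{i+j}\omega([X_i,X_j],X_1,\ldots,\hat X_i,\ldots,\hat X_j,\ldots,X_{k+1})(p),$$ where $X_j$ are smooth vector fields on $[-1,1]^{\mathcal{G}}$ with $X_j(p)=v_j$ (e.g. constant ones) and hats denote omission. Wedge products use $(\omega_1\wedge\cdots\wedge\omega_k)(v_1,\ldots,v_k)=\det(\omega_i(v_j))$. *)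

(* Defs.v *)
From HB Require Import structures.
From mathcomp Require Import freeg.
From mathcomp Require Import all_boot all_order all_fingroup all_algebra.
From mathcomp Require Import all_classical all_reals all_analysis.
From mathcomp Require Import ring.
Set Implicit Arguments.
Unset Strict Implicit.
Unset Printing Implicit Defensive.
Import Order.TTheory GRing.Theory Num.Theory.
Import numFieldNormedType.Exports.
Local Open Scope classical_set_scope.
Local Open Scope ring_scope.

Section DifferentialSpaces.
Variable R : realType.

Definition pderiv n (i : 'I_n) (f : 'rV[R]_n -> R) : 'rV[R]_n -> R :=
  fun x => 'D_(delta_mx 0 i) f x.

Definition smoothRn n (f : 'rV[R]_n -> R) : Prop :=
  forall s : seq 'I_n, continuous (foldr (@pderiv n) f s) /\
    forall i x, derivable (foldr (@pderiv n) f s) x (delta_mx 0 i).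

Inductive poly_fun n : ('rV[R]_n -> R) -> Prop :=
| Poly_cst c : poly_fun (cst c)
| Poly_coord i : poly_fun (fun x => x 0 i)
| Poly_add f g of poly_fun f & poly_fun g : poly_fun (f + g)
| Poly_mul f g of poly_fun f & poly_fun g : poly_fun (f * g).

Lemma is_derive_coord n (i j : 'I_n) (x : 'rV[R]_n) :
  is_derive x (delta_mx 0 i) (fun y : 'rV[R]_n => y 0 j : R) (j == i)%:R.
Proof.
apply: DeriveDef; first exact/diff_derivable/differentiable_coord.
apply/cvg_lim => //; apply: cvg_near_cst; near=> h.
rewrite /= !mxE eqxx /= addrK /GRing.scale /= mulrA mulVf ?mul1r //.
by near: h; rewrite nbhs_simpl; exact: (nbhs_dnbhs_neq (0 : R)).
Unshelve. all: by end_near. Qed.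

Lemma poly_fun_derivable n (f : 'rV[R]_n -> R) i x :
  poly_fun f -> derivable f x (delta_mx 0 i).
Proof.
elim=> [c|j|g h _ dg _ dh|g h _ dg _ dh]; first exact: derivable_cst.
- exact/diff_derivable/differentiable_coord.
- exact: derivableD.
- exact: derivableM.
Qed.

Lemma poly_fun_continuous n (f : 'rV[R]_n -> R) : poly_fun f -> continuous f.
Proof.
elim=> [c|j|g h _ cg _ ch|g h _ cg _ ch]; first exact: cst_continuous.
- exact: coord_continuous.
- by move=> x; exact: (cvgD (cg x) (ch x)).
- by move=> x; exact: (cvgM (cg x) (ch x)).
Qed.

Lemma poly_fun_pderiv n (f : 'rV[R]_n -> R) i :
  poly_fun f -> poly_fun (pderiv i f).
Proof.
elim=> [c|j|g h pg Pg ph Ph|g h pg Pg ph Ph].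
- suff -> : pderiv i (cst c) = cst 0 by exact: Poly_cst.
  by apply/funext => x; rewrite /pderiv derive_cst.
- suff -> : pderiv i (fun x : 'rV[R]_n => x 0 j) = cst (j == i)%:R by exact: Poly_cst.
  by apply/funext => x; rewrite /pderiv; have [_ ->] := is_derive_coord i j x.
- suff -> : pderiv i (g + h) = pderiv i g + pderiv i h by exact: Poly_add.
  by apply/funext => x; rewrite /pderiv deriveD //; exact: poly_fun_derivable.
- suff -> : pderiv i (g * h) = g * pderiv i h + h * pderiv i g.
    by apply: Poly_add; exact: Poly_mul.
  by apply/funext => x; rewrite /pderiv deriveM //; exact: poly_fun_derivable.
Qed.

Lemma smoothRn_poly n (f : 'rV[R]_n -> R) : poly_fun f -> smoothRn f.
Proof.
move=> pf s; have {pf}ps : poly_fun (foldr (@pderiv n) f s).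
  by elim: s => //= i s; exact: poly_fun_pderiv.
split; first exact: poly_fun_continuous.
by move=> i x; exact: poly_fun_derivable.
Qed.

Lemma smoothRn_comp_coord m n (A : 'rV[R]_m -> 'rV[R]_n) (u : 'I_m -> 'I_n)
    (f : 'rV[R]_n -> R) :
  continuous A ->
  (forall x t j, A (t *: delta_mx 0 j + x) = t *: delta_mx 0 (u j) + A x) ->
  smoothRn f -> smoothRn (f \o A).
Proof.
move=> cA hA sf.
have E j g x : pderiv j (g \o A) x = pderiv (u j) g (A x).
  rewrite /pderiv /derive; set a := (fun h => _); set b := (fun h => _).
  suff -> : a = b by [].
  by apply/funext => h; rewrite /a /b /= hA.
have Es s : foldr (@pderiv m) (f \o A) s = foldr (@pderiv n) f (map u s) \o A.
  elim: s => //= i s ->; exact/funext/E.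
move=> s; rewrite Es; have [cf df] := sf (map u s); split.
  by move=> x; exact: (continuous_comp (cA x) (cf (A x))).
move=> i x; have := df (u i) (A x); rewrite /derivable.
set a := (fun h => _); set b := (fun h => _).
suff -> : b = a by [].
by apply/funext => h; rewrite /a /b /= hA.
Qed.

(* The weakest uniform structure on [M] making every [g] in [G] uniformly
   continuous; its topology is the weakest one making every [g] continuous. *)
Definition weak_unif (M : choiceType) (G : set (M -> R)) : uniformType :=
  sup_topology (fun g : G => Uniform.class (initial_topology (val g))).

(* For [r = 0] the first clause only says that constants belong to [C]. *)
Definition diff_structure (M : choiceType) (C : set (M -> R)) : Prop :=
  (forall r (s : 'rV[R]_r -> R) (f : 'I_r -> M -> R),
     smoothRn s -> (forall i, C (f i)) -> C (fun p => s (\row_i f i p))) /\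
  (forall f : M -> R,
     (forall p : weak_unif C, exists2 g, C g & \forall q \near p, f q = g q) -> C f).

Definition gen_struct (M : choiceType) (G : set (M -> R)) : set (M -> R) :=
  smallest (@diff_structure M) G.

Lemma weak_fun_continuous (M : choiceType) (C : set (M -> R)) (f : M -> R) :
  C f -> continuous (f : weak_unif C -> R).
Proof.
move=> Cf p; pose i : C := SigSub (mem_set Cf).
have H : nbhs (p : weak_unif C) --> (p : weak_unif C) by exact: cvg_id.
move/cvg_sup/(_ i) : H => H.
have := @initial_continuous M R (val i) p.
by move=> h U /h /H.
Qed.

Lemma weak_map_continuous (M N : choiceType) (C : set (M -> R))
    (D : set (N -> R)) (F : M -> N) :
  (forall f, D f -> C (f \o F)) -> continuous (F : weak_unif C -> weak_unif D).
Proof.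
move=> h p.
have FF : Filter (F @ nbhs (p : weak_unif C)) by exact: fmap_filter.
apply/cvg_sup => i.
have : continuous (F : weak_unif C -> initial_topology (val i)).
  apply: continuous_comp_initial.
  by apply: weak_fun_continuous; apply: h; exact: set_valP.
by move/(_ p).
Qed.

Lemma diff_structure_gen (M : choiceType) (G : set (M -> R)) :
  diff_structure (gen_struct G).
Proof.
split=> [r s f ss Cf D [hD GD]|f loc D [hD GD]].
  by apply: hD.1 => // i; exact: Cf.
apply: hD.2 => p; have [g Cg fg] := loc p.
exists g; first exact: Cg.
have sub : gen_struct G `<=` D by move=> u; apply.
exact: (weak_map_continuous (F := id) sub fg).
Qed.

Lemma gen_structS (M : choiceType) (G : set (M -> R)) : G `<=` gen_struct G.
Proof. exact: sub_gen_smallest. Qed.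

Lemma gen_struct_comp (M N : choiceType) (C : set (M -> R)) (G : set (N -> R))
    (F : M -> N) :
  diff_structure C -> (forall g, G g -> C (g \o F)) ->
  forall f, gen_struct G f -> C (f \o F).
Proof.
move=> hC hG; suff sub : gen_struct G `<=` [set f : N -> R | C (f \o F)] by exact: sub.
apply: smallest_sub => //.
split=> [r s u ss Cu /=|u loc /=]; first exact: (hC.1 _ _ (fun i => u i \o F)).
apply: hC.2 => p; have [g Cg ug] := loc (F p).
exists (g \o F) => //.
exact: (weak_map_continuous (D := [set f : N -> R | C (f \o F)]) (F := F) _ ug).
Qed.

(* Non-emptiness of the carrier is not part of the record: it is a hypothesis
   where it is wanted. *)
Record dspace := DSpace {
  carrier :> choiceType;
  dfun : set (carrier -> R);
  dfunP : diff_structure dfun }.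

Definition gen_dspace (M : choiceType) (G : set (M -> R)) : dspace :=
  DSpace (diff_structure_gen G).

Definition sub_dspace (M : choiceType) (C : set (M -> R)) (A : set M) : dspace :=
  gen_dspace [set f \o (val : A -> M) | f in C].

Definition hausdorff_dspace (M : dspace) : Prop := hausdorff_space (weak_unif (@dfun M)).

Record smap (M N : dspace) := SMap {
  smap_fun :> M -> N;
  smapP : forall f, dfun f -> dfun (f \o smap_fun) }.

(* Linearity and the Leibniz rule are stated relationally: [h] is the element of
   the structure equal to [a f + b g], respectively to [f g]. *)
Definition tangent (M : dspace) (m : M) : set (@dfun M -> R) :=
  [set v | (forall (a b : R) (f g h : @dfun M),
              (forall p, val h p = a * val f p + b * val g p) ->
              v h = a * v f + b * v g) /\
           (forall f g h : @dfun M,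
              (forall p, val h p = val f p * val g p) ->
              v h = val f m * v g + val g m * v f)].

Definition TM (M : dspace) : choiceType := {m : M & set_type (@tangent M m)}.

Definition tpoint (M : dspace) (m : M) (v : tangent m) : TM M := existT _ m v.

Definition dd (M : dspace) (f : @dfun M) (v : TM M) : R := val (projT2 v) f.

(* [g \o pi] and [d g] for [g] in [G]. *)
Definition tgens (M : dspace) (G : set (M -> R)) : set (TM M -> R) :=
  [set g \o @projT1 _ _ | g in G] `|`
  [set dd f | f in [set f : @dfun M | G (val f)]].

Definition tspace (M : dspace) : dspace := gen_dspace (tgens (@dfun M)).

Definition power_struct k (M : dspace) : set (('I_k -> M) -> R) :=
  gen_struct [set h | exists i, exists2 f : M -> R, dfun f & h = (fun v => f (v i))].

Definition Tk k (M : dspace) : set ('I_k -> TM M) :=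
  [set v | forall i j, projT1 (v i) = projT1 (v j)].

Definition tkspace k (M : dspace) : dspace :=
  sub_dspace (@power_struct k (tspace M)) (@Tk k M).

Lemma Tk_at k (M : dspace) (m : M) (v : 'I_k -> tangent m) :
  Tk (fun i => tpoint (v i)).
Proof. by []. Qed.

Definition tuple_at k (M : dspace) (m : M) (v : 'I_k -> tangent m) : tkspace k M :=
  SigSub (mem_set (Tk_at v)).

Definition multilinear k (M : dspace) (w : tkspace k M -> R) : Prop :=
  forall (m : M) (i : 'I_k) (a b : R) (u v z : 'I_k -> tangent m),
    (forall j, j != i -> u j = z j /\ v j = z j) ->
    (forall f, val (z i) f = a * val (u i) f + b * val (v i) f) ->
    w (tuple_at z) = a * w (tuple_at u) + b * w (tuple_at v).

Definition skew_symmetric k (M : dspace) (w : tkspace k M -> R) : Prop :=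
  forall (m : M) (s : 'S_k) (v : 'I_k -> tangent m),
    w (tuple_at (fun i => v (s i))) = (-1) ^+ s * w (tuple_at v).

Record kform k (M : dspace) := KForm {
  form_fun :> tkspace k M -> R;
  form_multilinear : multilinear form_fun;
  form_smooth : dfun form_fun }.

Definition comp_dfun (M N : dspace) (F : smap M N) (f : @dfun N) : @dfun M :=
  SigSub (mem_set (smapP F (set_valP f))).

Lemma tangent_map_subproof (M N : dspace) (F : smap M N) (m : M) (v : tangent m) :
  @tangent N (F m) (fun f => val v (comp_dfun F f)).
Proof.
have [vl vm] := set_valP v; split=> [a b f g h hE|f g h hE].
  by apply: vl => p; exact: hE.
exact: (vm (comp_dfun F f) (comp_dfun F g) (comp_dfun F h) (fun p => hE (F p))).
Qed.

Definition tmap (M N : dspace) (F : smap M N) (v : TM M) : TM N :=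
  @tpoint N (F (projT1 v)) (SigSub (mem_set (tangent_map_subproof F (projT2 v)))).

Lemma tkmap_subproof k (M N : dspace) (F : smap M N) (v : tkspace k M) :
  Tk (fun i => tmap F (val v i)).
Proof. by move=> i j /=; congr (F _); exact: (set_valP v). Qed.

Definition tkmap k (M N : dspace) (F : smap M N) (v : tkspace k M) : tkspace k N :=
  SigSub (mem_set (tkmap_subproof F v)).

Definition pull_form k (M N : dspace) (F : smap M N) (w : tkspace k N -> R) :
  tkspace k M -> R := w \o tkmap F.


Record vfield (M : dspace) := VField {
  vf_at :> forall p : M, tangent p;
  vf_smooth : forall f : TM M -> R, @dfun (tspace M) f ->
    dfun (fun p => f (tpoint (vf_at p))) }.

Lemma vf_app_subproof (M : dspace) (X : vfield M) (f : @dfun M) :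
  dfun (fun p => val (X p) f).
Proof.
apply: (vf_smooth X (f := dd f)); apply: gen_structS; right.
by exists f => //; exact: set_valP.
Qed.

Definition vf_app (M : dspace) (X : vfield M) (f : @dfun M) : @dfun M :=
  SigSub (mem_set (vf_app_subproof X f)).

Lemma dfun_mul (M : dspace) (f g : M -> R) :
  dfun f -> dfun g -> dfun (fun p => f p * g p).
Proof.
move=> df dg.
pose s (x : 'rV[R]_2) := x 0 0 * x 0 1.
have ss : smoothRn s by apply: smoothRn_poly; apply: Poly_mul; exact: Poly_coord.
have := (dfunP M).1 _ s (fun i => if i == 0 then f else g) ss.
have -> : (fun p => s (\row_i (if i == 0 then f else g) p)) = (fun p => f p * g p).
  by apply/funext => p; rewrite /s !mxE.
by apply=> i; case: ifP.
Qed.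

Lemma bracket_subproof (M : dspace) (X Y : vfield M) (p : M) :
  @tangent M p (fun f => val (X p) (vf_app Y f) - val (Y p) (vf_app X f)).
Proof.
have [Xl Xm] := set_valP (X p); have [Yl Ym] := set_valP (Y p).
have L (Z : vfield M) := fun q => (set_valP (Z q)).1.
have P (Z : vfield M) := fun q => (set_valP (Z q)).2.
split=> [a b f g h hE|f g h hE].
  rewrite (Xl a b (vf_app Y f) (vf_app Y g)); last by move=> q; exact: L.
  rewrite (Yl a b (vf_app X f) (vf_app X g)); last by move=> q; exact: L.
  by rewrite !mulrBr opprD addrACA.
pose mu (u v : @dfun M) : @dfun M :=
  SigSub (mem_set (dfun_mul (set_valP u) (set_valP v))).
have D (Z W : vfield M) : val (Z p) (vf_app W h) =
    val f p * val (Z p) (vf_app W g) + val (W p) g * val (Z p) f +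
    (val g p * val (Z p) (vf_app W f) + val (W p) f * val (Z p) g).
  rewrite (L Z p 1 1 (mu f (vf_app W g)) (mu g (vf_app W f))); last first.
    by move=> q; rewrite !mul1r; exact: P.
  by rewrite !mul1r; congr (_ + _); exact: P.
rewrite !D; set a := val f p; set b := val g p.
set Xg := val (X p) g; set Yg := val (Y p) g.
set Xf := val (X p) f; set Yf := val (Y p) f.
rewrite !mulrBr [Xg * Yf]mulrC [Xf * Yg]mulrC.
set u1 := a * _; set u2 := b * _; set u3 := a * _; set u4 := b * _.
set w1 := Yg * _; set w2 := Yf * _.
rewrite [u3 + _]addrC [u4 + _]addrC !opprD !addrA.
by ring.
Qed.

Definition bracket (M : dspace) (X Y : vfield M) (p : M) : tangent p :=
  SigSub (mem_set (bracket_subproof X Y p)).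

Lemma form_on_subproof k (M : dspace) (w : kform k M) (X : 'I_k -> vfield M) :
  dfun (fun p => w (tuple_at (fun i => X i p))).
Proof.
apply: (gen_struct_comp (F := fun p => tuple_at (fun i => X i p)) (dfunP M));
  last exact: form_smooth.
move=> _ [f + <-]; apply: gen_struct_comp (dfunP M) _ f => _ [i [f df ->]].
exact: (vf_smooth (X i)).
Qed.

Definition form_on k (M : dspace) (w : kform k M) (X : 'I_k -> vfield M) : @dfun M :=
  SigSub (mem_set (form_on_subproof w X)).

(* Indices start at 0, which changes neither [(-1) ^ (i + j)] nor, up to the
   shift by 2, the first sign.  For [i < j] the map
   [fun l => bump i (bump j.-1 l)] enumerates increasingly the indices other
   than [i] and [j]. *)
Definition dext_on k (M : dspace) (w : kform k M) (X : 'I_k.+1 -> vfield M) (p : M) : R :=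
  \sum_(i < k.+1) (-1) ^+ i * val (X i p) (form_on w (fun l => X (lift i l))) +
  \sum_(i < k.+1) \sum_(j < k.+1 | (i < j)%N) (-1) ^+ (i + j) *
    w (tuple_at (fun l : 'I_k =>
         if l == 0 :> nat then bracket (X i) (X j) p
         else X (inord (bump i (bump j.-1 l.-1))) p)).

(* The value at [(v_1, ..., v_(k+1))] is computed with arbitrarily chosen smooth
   vector fields extending the [v_i]. *)
Definition dext k (M : dspace) (w : kform k M) (v : tkspace k.+1 M) : R :=
  xget 0 [set r | exists (X : 'I_k.+1 -> vfield M) (p : M),
    (forall i, val v i = tpoint (X i p)) /\ r = dext_on w X p].

Definition unit_box (I : Type) : set {ptws I -> R} := [set x | forall i, `|x i| <= 1].

Arguments unit_box I : clear implicits.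

Definition box_space (I : Type) : dspace :=
  gen_dspace (range (fun i (x : unit_box I) => val x i)).

Definition ev (M : choiceType) (G : set (M -> R)) (p : M) : {ptws G -> R} :=
  fun g => val g p.
Arguments ev {M} G p.

(* The Hausdorff completion of [weak_unif G]: the closure of the image of [M] in
   the complete Hausdorff uniform space [R^G], whose uniform structure induces
   [weak_unif G]; the extension of [g] is the coordinate of index [g]. *)
Definition completion (M : choiceType) (G : set (M -> R)) : set {ptws G -> R} :=
  closure (range (ev G)).
Arguments completion {M} G.

Definition completion_space (M : choiceType) (G : set (M -> R)) : dspace :=
  gen_dspace (range (fun (g : G) (x : completion G) => val x g)).

Lemma compl_ev (M : choiceType) (G : set (M -> R)) (p : M) : completion G (ev G p).
Proof. by apply: subset_closure; exists p. Qed.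

Definition to_compl_fun (M : choiceType) (G : set (M -> R)) (p : M) : completion_space G :=
  SigSub (mem_set (@compl_ev M G p)).

Lemma to_compl_smooth (M : dspace) (G : set (M -> R)) :
  gen_struct G = @dfun M ->
  forall f, @dfun (completion_space G) f -> dfun (f \o @to_compl_fun M G).
Proof.
move=> hG; apply: (gen_struct_comp (dfunP M)) => _ [g _ <-].
by rewrite -hG; apply: gen_structS; exact: (set_valP g).
Qed.

Definition to_compl (M : dspace) (G : set (M -> R)) (hG : gen_struct G = @dfun M) :
  smap M (completion_space G) := SMap (to_compl_smooth hG).

Definition bounded1 (M : choiceType) (G : set (M -> R)) : Prop :=
  forall g, G g -> forall p, `|g p| <= 1.

Lemma compl_box (M : choiceType) (G : set (M -> R)) :
  bounded1 G -> completion G `<=` unit_box G.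
Proof.
move=> hb x xc i; apply: contrapT => /negP; rewrite -ltNge => xi.
have cx : {for x, continuous (fun y : {ptws G -> R} => `|y i|)}.
  apply: (continuous_comp (g := fun t : R => `|t|)); last exact: norm_continuous.
  exact: (@proj_continuous {classic G} (fun=> R) i x).
have [] := xc [set y | 1 < `|y i|].
  exact: (cx _ (open_nbhs_nbhs (conj (@open_gt R 1) xi))).
by move=> _ [[p _ <-] /=]; rewrite ltNge hb //; exact: set_valP.
Qed.

Definition compl_to_box_fun (M : choiceType) (G : set (M -> R)) (hb : bounded1 G)
  (x : completion_space G) : box_space G := SigSub (mem_set (@compl_box M G hb _ (set_valP x))).

Lemma compl_to_box_smooth (M : choiceType) (G : set (M -> R)) (hb : bounded1 G) f :
  @dfun (box_space G) f -> dfun (f \o compl_to_box_fun hb).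
Proof.
apply: (gen_struct_comp (dfunP (completion_space G))) => _ [g _ <-].
by apply: gen_structS; exists g.
Qed.

Definition compl_to_box (M : choiceType) (G : set (M -> R)) (hb : bounded1 G) :
  smap (completion_space G) (box_space G) := SMap (@compl_to_box_smooth M G hb).

Definition comp_smap (M N P : dspace) (F : smap N P) (H : smap M N) : smap M P :=
  SMap (fun f hf => smapP H (smapP F hf)).

Definition to_box (M : dspace) (G : set (M -> R)) (hG : gen_struct G = @dfun M)
  (hb : bounded1 G) : smap M (box_space G) := comp_smap (compl_to_box hb) (to_compl hG).

Definition Rn_sub n (D : set 'rV[R]_n) : dspace := sub_dspace (@smoothRn n) D.

Definition ucube n : set 'rV[R]_n := [set x | forall i, 0 <= x 0 i <= 1].

Record cube n (M : dspace) := Cube {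
  cdom : set 'rV[R]_n;
  cdom_sub : cdom `<=` @ucube n;
  cdom_dense : @ucube n `<=` closure cdom;
  cmap :> smap (Rn_sub cdom) M }.

Lemma coord_fun_subproof n (D : set 'rV[R]_n) (i : 'I_n) :
  @dfun (Rn_sub D) (fun x => val x 0 i).
Proof.
apply: gen_structS; exists (fun x : 'rV[R]_n => x 0 i) => //.
by apply: smoothRn_poly; exact: Poly_coord.
Qed.

Definition coord_fun n (D : set 'rV[R]_n) (i : 'I_n) : @dfun (Rn_sub D) :=
  SigSub (mem_set (@coord_fun_subproof n D i)).

(* For [D] dense in the cube, [TD] is identified with [D * R^n], seen in
   [R^(n + n)], by [v |-> (pi v, (dt^i v)_i)]. *)
Definition TD_coord n (D : set 'rV[R]_n) (v : TM (Rn_sub D)) : 'rV[R]_(n + n) :=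
  row_mx (val (projT1 v)) (\row_i dd (coord_fun D i) v).

Definition cylinder n : set 'rV[R]_(n + n) := [set z | ucube (lsubmx z)].

Definition extendable_cube n (M : dspace) (G : set (M -> R)) (phi : cube n M) : Prop :=
  unif_continuous
    (tmap phi : initial_topology (@TD_coord n (cdom phi)) -> weak_unif (@tgens M G)) /\
  exists Psi : Rn_sub (@cylinder n) -> completion_space (@tgens M G),
    [/\ continuous (Psi : set_type (@cylinder n) -> set_type (completion (@tgens M G))),
        forall v z, val z = TD_coord v -> Psi z = to_compl_fun (@tgens M G) (tmap phi v) &
        forall f, dfun f -> dfun (f \o Psi)].

Definition extends_cube n (M : dspace) (G : set (M -> R)) (phi : cube n M)
    (F : smap (Rn_sub (@ucube n)) (completion_space G)) : Prop :=
  forall (x : Rn_sub (cdom phi)) (y : Rn_sub (@ucube n)),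
    val y = val x -> F y = to_compl_fun G (phi x).

Definition insert_coord n (i : 'I_n) (a : R) (x : 'rV[R]_n.-1) : 'rV[R]_n :=
  \row_j if unlift i j is Some l then x 0 l else a.

Lemma insert_ucube n (i : 'I_n) (a : bool) (x : 'rV[R]_n.-1) :
  ucube x -> ucube (insert_coord i a%:R x).
Proof.
move=> hx j; rewrite mxE; case: unlift => [l|]; first exact: hx.
by case: a; rewrite /= ?lexx ?ler01.
Qed.

Definition face_fun n (i : 'I_n) (a : bool) (x : Rn_sub (@ucube n.-1)) :
  Rn_sub (@ucube n) := SigSub (mem_set (insert_ucube i a (set_valP x))).

Lemma face_smooth n (i : 'I_n) (a : bool) f :
  @dfun (Rn_sub (@ucube n)) f -> @dfun (Rn_sub (@ucube n.-1)) (f \o face_fun i a).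
Proof.
apply: (gen_struct_comp (dfunP (Rn_sub (@ucube n.-1)))) => _ [f' sf <-].
apply: gen_structS; exists (f' \o insert_coord i a%:R) => //.
apply: (smoothRn_comp_coord (u := lift i)) sf.
  move=> x U [P hP sPU]; exists (fun i0 l => P i0 (lift i l)).
    by move=> i0 l; have := hP i0 (lift i l); rewrite mxE liftK ord1.
  move=> y hy; apply: sPU => i0 j; rewrite mxE.
  case: unliftP => [l ->|->]; first by have := hy i0 l; rewrite ord1.
  by have /nbhs_singleton := hP i0 i; rewrite mxE unlift_none.
move=> x t j; apply/rowP => l; rewrite !mxE.
case: unliftP => [l' ->|->]; first by rewrite !mxE !eqxx (inj_eq (@lift_inj _ i)).
by rewrite eqxx /= (negbTE (neq_lift i j)) mulr0 add0r.
Qed.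

Definition face n (i : 'I_n) (a : bool) :
  smap (Rn_sub (@ucube n.-1)) (Rn_sub (@ucube n)) := SMap (@face_smooth n i a).

Definition full_cube n (M : dspace) (F : smap (Rn_sub (@ucube n)) M) : cube n M :=
  Cube (@subset_refl _ (@ucube n)) (@subset_closure _ (@ucube n)) F.

Definition chain n (M : dspace) := {freeg {classic cube n M} / R}.

Definition extendable_chain n (M : dspace) (G : set (M -> R)) (Phi : chain n M) : Prop :=
  forall phi : cube n M, phi \in freeg.dom Phi -> extendable_cube G phi.

(* The smooth extension of [phi] to [0,1]^n is unique when it exists; a cube
   without one gets boundary 0.  As [i] starts at 0, the sign is
   [(-1) ^ (i.+1 + a)]. *)
Definition boundary_cube n (M : dspace) (G : set (M -> R)) (phi : cube n M) :
    chain n.-1 (completion_space G) :=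
  if pselect (exists F, @extends_cube n M G phi F) is left h then
    \sum_(i < n) \sum_(a : bool)
       (-1) ^+ (i.+1 + a) *:
         << (full_cube (comp_smap (projT1 (cid h)) (face i a))
              : {classic cube n.-1 (completion_space G)}) >>
  else 0.

Definition boundary n (M : dspace) (G : set (M -> R)) (Phi : chain n M) :
  chain n.-1 (completion_space G) := fglift (fun phi : {classic cube n M} => boundary_cube G (phi : cube n M)) Phi.

(* Iterated integral over [0,1]^n; by Fubini it is the n-dimensional integral for
   the continuous functions it is applied to. *)
Fixpoint integral_ucube n : ('rV[R]_n -> R) -> R :=
  match n with
  | 0 => fun f => f 0
  | n'.+1 => fun f => \int[lebesgue_measure]_(t in `[0, 1]%classic)
      integral_ucube (fun x : 'rV[R]_n' => f (row_mx (t%:M : 'rV_1) x))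
  end.

(* [phi^* w = c dt^1 ^ ... ^ dt^n], the wedge product being
   [(v_1, ..., v_n) |-> det (dt^i (v_j))]. *)
Definition is_coef n (M : dspace) (w : tkspace n M -> R) (phi : cube n M)
    (c : Rn_sub (cdom phi) -> R) : Prop :=
  forall x (v : 'I_n -> tangent x),
    pull_form phi w (tuple_at v) =
    c x * \det (\matrix_(i, j) val (v j) (coord_fun (cdom phi) i)).

Definition is_coef_ext n (M : dspace) (w : tkspace n M -> R) (phi : cube n M)
    (c : 'rV[R]_n -> R) : Prop :=
  {within @ucube n, continuous c} /\ is_coef w (fun x : Rn_sub (cdom phi) => c (val x)).

(* A [k]-form is integrable, with integral 0, over every [n]-cube when
   [k <> n]. *)
Definition integrable_cube k n (M : dspace) (w : tkspace k M -> R) (phi : cube n M) :=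
  forall e : k = n, exists c, is_coef_ext (ecast j (tkspace j M -> R) e w) (phi : cube n M) c.

Definition integral_cube k n (M : dspace) (w : tkspace k M -> R) (phi : cube n M) : R :=
  if @eqP _ k n is ReflectT e then
    integral_ucube (xget (cst 0)
      [set c | is_coef_ext (ecast j (tkspace j M -> R) e w) phi c])
  else 0.

Definition integrable_chain k n (M : dspace) (w : tkspace k M -> R) (Phi : chain n M) :=
  forall phi : cube n M, phi \in freeg.dom Phi -> integrable_cube w phi.

Definition integral_chain k n (M : dspace) (w : tkspace k M -> R) (Phi : chain n M) : R :=
  fglift (fun phi : {classic cube n M} => integral_cube w (phi : cube n M) : R^o) Phi.

End DifferentialSpaces.

(* Main.v *)
(* A tangent vector at a point of a space generated by coordinate functions is
   determined by its values on them: a derivation is local (bump functions) and obeys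
   the chain rule (Hadamard's lemma).  On a dense subset of the cube and on the box
   [-1,1]^G the partial derivatives of a smooth function of finitely many coordinates
   are determined by its restriction, boundary points included, so that every tangent
   vector extends to a constant vector field.  Hence a smooth form is locally
   [sum_b t_b dx^(b_1) ... dx^(b_k)] with finitely many terms, and, the bracket terms
   cancelling against the derivatives of the vector fields,
   [d w (v_0, ..., v_k) = sum_i (-1)^i sum_b v_i(t_b) prod_j v_(lift i j)(x^(b_j))].
   This expression is natural under smooth maps.  On the cube it is evaluated on the
   commuting fields [d/dx^i], where the brackets vanish, and becomes the divergence
   [sum_i (-1)^i d/dx^i w(..., omit d/dx^i, ...)]; the formula then follows from the
   fundamental theorem of calculus in each variable.  The smooth extension of a cube
   is obtained by restricting the extension of its tangent map to the zero section. *)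
From HB Require Import structures.
Require Import Defs.
From mathcomp Require Import freeg.
From mathcomp Require Import all_boot all_order all_fingroup all_algebra.
From mathcomp Require Import all_classical all_reals all_analysis.
From mathcomp Require Import ring lra zify.
Set Implicit Arguments.
Unset Strict Implicit.
Unset Printing Implicit Defensive.
Import Order.TTheory GRing.Theory Num.Theory.
Import numFieldNormedType.Exports.
Local Open Scope classical_set_scope.
Local Open Scope ring_scope.

(** * Smooth functions on R^n *)

Section Calculus.
Variable R : realType.

(** [dext] picks one value among those given by arbitrary vector fields, so nothing can be computed
    from it before this value is known to be independent of the choice. This is why a formula for it
    is established ahead of everything about cubes. The second obstacle is that the domain of a cube
    is only dense. All computations are therefore made on the whole of [0,1]^n: an extension [F] of
    [phi], followed by the inclusion into the box, pulls [teta] back to a single form there, and the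
    integrands over [phi] and over its faces are both read off from that form. Determinants enter as
    changes of frame: a form of top degree on the cube is known from its value on the coordinate
    fields, so an identity checked on that frame extends to all tangent vectors. *)

Lemma row_norm_ltP n (x : 'rV[R]_n) (e : R) : 0 < e ->
  reflect (forall i, `|x 0 i| < e) (`|x| < e).
Proof.
move=> e0; apply: (iffP idP) => [xe i|h].
  apply: le_lt_trans xe; rewrite /Num.norm/= mx_normrE.
  exact: (le_bigmax_cond _ (fun k : 'I_1 * 'I_n => `|x k.1 k.2|) (j := (0, i))).
rewrite /Num.norm/= mx_normrE; apply/bigmax_ltP; split=> // -[i j] _ /=.
by rewrite ord1.
Qed.

Lemma cvg_rowP n (T : Type) (F : set_system T) {FF : Filter F}
    (u : T -> 'rV[R]_n) (l : 'rV[R]_n) :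
  u @ F --> l <-> forall i, (fun t => u t 0 i : R) @ F --> (l 0 i : R).
Proof.
split=> [ul i|h].
  exact: (cvg_comp _ _ ul (@coord_continuous _ 1 n 0 i l)).
apply/cvgrPdist_lt => e e0; near=> t; apply/row_norm_ltP => //.
near: t; apply: filter_forall => i.
have /cvgrPdist_lt /(_ e e0) := h i; apply: filterS => t.
by rewrite !mxE.
Unshelve. all: by end_near. Qed.

Lemma near_gt0 (t : R) : 0 < t -> \forall u \near t, 0 < u.
Proof.
move=> t0; have := Nlt_nbhsl (_ : - t < 0); rewrite oppr_lt0 => /(_ t0).
by apply: filterS => u; rewrite oppr_lt0.
Qed.

Lemma is_deriveP (V : normedModType R) (f : V -> R) x v (d : R) :
  is_derive x v f d <->
  (fun h : R => h^-1 * (f (h *: v + x) - f x)) @ 0^' --> d.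
Proof.
split=> [[fx <-]|h]; first exact: fx.
by apply: DeriveDef; [apply/cvg_ex; exists d; exact: h|exact/cvg_lim].
Qed.


(** Positions are measured by their distance to [a], so that increments of either sign are treated
    alike. *)
Lemma MVT_any (f df : R -> R) (a b : R) :
  (forall t : R, `|t - a| <= `|b - a| -> is_derive t (1 : R) f (df t)) ->
  exists2 c : R, `|c - a| <= `|b - a| & f b - f a = df c * (b - a).
Proof.
move=> fd; have [ab|ab] := leP a b.
  have fd1 t : t \in `[a, b]%R -> is_derive t (1 : R) f (df t).
    rewrite in_itv/= => /andP[ac cb]; apply: fd.
    by rewrite !ger0_norm ?subr_ge0// lerD2r.
  have cf : {within `[a, b], continuous f}.
    by apply: derivable_within_continuous => t /fd1[].
  have [c] := MVT_segment ab (fun t tab => fd1 t (subset_itv_oo_cc tab)) cf.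
  rewrite in_itv/= => /andP[ac cb] ->; exists c => //.
  by rewrite !ger0_norm ?subr_ge0// lerD2r.
have fd1 t : t \in `[b, a]%R -> is_derive t (1 : R) f (df t).
  rewrite in_itv/= => /andP[bc ca]; apply: fd.
  by rewrite distrC [leRHS]distrC !ger0_norm ?subr_ge0 ?(ltW ab)// lerD2l lerN2.
have cf : {within `[b, a], continuous f}.
  by apply: derivable_within_continuous => t /fd1[].
have [c] := MVT_segment (ltW ab) (fun t tab => fd1 t (subset_itv_oo_cc tab)) cf.
rewrite in_itv/= => /andP[bc ca] E; exists c.
  by rewrite distrC [leRHS]distrC !ger0_norm ?subr_ge0 ?(ltW ab)// lerD2l lerN2.
by rewrite -opprB E -mulrN opprB.
Qed.

Lemma is_derive_line n (s : 'rV[R]_n -> R) i (z : 'rV[R]_n) (a : R) :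
  derivable s (z + a *: delta_mx 0 i) (delta_mx 0 i) ->
  is_derive a (1 : R) (fun h => s (z + h *: delta_mx 0 i))
    (pderiv i s (z + a *: delta_mx 0 i)).
Proof.
move=> /derivableP /is_deriveP h; apply/is_deriveP.
apply: cvg_trans h; apply: near_eq_cvg; near=> h.
by rewrite [h *: (1 : R)]mulr1 scalerDl addrCA.
Unshelve. all: by end_near. Qed.

(* Change the coordinates one at a time and apply the mean value theorem on each
   segment. *)
Lemma mean_value_row n (s : 'rV[R]_n -> R) (x y : 'rV[R]_n) :
  (forall i z, derivable s z (delta_mx 0 i)) ->
  exists2 xi : 'I_n -> 'rV[R]_n,
    (forall i j, `|xi i 0 j - x 0 j| <= `|y 0 j - x 0 j|) &
    s y - s x = \sum_i pderiv i s (xi i) * (y 0 i - x 0 i).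
Proof.
move=> ds; pose Z k : 'rV[R]_n := \row_i if (i < k)%N then y 0 i else x 0 i.
have ZS (i : 'I_n) : Z i.+1 = Z i + (y 0 i - x 0 i) *: delta_mx 0 i.
  apply/rowP => j; rewrite !mxE eqxx /=; have [->|ij] := eqVneq j i.
    by rewrite ltnS leqnn ltnn mulr1 addrC subrK.
  by rewrite mulr0 addr0 ltnS leq_eqVlt (inj_eq val_inj) (negbTE ij).
have st (i : 'I_n) : exists xi : 'rV[R]_n,
    (forall j, `|xi 0 j - x 0 j| <= `|y 0 j - x 0 j|) /\
    s (Z i.+1) - s (Z i) = pderiv i s xi * (y 0 i - x 0 i).
  have [c cle E] := @MVT_any (fun h => s (Z i + h *: delta_mx 0 i))
    (fun h => pderiv i s (Z i + h *: delta_mx 0 i)) 0 (y 0 i - x 0 i)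
    (fun t _ => is_derive_line (ds i _)).
  exists (Z i + c *: delta_mx 0 i); split; last first.
    by rewrite ZS; move: E; rewrite scale0r addr0 subr0.
  move=> j; rewrite !mxE eqxx /=; have [->|ij] := eqVneq j i.
    by rewrite ltnn mulr1 addrAC subrr add0r; move: cle; rewrite !subr0.
  by rewrite mulr0 addr0; case: ifP => // _; rewrite subrr normr0.
have [xi xiP] := choice st; exists xi => [i j|]; first by have [] := xiP i.
under eq_bigr do rewrite -(xiP _).2.
rewrite -(big_mkord xpredT (fun i => s (Z i.+1) - s (Z i))) telescope_sumr//.
by congr (s _ - s _); apply/rowP => j; rewrite !mxE ?ltn_ord.
Qed.

(** The increment of [s] is a combination of partial derivatives at points [xi h i] squeezed between
    [F x] and [F (h *: v + x)]. These points tend to [F x], and continuity of the partial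
    derivatives gives the limit. *)
Lemma is_derive_comp_row n (V : normedModType R) (s : 'rV[R]_n -> R)
    (f : 'I_n -> V -> R) x v (df : 'I_n -> R) :
  (forall i z, derivable s z (delta_mx 0 i)) ->
  (forall i, continuous (pderiv i s)) ->
  (forall i, is_derive x v (f i) (df i)) ->
  is_derive x v (fun y => s (\row_i f i y))
    (\sum_i pderiv i s (\row_i f i x) * df i).
Proof.
move=> ds cs fd; apply/is_deriveP.
pose F y : 'rV[R]_n := \row_i f i y.
have [xi xi1 xi2] : exists2 xi : R -> 'I_n -> 'rV[R]_n,
    (forall h i j, `|xi h i 0 j - F x 0 j| <= `|F (h *: v + x) 0 j - F x 0 j|) &
    forall h, s (F (h *: v + x)) - s (F x) =
      \sum_i pderiv i s (xi h i) * (F (h *: v + x) 0 i - F x 0 i).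
  pose xi h := s2val (cid2 (mean_value_row (F x) (F (h *: v + x)) ds)).
  by exists xi => h; rewrite /xi; case: cid2.
have cf i : (fun h : R => f i (h *: v + x)) @ 0^' --> f i x.
  have [+ _] := fd i; move=> /derivable1P/derivable1_diffP/differentiable_continuous.
  by move=> /cvg_within_filter/cvg_trans h; apply: h; rewrite scale0r add0r.
have cxi i : (fun h => xi h i) @ 0^' --> F x.
  apply/cvg_rowP => j; apply/cvgrPdist_lt => e e0.
  have /cvgrPdist_lt /(_ e e0) := cf j; apply: filterS => h.
  rewrite distrC => hh; rewrite distrC; apply: le_lt_trans hh.
  by apply: le_trans (xi1 h i j) _; rewrite !mxE.
have -> : (fun h : R => h^-1 * (s (F (h *: v + x)) - s (F x))) =
    (fun h => \sum_i pderiv i s (xi h i) * (h^-1 * (f i (h *: v + x) - f i x))).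
  apply/funext => h; rewrite xi2 mulr_sumr; apply: eq_bigr => i _.
  by rewrite !mxE mulrCA.
apply: cvg_big => [|i _]; first exact: add_continuous.
apply: cvgM; last exact/is_deriveP.
exact: (cvg_comp _ _ (cxi i) (cs i _)).
Unshelve. all: by end_near. Qed.

(** A derivative of a product or of a composition is a sum of products, a shape that iterated
    derivatives along a list do not preserve. With a finite order [N], closure properties follow by
    induction on [N]. *)
Fixpoint Ck (n N : nat) (f : 'rV[R]_n -> R) : Prop :=
  if N is N'.+1 then [/\ continuous f, forall i x, derivable f x (delta_mx 0 i)
    & forall i, Ck N' (pderiv i f)]
  else continuous f.

Lemma smoothRn_Ck n (f : 'rV[R]_n -> R) : smoothRn f <-> forall N, Ck N f.
Proof.
split=> [sf N|].
  elim: N f sf => [|N IH] f sf; first by have [] := sf [::].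
  have [c d] := sf [::]; split=> // i; apply: IH => s.
  by have := sf (rcons s i); rewrite foldr_rcons.
move=> h s; elim/last_ind: s f h => [|s i IH] f h; first by have [c d _] := h 1%N.
rewrite foldr_rcons; apply: IH => N; have [_ _ +] := h N.+1; exact.
Qed.

Lemma CkW n N (f : 'rV[R]_n -> R) : Ck N.+1 f -> Ck N f.
Proof.
elim: N f => [|N IH] f; first by case.
by case=> c d h; split=> // i; exact: IH (h i).
Qed.

Lemma Ck_continuous n N (f : 'rV[R]_n -> R) : Ck N f -> continuous f.
Proof. by case: N => [|N] // []. Qed.

Lemma Ck_cst n N (c : R) : Ck N (fun _ : 'rV[R]_n => c).
Proof.
elim: N c => [|N IH] c; first exact: cst_continuous.
split=> [|i x|i]; first exact: cst_continuous.
  exact: derivable_cst.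
have -> : pderiv i (fun _ : 'rV[R]_n => c) = (fun=> 0); last exact: IH.
by apply/funext => x; rewrite /pderiv; exact: derive_cst.
Qed.

Lemma Ck_add n N (f g : 'rV[R]_n -> R) : Ck N f -> Ck N g -> Ck N (fun x => f x + g x).
Proof.
elim: N f g => [|N IH] f g; first by move=> cf cg x; exact: (cvgD (cf x) (cg x)).
move=> [cf df hf] [cg dg hg]; split=> [x|i x|i].
- exact: (cvgD (cf x) (cg x)).
- exact: (derivableD (df i x) (dg i x)).
have -> : pderiv i (fun x => f x + g x) = (fun x => pderiv i f x + pderiv i g x).
  by apply/funext => x; exact: (deriveD (df i x) (dg i x)).
exact: IH (hf i) (hg i).
Qed.

Lemma Ck_mul n N (f g : 'rV[R]_n -> R) : Ck N f -> Ck N g -> Ck N (fun x => f x * g x).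
Proof.
elim: N f g => [|N IH] f g; first by move=> cf cg x; exact: (cvgM (cf x) (cg x)).
move=> Cf Cg; have [cf df hf] := Cf; have [cg dg hg] := Cg; split=> [x|i x|i].
- exact: (cvgM (cf x) (cg x)).
- exact: (derivableM (df i x) (dg i x)).
have -> : pderiv i (fun x => f x * g x) =
    (fun x => f x * pderiv i g x + g x * pderiv i f x).
  by apply/funext => x; exact: (deriveM (df i x) (dg i x)).
by apply: Ck_add; apply: IH; [exact: CkW|exact: hg|exact: CkW|exact: hf].
Qed.

Lemma Ck_sum n N (I : Type) (r : seq I) (f : I -> 'rV[R]_n -> R) :
  (forall i, Ck N (f i)) -> Ck N (fun x => \sum_(i <- r) f i x).
Proof.
move=> h; elim: r => [|i r IH].
  by under eq_fun do rewrite big_nil; exact: Ck_cst.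
by under eq_fun do rewrite big_cons; exact: Ck_add.
Qed.

Lemma Ck_comp m n N (s : 'rV[R]_n -> R) (f : 'I_n -> 'rV[R]_m -> R) :
  Ck N s -> (forall i, Ck N (f i)) -> Ck N (fun x => s (\row_i f i x)).
Proof.
have cont (s' : 'rV[R]_n -> R) (f' : 'I_n -> 'rV[R]_m -> R) : continuous s' ->
    (forall i, continuous (f' i)) -> continuous (fun x => s' (\row_i f' i x)).
  move=> cs cf x; apply: (cvg_comp (fun x => \row_i f' i x) s'); last exact: cs.
  apply/(@cvg_rowP _ _ (nbhs x) (nbhs_filter x)) => i; rewrite mxE.
  by under eq_fun do rewrite mxE; exact: cf.
elim: N s f => [|N IH] s f; first exact: cont.
move=> [cs ds hs] hf.
have H i x : is_derive x (delta_mx 0 i) (fun x => s (\row_i f i x))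
    (\sum_j pderiv j s (\row_i f i x) * pderiv i (f j) x).
  apply: is_derive_comp_row => // j; first exact: Ck_continuous (hs j).
  by apply: derivableP; have [_ + _] := hf j; apply.
split=> [|i x|i].
- by apply: cont => // i; exact: Ck_continuous (hf i).
- by have [] := H i x.
have -> : pderiv i (fun x => s (\row_i f i x)) =
    (fun x => \sum_j pderiv j s (\row_i f i x) * pderiv i (f j) x).
  by apply/funext => x; have [_ <-] := H i x.
apply: Ck_sum => j; apply: Ck_mul; last by have [_ _ +] := hf j; exact.
by apply: IH; [exact: hs|move=> k; exact: CkW].
Qed.

Lemma smoothRn_continuous n (f : 'rV[R]_n -> R) : smoothRn f -> continuous f.
Proof. by move=> /(_ [::])[]. Qed.

Lemma smoothRn_derivable n (f : 'rV[R]_n -> R) :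
  smoothRn f -> forall i x, derivable f x (delta_mx 0 i).
Proof. by move=> /(_ [::])[]. Qed.

Lemma smoothRn_pderiv n (f : 'rV[R]_n -> R) i : smoothRn f -> smoothRn (pderiv i f).
Proof. by move=> sf s; have := sf (rcons s i); rewrite foldr_rcons. Qed.

Lemma smoothRn_comp m n (s : 'rV[R]_n -> R) (f : 'I_n -> 'rV[R]_m -> R) :
  smoothRn s -> (forall i, smoothRn (f i)) -> smoothRn (fun x => s (\row_i f i x)).
Proof.
move=> /smoothRn_Ck ss sf; apply/smoothRn_Ck => N.
by apply: Ck_comp => // i; have /smoothRn_Ck := sf i.
Qed.

Lemma smoothRn_cst n (c : R) : smoothRn (fun _ : 'rV[R]_n => c).
Proof. by apply/smoothRn_Ck => N; exact: Ck_cst. Qed.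

Lemma smoothRn_coord n (i : 'I_n) : smoothRn (fun x : 'rV[R]_n => x 0 i).
Proof. by apply: smoothRn_poly; exact: Poly_coord. Qed.

Lemma smoothRn_add n (f g : 'rV[R]_n -> R) :
  smoothRn f -> smoothRn g -> smoothRn (fun x => f x + g x).
Proof.
by move=> /smoothRn_Ck sf /smoothRn_Ck sg; apply/smoothRn_Ck => N; exact: Ck_add.
Qed.

Lemma smoothRn_mul n (f g : 'rV[R]_n -> R) :
  smoothRn f -> smoothRn g -> smoothRn (fun x => f x * g x).
Proof.
by move=> /smoothRn_Ck sf /smoothRn_Ck sg; apply/smoothRn_Ck => N; exact: Ck_mul.
Qed.

Lemma is_derive_smooth n (V : normedModType R) (s : 'rV[R]_n -> R)
    (f : 'I_n -> V -> R) x v (df : 'I_n -> R) :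
  smoothRn s -> (forall i, is_derive x v (f i) (df i)) ->
  is_derive x v (fun y => s (\row_i f i y))
    (\sum_i pderiv i s (\row_i f i x) * df i).
Proof.
move=> ss; apply: is_derive_comp_row; first exact: smoothRn_derivable.
by move=> i; exact/smoothRn_continuous/smoothRn_pderiv.
Qed.

Lemma pderiv_comp m n (s : 'rV[R]_n -> R) (f : 'I_n -> 'rV[R]_m -> R) j x :
  smoothRn s -> (forall i, smoothRn (f i)) ->
  pderiv j (fun x => s (\row_i f i x)) x =
  \sum_i pderiv i s (\row_i f i x) * pderiv j (f i) x.
Proof.
move=> ss sf; apply: derive_val; apply: is_derive_smooth => // i.
by apply: derivableP; exact: smoothRn_derivable.
Qed.

(* The bump function is built from [h_m t = t^-m exp (-1/t)] for [t > 0], [0] for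
   [t <= 0], since [h_m' = h_(m+2) - m h_(m+1)]. *)
Definition flat m (t : R) : R := if 0 < t then t^-1 ^+ m * expR (- t^-1) else 0.

(** A single term of the exponential series bounds [expR t^-1] from below. The square on the right
    makes the derivative of [flat m] at 0 vanish. *)
Lemma flat_le m (t : R) : `|flat m t| <= m.+2`!%:R * t ^+ 2.
Proof.
rewrite /flat; case: ifPn => [t0|_]; last by rewrite normr0 mulr_ge0 ?sqr_ge0.
have u0 : 0 < t^-1 by rewrite invr_gt0.
rewrite ger0_norm ?mulr_ge0 ?exprn_ge0 ?expR_ge0 ?(ltW u0)//.
rewrite expRN ler_pdivrMr ?expR_gt0//.
have key : t^-1 ^+ m.+2 / m.+2`!%:R <= expR t^-1.
  by apply: (le_trans _ (expR_ge1Dxn m.+1 (ltW u0))); rewrite lerDr.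
have -> : t^-1 ^+ m = m.+2`!%:R * t ^+ 2 * (t^-1 ^+ m.+2 / m.+2`!%:R).
  rewrite -addn2 exprD exprVn; field.
  by rewrite pnatr_eq0 -lt0n fact_gt0 expf_neq0 gt_eqF.
by rewrite ler_pM2l// mulr_gt0 ?exprn_gt0// ltr0n fact_gt0.
Qed.

Lemma is_derive_flat m (t : R) :
  is_derive t (1 : R) (flat m) (flat m.+2 t - m%:R * flat m.+1 t).
Proof.
have [t0|t0|->] := ltgtP t 0.
- have -> : flat m.+2 t - m%:R * flat m.+1 t = 0.
    by rewrite /flat ltNge (ltW t0) mulr0 subrr.
  apply: (@near_eq_is_derive _ _ _ (cst 0)) => //.
  near=> u; rewrite /flat ltNge; have -> // : u <= 0.
  by apply: ltW; near: u; exact: lt_nbhsl.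
- apply: (@near_eq_is_derive _ _ _ (fun t : R => t^-1 ^+ m * expR (- t^-1))).
    near=> u; rewrite /flat; have -> // : 0 < u.
    by near: u; exact: near_gt0.
  have tn0 : t != 0 by rewrite gt_eqF.
  have i1 : is_derive t (1 : R) (fun t : R => t^-1) (- t ^- 2).
    by have := is_deriveV tn0 (is_derive_id t (1:R)); rewrite scaler1.
  have dV := is_deriveX m i1.
  have dE : is_derive t (1 : R) (fun t : R => expR (- t^-1)) (expR (- t^-1) * t ^- 2).
    by apply: is_derive_eq; rewrite opprK.
  have -> : (fun t : R => t^-1 ^+ m * expR (- t^-1)) =
      (([eta GRing.inv] : R -> R) ^+ m) * (fun t => expR (- t^-1)).
    by apply/funext => u; rewrite mulrfctE exprfctE.
  apply: is_derive_eq.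
  rewrite exprfctE /flat t0 /= /GRing.scale/=.
  case: m {dV} => [|m]; first by rewrite !mul0r subr0 !mulr0 addr0 expr0 exprVn; ring.
  by rewrite -!exprVn !exprS; ring.
- have -> : flat m.+2 0 - m%:R * flat m.+1 0 = 0 by rewrite /flat ltxx mulr0 subrr.
  apply/is_deriveP; apply/cvgrPdist_le => e e0; near=> h.
  rewrite sub0r normrN addr0 [h *: (1:R)]mulr1 {2}/flat ltxx subr0 normrM normfV.
  have h0 : h != 0 by near: h; exact: nbhs_dnbhs_neq.
  rewrite ler_pdivrMl ?normr_gt0//; apply: le_trans (flat_le m h) _.
  rewrite -real_normK ?num_real// expr2 mulrA mulrC ler_pM2l ?normr_gt0//.
  rewrite -ler_pdivlMl ?ltr0n ?fact_gt0//.
  by near: h; apply: dnbhs0_le; rewrite mulr_gt0 ?invr_gt0 ?ltr0n ?fact_gt0.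
Unshelve. all: by end_near.
Qed.

Lemma smoothRn_flat m : smoothRn (fun x : 'rV[R]_1 => flat m (x 0 0)).
Proof.
apply/smoothRn_Ck => N; elim: N m => [|N IH] m.
  move=> x; apply: (cvg_comp (fun x : 'rV[R]_1 => x 0 0) (flat m)); first exact: coord_continuous.
  have [+ _] := is_derive_flat m (x 0 0).
  by move=> /derivable1_diffP/differentiable_continuous.
have H i x : is_derive x (delta_mx 0 i) (fun x : 'rV[R]_1 => flat m (x 0 0))
    (flat m.+2 (x 0 0) + - m%:R * flat m.+1 (x 0 0)).
  have /is_deriveP h := is_derive_flat m (x 0 0).
  rewrite mulNr; apply/is_deriveP; apply: cvg_trans h; apply: near_eq_cvg; near=> h.
  by rewrite !mxE ord1 !eqxx.
split=> [x|i x|i].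
- by apply: (Ck_continuous (N := N)); exact: IH.
- by have [] := H i x.
have -> : pderiv i (fun x : 'rV[R]_1 => flat m (x 0 0)) =
    (fun x => flat m.+2 (x 0 0) + - m%:R * flat m.+1 (x 0 0)).
  by apply/funext => x; have [_ <-] := H i x.
apply: Ck_add; first exact: IH.
by apply: Ck_mul; [exact: Ck_cst|exact: IH].
Unshelve. all: by end_near. Qed.

(** The function is a product of one-variable bumps [flat 0 (e^2 - (y_i - a_i)^2)], each divided by
    its value [c] at the centre. *)
Lemma smooth_bump r (a : 'rV[R]_r) (e : R) : 0 < e ->
  exists chi : 'rV[R]_r -> R, [/\ smoothRn chi, chi a = 1 &
    forall y : 'rV[R]_r, (exists i, e <= `|y 0 i - a 0 i|) -> chi y = 0].
Proof.
move=> e0.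
pose c : R := flat 0 (e ^+ 2).
have c0 : c != 0 by rewrite /c /flat exprn_gt0// expr0 mul1r gt_eqF ?expR_gt0.
pose b i (y : 'rV[R]_r) : R := flat 0 (e ^+ 2 - (y 0 i - a 0 i) ^+ 2) / c.
exists (fun y => \prod_i b i y); split=> [||y [i yi]].
- elim: (index_enum _) => [|i s IH].
    by under eq_fun do rewrite big_nil; exact: smoothRn_cst.
  under eq_fun do rewrite big_cons; apply: smoothRn_mul => //.
  apply: smoothRn_mul; last exact: smoothRn_cst.
  have -> : (fun y : 'rV[R]_r => flat 0 (e ^+ 2 - (y 0 i - a 0 i) ^+ 2)) =
    (fun y => (fun x : 'rV[R]_1 => flat 0 (x 0 0))
      (\row_(j < 1) (e ^+ 2 + - 1 * ((y 0 i + - a 0 i) * (y 0 i + - a 0 i))))).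
    by apply/funext => y; rewrite mxE mulN1r expr2.
  apply: (smoothRn_comp (f := fun (_ : 'I_1) y => _) (smoothRn_flat 0)) => _.
  apply: smoothRn_add; first exact: smoothRn_cst.
  apply: smoothRn_mul; first exact: smoothRn_cst.
  by apply: smoothRn_mul; apply: smoothRn_add; (exact: smoothRn_coord || exact: smoothRn_cst).
- by rewrite big1// => i _; rewrite /b subrr expr0n subr0 divff.
apply/eqP; rewrite (bigD1 i)//= mulf_eq0; apply/orP; left.
rewrite /b /flat subr_gt0 ltNge -[in X in _ <= X]real_normK ?num_real//.
by rewrite lerXn2r ?nnegrE ?(ltW e0)//= mul0r.
Qed.

End Calculus.

(** * Integration over the cube *)

Section Integration.
Variable R : realType.

Lemma cvg_row_mx (T : Type) (F : set_system T) {FF : Filter F} m n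
    (u : T -> 'rV[R]_m) (v : T -> 'rV[R]_n) (a : 'rV[R]_m) (b : 'rV[R]_n) :
  u @ F --> a -> v @ F --> b -> (fun t => row_mx (u t) (v t)) @ F --> row_mx a b.
Proof.
move=> /cvg_rowP ua /cvg_rowP vb; apply/cvg_rowP => i.
case: (splitP i) => j ij.
  have -> : i = lshift n j by exact: val_inj.
  by rewrite row_mxEl; under eq_fun do rewrite row_mxEl; exact: ua.
have -> : i = rshift m j by exact: val_inj.
by rewrite row_mxEr; under eq_fun do rewrite row_mxEr; exact: vb.
Qed.

Lemma row_mx_insert n t (x : 'rV[R]_n) :
  row_mx (t%:M : 'rV_1) x = insert_coord (ord0 : 'I_n.+1) t x.
Proof.
apply/rowP => i; rewrite !mxE; case: splitP => j ij; rewrite ?mxE.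
  have -> : i = ord0 by apply: val_inj; rewrite /= ij ord1.
  by rewrite unlift_none ord1 eqxx.
have -> : i = lift ord0 j by apply: val_inj; rewrite /= ij.
by rewrite liftK.
Qed.

Lemma compact_ucube n : compact (@ucube R n).
Proof.
have := @rV_compact R n (fun=> `[0, 1]%classic) (fun=> @segment_compact R 0 1).
congr compact; apply/seteqP; split=> x /= h i; have := h i; by rewrite in_itv.
Qed.

(** * Integrals depending on a parameter *)

Definition jcont (T : topologicalType) n (f : T -> 'rV[R]_n -> R) :=
  continuous (fun z : T * 'rV[R]_n => f z.1 z.2).

Lemma jcont_cont (T : topologicalType) n (f : T -> 'rV[R]_n -> R) t :
  jcont f -> continuous (f t).
Proof.
move=> jf x; have h : (fun y => (t, y)) @ x --> (t, x).
  exact: (cvg_pair (cvg_cst t) (@cvg_id _ (nbhs x))).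
exact: (cvg_comp _ _ h (jf (t, x))).
Qed.

(** A tube argument: near each [(t0, x)] all values are within [e / 2] of [f t0 x], and compactness
    of the cube yields one neighbourhood of [t0] for all [x]. *)
Lemma jcont_unif (T : topologicalType) n (f : T -> 'rV[R]_n -> R) t0 e :
  jcont f -> 0 < e ->
  \forall t \near t0, forall x, ucube x -> `|f t x - f t0 x| < e.
Proof.
move=> jf e0.
have /compact_near_coveringP K := @compact_ucube n.
apply: (K T (nbhs t0) (fun t x => `|f t x - f t0 x| < e)) => x _.
have e20 : 0 < e / 2 by rewrite divr_gt0.
have /cvgrPdist_lt /(_ _ e20) [[A B] /= [A1 B1] AB] := jf (t0, x).
exists (B, A) => //= -[y t] /= [By At].
have := AB (t, y) (conj At By); have := AB (t0, y) (conj (nbhs_singleton A1) By).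
rewrite /= => h1 h2.
rewrite (splitr e) -[f t y](subrK (f t0 x)) -addrA.
by apply: le_lt_trans (ler_normD _ _) _; rewrite ltrD// distrC.
Qed.

(* [L] stands for the iterated integral over the cube: only linearity and
   [|L f| <= sup |f|] on continuous functions are needed to differentiate under
   the integral sign. *)
Definition mean n (L : ('rV[R]_n -> R) -> R) :=
  (forall (f g : 'rV[R]_n -> R) (a : R), continuous f -> continuous g ->
     L (fun x => a * f x + g x) = a * L f + L g) /\
  (forall (f : 'rV[R]_n -> R) (M : R), continuous f ->
     (forall x, ucube x -> `|f x| <= M) -> `|L f| <= M).

Lemma contB n (f g : 'rV[R]_n -> R) :
  continuous f -> continuous g -> continuous (fun x => f x - g x).
Proof. by move=> cf cg x; exact: (cvgB (cf x) (cg x)). Qed.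

Lemma contM n (f g : 'rV[R]_n -> R) :
  continuous f -> continuous g -> continuous (fun x => f x * g x).
Proof. by move=> cf cg x; exact: (cvgM (cf x) (cg x)). Qed.

Lemma meanB n (L : ('rV[R]_n -> R) -> R) (f g : 'rV[R]_n -> R) : mean L ->
  continuous f -> continuous g -> L f - L g = L (fun x => f x - g x).
Proof.
move=> [lin _] cf cg; rewrite addrC -[- L g]mulN1r -lin//.
by congr L; apply/funext => x; rewrite mulN1r addrC.
Qed.

Lemma meanZ n (L : ('rV[R]_n -> R) -> R) (f : 'rV[R]_n -> R) a : mean L ->
  continuous f -> a * L f = L (fun x => a * f x).
Proof.
move=> [lin bnd] cf; have c0 : continuous (fun _ : 'rV[R]_n => 0 : R) by exact: cst_continuous.
have L0 : L (fun=> 0) = 0.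
  by apply/eqP; rewrite -normr_le0; apply: bnd => // x _; rewrite normr0.
by rewrite -[LHS]addr0 -L0 -lin//; congr L; apply/funext => x; rewrite addr0.
Qed.

Lemma mean_continuous (T : topologicalType) n (L : ('rV[R]_n -> R) -> R)
    (f : T -> 'rV[R]_n -> R) : mean L -> jcont f -> continuous (fun t => L (f t)).
Proof.
move=> mL jf t0; apply/cvgrPdist_le => e e0.
have := jcont_unif t0 jf e0; apply: filterS => t h.
rewrite distrC meanB//; try exact: jcont_cont.
have [_] := mL; apply=> [|x /h/ltW//].
by apply: contB; exact: jcont_cont.
Qed.

(** By the mean value theorem the difference quotient at [x] is [df c x] for some [c] near [t0] that
    depends on [x]. The closeness of [df c x] to [df t0 x] is uniform over the cube, so the bound on
    [L] applies. *)
Lemma mean_derive n (L : ('rV[R]_n -> R) -> R) (f df : R -> 'rV[R]_n -> R) t0 :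
  mean L -> jcont f -> jcont df ->
  (\forall t \near t0, forall x, ucube x -> is_derive t (1 : R) (f ^~ x) (df t x)) ->
  is_derive t0 (1 : R) (fun t => L (f t)) (L (df t0)).
Proof.
move=> mL jf jdf fd; apply/is_deriveP; apply/cvgrPdist_le => e e0.
have : \forall t \near t0, forall x, ucube x ->
    is_derive t (1 : R) (f ^~ x) (df t x) /\ `|df t x - df t0 x| < e.
  have := jcont_unif t0 jdf e0; apply: filterS2 fd => t h1 h2 x cx.
  by split; [exact: h1|exact: h2].
case=> d d0 hd; near=> h.
have h0 : h != 0 by near: h; exact: nbhs_dnbhs_neq.
have hlt : `|h| < d by near: h; exact: dnbhs0_lt.
rewrite [h *: _]mulr1 meanB//; try exact: jcont_cont.
have cf t := jcont_cont (t:=t) jf; have cdf t := jcont_cont (t:=t) jdf.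
have [lin bnd] := mL.
rewrite meanZ//; last exact: contB.
have cZ : continuous (fun x => h^-1 * (f (h + t0) x - f t0 x)).
  by apply: contM; [exact: cst_continuous|exact: contB].
rewrite meanB//; apply: bnd => [|x cx]; first exact: contB.
have dt t : `|t - t0| <= `|h + t0 - t0| -> ball t0 d t.
  by rewrite addrK distrC => tle; exact: le_lt_trans tle _.
have [c cle ->] := @MVT_any _ (f ^~ x) (df ^~ x) t0 (h + t0)
  (fun t tle => (hd t (dt t tle) x cx).1).
rewrite addrK [h^-1 * _]mulrC mulfK// distrC; apply: ltW.
exact: (hd c (dt c cle) x cx).2.
Unshelve. all: by end_near. Qed.

(** The induction hypothesis makes the inner integral continuous in the outer variable, hence
    integrable, as linearity and the bound for the outer integral require. *)
Lemma mean_ucube n : mean (@integral_ucube R n).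
Proof.
elim: n => [|n IH].
  split=> [f g a _ _ //|f M _] /=; apply => -[].
  by case.
have jc (f : 'rV[R]_n.+1 -> R) : continuous f ->
    jcont (fun (t : R) (x : 'rV[R]_n) => f (row_mx (t%:M : 'rV_1) x)).
  move=> cf [t x].
  have h1 : (fun z : R * 'rV[R]_n => z.1) @ (t, x) --> t 
    by exact: (@cvg_fst _ _ (nbhs t) (nbhs x) _).
  have h2 : (fun z : R * 'rV[R]_n => z.2) @ (t, x) --> x 
    by exact: (@cvg_snd _ _ (nbhs t) (nbhs x) _).
  have h : (fun z : R * 'rV[R]_n => row_mx (z.1%:M : 'rV_1) z.2) @ (t, x) -->
      row_mx (t%:M : 'rV_1) x.
    apply: cvg_row_mx h2; apply/cvg_rowP => i; rewrite mxE ord1 eqxx.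
    by under eq_fun do rewrite mxE eqxx.
  exact: (cvg_comp _ _ h (cf _)).
have ci (f : 'rV[R]_n.+1 -> R) : continuous f ->
  lebesgue_measure.-integrable `[0, 1] (EFin \o (fun t : R =>
    integral_ucube (fun x : 'rV[R]_n => f (row_mx (t%:M : 'rV_1) x)))).
  move=> cf; apply: continuous_compact_integrable; first exact: segment_compact.
  by apply: continuous_subspaceT; apply: mean_continuous IH _; exact: jc.
split=> [f g a cf cg|f M cf fM] /=.
  rewrite -RintegralZl//; last exact: ci.
  rewrite -RintegralD//; last 2 first.
  - apply: (integrableZl _ _ (ci f cf)) => //.
  - exact: ci.
  apply: eq_Rintegral => t _; apply: IH.1; first exact: (jcont_cont (t:=t) (jc f cf)).
  exact: (jcont_cont (t:=t) (jc g cg)).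
have M0 : 0 <= M.
  apply: le_trans (fM 0 _) => // i; by rewrite mxE lexx ler01.
apply: le_trans (le_normr_Rintegral _ _) _ => //; first exact: ci.
have -> : M = \int[lebesgue_measure]_(t in `[0, 1]%classic) (cst M (t : R)).
  rewrite Rintegral_cst//.
  rewrite [X in M * fine X](_ : _ = 1%:E) ?mulr1//.
  have := @lebesgue_measure_itv R `[0, 1]%R.
  by rewrite /= lte_fin ltr01 oppr0 adde0.
apply: le_Rintegral => //.
- by have := integrable_norm (ci f cf).
- apply: continuous_compact_integrable; first exact: segment_compact.
  by apply: continuous_subspaceT; exact: cst_continuous.
move=> t t01; apply: IH.2 => [|x cx]; first exact: (jcont_cont (t:=t) (jc f cf)).
apply: fM => i; rewrite row_mx_insert mxE.
by case: unliftP => [l _|_]; [exact: cx|move: t01; rewrite /= in_itv].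
Qed.


Lemma jcont_comp (T T' : topologicalType) n (u : T -> T') (f : T' -> 'rV[R]_n -> R) :
  continuous u -> jcont f -> jcont (fun t => f (u t)).
Proof.
move=> cu jf z; have h : (fun z : T * 'rV[R]_n => (u z.1, z.2)) @ z --> (u z.1, z.2).
  exact: (cvg_pair (cvg_comp _ _ (@cvg_fst _ _ (nbhs z.1) (nbhs z.2) _) (cu _))
    (@cvg_snd _ _ (nbhs z.1) (nbhs z.2) _)).
exact: (cvg_comp _ _ h (jf _)).
Qed.

Lemma is_derive_along (V : normedModType R) (f : V -> R) (x v : V) (d : R) :
  is_derive (0 : R) (1 : R) (fun h => f (h *: v + x)) d -> is_derive x v f d.
Proof.
move=> /is_deriveP h; apply/is_deriveP; apply: cvg_trans h; apply: near_eq_cvg.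
by near=> h; rewrite [h *: (1 : R)]mulr1 addr0 scale0r add0r.
Unshelve. all: by end_near. Qed.

(** Differentiating in [y_i] under the integral brings out a factor [t] and replaces [s] by a
    partial derivative of [s], so the family over all [m] and [s] is closed under derivatives. The
    case [m = 0] gives the factors of Hadamard's lemma. *)
Lemma smooth_average n (s : 'rV[R]_n -> R) (a : 'rV[R]_n) m : smoothRn s ->
  smoothRn (fun y => integral_ucube (fun t : 'rV[R]_1 =>
    t 0 0 ^+ m * s (\row_i (a 0 i + t 0 0 * (y 0 i - a 0 i))))).
Proof.
have jc (s' : 'rV[R]_n -> R) m' : continuous s' ->
    jcont (fun (y : 'rV[R]_n) (t : 'rV[R]_1) =>
      t 0 0 ^+ m' * s' (\row_i (a 0 i + t 0 0 * (y 0 i - a 0 i)))).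
  move=> cs z.
  have ct : (fun z : 'rV[R]_n * 'rV[R]_1 => z.2 0 0) @ z --> z.2 0 0.
    exact: (cvg_comp _ _ (@cvg_snd _ _ (nbhs z.1) (nbhs z.2) _) (@coord_continuous _ _ _ 0 0 _)).
  have cy i : (fun z : 'rV[R]_n * 'rV[R]_1 => z.1 0 i) @ z --> z.1 0 i.
    exact: (cvg_comp _ _ (@cvg_fst _ _ (nbhs z.1) (nbhs z.2) _) (@coord_continuous _ _ _ 0 i _)).
  apply: cvgM; first exact: (cvg_comp _ _ ct (@exprn_continuous _ m' _)).
  have h : (fun z : 'rV[R]_n * 'rV[R]_1 => \row_i (a 0 i + z.2 0 0 * (z.1 0 i - a 0 i))) @ z -->
      \row_i (a 0 i + z.2 0 0 * (z.1 0 i - a 0 i)).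
    apply/(@cvg_rowP _ _ _ (nbhs z) (nbhs_filter z)) => i; rewrite mxE.
    under eq_fun do rewrite mxE.
    by apply: cvgD; [exact: cvg_cst|apply: cvgM => //; apply: cvgB => //; exact: cvg_cst].
  exact: (cvg_comp _ _ h (cs _)).
move=> ss; apply/smoothRn_Ck => N; elim: N m s ss => [|N IH] m s ss.
  by apply: mean_continuous (mean_ucube 1) _; apply: jc; exact: smoothRn_continuous.
have H i (x : 'rV[R]_n) : is_derive x (delta_mx 0 i) (fun y => integral_ucube (fun t : 'rV[R]_1 =>
      t 0 0 ^+ m * s (\row_i (a 0 i + t 0 0 * (y 0 i - a 0 i)))))
    (integral_ucube (fun t : 'rV[R]_1 =>
      t 0 0 ^+ m.+1 * pderiv i s (\row_i (a 0 i + t 0 0 * (x 0 i - a 0 i))))).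
  apply: is_derive_along.
  have cl : continuous (fun h : R => h *: delta_mx 0 i + x : 'rV[R]_n).
    move=> h; apply: (@continuousD _ _ _ (fun h : R => h *: delta_mx 0 i) (fun=> x)).
      exact: scalel_continuous.
    exact: cst_continuous.
  have -> : integral_ucube (fun t : 'rV[R]_1 =>
      t 0 0 ^+ m.+1 * pderiv i s (\row_i (a 0 i + t 0 0 * (x 0 i - a 0 i)))) =
    integral_ucube (fun t : 'rV[R]_1 => t 0 0 ^+ m.+1 * pderiv i s
      (\row_j (a 0 j + t 0 0 * ((0 *: delta_mx 0 i + x) 0 j - a 0 j)))).
    by rewrite scale0r add0r.
  apply: (mean_derive (df := fun (h : R) (t : 'rV[R]_1) => t 0 0 ^+ m.+1 * pderiv i s
      (\row_j (a 0 j + t 0 0 * ((h *: delta_mx 0 i + x) 0 j - a 0 j)))) (mean_ucube 1)).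
  - exact: (jcont_comp cl (jc s m (smoothRn_continuous ss))).
  - exact: (jcont_comp cl (jc _ m.+1 (smoothRn_continuous (smoothRn_pderiv i ss)))).
  near=> h; move=> t _.
  have dj (j : 'I_n) : is_derive h (1 : R)
      (fun h : R => a 0 j + t 0 0 * ((h *: delta_mx 0 i + x) 0 j - a 0 j))
      (t 0 0 * (j == i)%:R).
    apply/is_deriveP; apply: cvg_near_cst; near=> u.
    have u0 : u != 0 by near: u; exact: nbhs_dnbhs_neq.
    rewrite [u *: (1 : R)]mulr1 !mxE eqxx/=; by field.
  have := is_derive_smooth ss dj.
  rewrite (bigD1 i)//= big1 ?addr0 => [|j /negbTE ->]; last by rewrite !mulr0.
  rewrite eqxx mulr1 => dS.
  have := is_deriveZ (t 0 0 ^+ m) dS; congr is_derive.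
  by rewrite /GRing.scale/= exprS; ring.
split=> [x|i x|i].
- by apply: (Ck_continuous (N := N)); exact: IH.
- by have [] := H i x.
rewrite [pderiv i _](_ : _ = fun x : 'rV[R]_n => integral_ucube (fun t : 'rV[R]_1 =>
      t 0 0 ^+ m.+1 * pderiv i s (\row_i (a 0 i + t 0 0 * (x 0 i - a 0 i))))).
  exact/IH/smoothRn_pderiv.
by apply/funext => x; have [_ <-] := H i x.
Unshelve. all: by end_near. Qed.

Lemma FTC01 (f df : R -> R) : continuous f -> continuous df ->
  (forall t : R, 0 < t < 1 -> is_derive t (1 : R) f (df t)) ->
  \int[lebesgue_measure]_(t in `[0, 1]%classic) df t = f 1 - f 0.
Proof.
move=> cf cdf fd; rewrite /Rintegral (@continuous_FTC2 _ df f)//.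
- exact: continuous_subspaceT.
- split=> [t|  |]; first by rewrite in_itv/= => /fd[].
  + by apply: cvg_at_right_filter; exact: cf.
  + by apply: cvg_at_left_filter; exact: cf.
- by move=> t; rewrite in_itv/= => /fd[_ <-]; rewrite derive1E.
Qed.

Lemma mean_sum n (L : ('rV[R]_n -> R) -> R) (I : Type) (r : seq I) (c : I -> R)
    (f : I -> 'rV[R]_n -> R) : mean L -> (forall i, continuous (f i)) ->
  \sum_(i <- r) c i * L (f i) = L (fun x => \sum_(i <- r) c i * f i x).
Proof.
move=> mL cf.
have cS s : continuous (fun x => \sum_(i <- s) c i * f i x).
  elim: s => [|j s IH]; first by under eq_fun do rewrite big_nil; exact: cst_continuous.
  under eq_fun do rewrite big_cons.
  move=> x; apply: (@continuousD _ _ _ (fun x => c j * f j x)); last exact: IH.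
  by apply: contM => //; exact: cst_continuous.
elim: r => [|i r IH].
  have -> : (fun x : 'rV[R]_n => \sum_(i <- [::]) c i * f i x) = (fun x => 0 * 0).
    by apply/funext => x; rewrite big_nil mul0r.
  rewrite -(meanZ 0 mL (f := fun=> 0)) ?big_nil ?mul0r//; exact: cst_continuous.
have -> : (fun x => \sum_(j <- i :: r) c j * f j x) =
    (fun x => c i * f i x + \sum_(j <- r) c j * f j x).
  by apply/funext => x; rewrite big_cons.
by rewrite big_cons IH mL.1.
Qed.

(** The factor [h i y] is the integral over [t] in [0,1] of the partial derivative at
    [a + t (y - a)], and the identity is the fundamental theorem of calculus along the segment from
    [a] to [y]. The power [t ^+ 0] in [K] only gives it the shape of [smooth_average]. *)
Lemma hadamard n (s : 'rV[R]_n -> R) (a : 'rV[R]_n) : smoothRn s ->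
  exists h : 'I_n -> 'rV[R]_n -> R, [/\ forall i, smoothRn (h i),
    forall i, h i a = pderiv i s a &
    forall y, s y = s a + \sum_i (y 0 i - a 0 i) * h i y].
Proof.
move=> ss; pose K i (y : 'rV[R]_n) (t : 'rV[R]_1) :=
  t 0 0 ^+ 0 * pderiv i s (\row_i (a 0 i + t 0 0 * (y 0 i - a 0 i))).
have cl (y : 'rV[R]_n) : continuous (fun t : R => \row_i (a 0 i + t * (y 0 i - a 0 i)) : 'rV[R]_n).
  move=> t; apply/(@cvg_rowP _ _ _ (nbhs t) (nbhs_filter t)) => i; rewrite mxE.
  under eq_fun do rewrite mxE.
  exact: (cvgD (cvg_cst (a 0 i)) (cvgM (@cvg_id _ (nbhs t)) (cvg_cst (y 0 i - a 0 i)))).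
have c00 : continuous (fun t : 'rV[R]_1 => t 0 0) by exact: coord_continuous.
have cs i : continuous (pderiv i s) by apply: smoothRn_continuous; exact: smoothRn_pderiv.
have cK i y : continuous (K i y).
  apply: contM; first by under eq_fun do rewrite expr0; exact: cst_continuous.
  move=> t; apply: (@continuous_comp _ _ _
    (fun t : 'rV[R]_1 => \row_i (a 0 i + t 0 0 * (y 0 i - a 0 i))) (pderiv i s)); last exact: cs.
  exact: (@continuous_comp _ _ _ (fun t : 'rV[R]_1 => t 0 0)
    (fun t : R => \row_i (a 0 i + t * (y 0 i - a 0 i))) t (c00 t) (cl y (t 0 0))).
exists (fun i y => integral_ucube (K i y)); split=> [i|i|y].
- exact/smooth_average/smoothRn_pderiv.
- rewrite (_ : K i a = cst (pderiv i s a)); last first.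
    apply/funext => t; rewrite /K expr0 mul1r /=; congr (pderiv i s _).
    by apply/rowP => j; rewrite mxE subrr mulr0 addr0.
  have ML := mean_ucube 1.
  rewrite /= Rintegral_cst//.
  rewrite [X in _ * fine X](_ : _ = 1%:E) ?mulr1//.
  have := @lebesgue_measure_itv R `[0, 1]%R.
  by rewrite /= lte_fin ltr01 oppr0 adde0.
rewrite (mean_sum _ _ (mean_ucube 1))//=.
have dS (t : R) : is_derive t (1 : R) (fun t => s (\row_i (a 0 i + t * (y 0 i - a 0 i))))
    (\sum_i pderiv i s (\row_i (a 0 i + t * (y 0 i - a 0 i))) * (y 0 i - a 0 i)).
  apply: is_derive_smooth => // i; apply/is_deriveP; apply: cvg_near_cst; near=> u.
  have u0 : u != 0 by near: u; exact: nbhs_dnbhs_neq.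
  by rewrite [u *: (1 : R)]mulr1; field.
have := @FTC01 _ _ _ _ (fun t _ => dS t).
rewrite [X in s X - _](_ : _ = y); last by apply/rowP => i; rewrite mxE mul1r addrC subrK.
rewrite [X in _ - s X](_ : _ = a); last by apply/rowP => i; rewrite mxE mul0r addr0.
move=> FTC; rewrite -[LHS](subrK (s a)) addrC -{}FTC.
- congr (_ + _); apply: eq_Rintegral => t _; apply: eq_bigr => i _.
  by rewrite /K row_mx_insert !mxE unlift_none expr0 mul1r mulrC.
- move=> t; apply: (@continuous_comp _ _ _
    (fun t : R => \row_i (a 0 i + t * (y 0 i - a 0 i))) s); first exact: cl.
  exact: smoothRn_continuous.
- move=> t; apply: cvg_big => [|i _]; first exact: add_continuous.
  have cp : (fun t : R => pderiv i s (\row_i (a 0 i + t * (y 0 i - a 0 i)))) @ t -->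
      pderiv i s (\row_i (a 0 i + t * (y 0 i - a 0 i))).
    apply: (@continuous_comp _ _ _
      (fun t : R => \row_i (a 0 i + t * (y 0 i - a 0 i))) (pderiv i s)); first exact: cl.
    exact: cs.
  exact: (cvgM cp (cvg_cst _)).
Unshelve. all: by end_near. Qed.

Lemma integral_ucubeS n (f : 'rV[R]_n.+1 -> R) : integral_ucube f =
  \int[lebesgue_measure]_(t in `[0, 1]%classic)
    integral_ucube (fun x : 'rV[R]_n => f (insert_coord ord0 t x)).
Proof.
apply: eq_Rintegral => t _; congr integral_ucube; apply/funext => x.
by rewrite row_mx_insert.
Qed.

Lemma insert_insert n (j : 'I_n.+1) (a t : R) (y : 'rV[R]_n) :
  insert_coord (lift ord0 j) a (insert_coord (ord0 : 'I_n.+1) t y) =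
  insert_coord ord0 t (insert_coord j a y) :> 'rV[R]_n.+2.
Proof.
apply/rowP => i; rewrite !mxE.
case: (unliftP ord0 i) => [k ->|->].
  rewrite mxE; case: (unliftP j k) => [l ->|->]; last by rewrite unlift_none.
  have -> : lift ord0 (lift j l) = lift (lift ord0 j) (lift ord0 l).
    by apply: val_inj; rewrite /= /bump /= !add1n addnS ltnS.
  by rewrite liftK mxE liftK.
have -> : ord0 = lift (lift ord0 j) ord0 :> 'I_n.+2 by apply: val_inj.
by rewrite liftK mxE unlift_none.
Qed.

Lemma ucube_insert n (i : 'I_n) (t : R) (x : 'rV[R]_n.-1) :
  0 <= t <= 1 -> ucube x -> ucube (insert_coord i t x).
Proof. by move=> t01 cx j; rewrite mxE; case: unliftP. Qed.

Lemma cvg_insert n (i : 'I_n) (t : R) (x : 'rV[R]_n.-1) :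
  (fun z : R * 'rV[R]_n.-1 => insert_coord i z.1 z.2) @ (t, x) --> insert_coord i t x.
Proof.
apply/(@cvg_rowP _ _ _ (nbhs (t, x)) (nbhs_filter (t, x))) => j; rewrite mxE.
under eq_fun do rewrite mxE.
case: unliftP => [l _|_]; last exact: (@cvg_fst _ _ (nbhs t) (nbhs x) _).
exact: (cvg_comp _ _ (@cvg_snd _ _ (nbhs t) (nbhs x) _) (@coord_continuous _ _ _ 0 l _)).
Qed.

Lemma jcont_insert n (i : 'I_n) (f : 'rV[R]_n -> R) : continuous f ->
  jcont (fun (t : R) x => f (insert_coord i t x)).
Proof. by move=> cf [t x]; exact: (cvg_comp _ _ (cvg_insert (i:=i) (t:=t) (x:=x)) (cf _)). Qed.

(** Coordinate 0 is integrated outermost. If [i] is that coordinate, the derivative is moved out of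
    the inner integral and the one-variable theorem applies. Otherwise the induction hypothesis is
    used for each fixed value of coordinate 0, since insertions at different places commute. *)
Lemma integral_ucube_FTC n (i : 'I_n) (f df : 'rV[R]_n -> R) :
  continuous f -> continuous df ->
  (forall (x : 'rV[R]_n.-1) (t : R), ucube x -> 0 < t < 1 ->
     is_derive t (1 : R) (fun t => f (insert_coord i t x)) (df (insert_coord i t x))) ->
  integral_ucube df = integral_ucube (fun x => f (insert_coord i 1 x)) -
                      integral_ucube (fun x => f (insert_coord i 0 x)).
Proof.
elim: n i f df => [[]//|n IH] i f df cf cdf fd.
case: (unliftP ord0 i) fd => [j ->|->] fd; last first.
  have jf := jcont_insert (i := ord0) cf; have jdf := jcont_insert (i := ord0) cdf.
  refine (etrans _ (@FTC01 (fun t => integral_ucube (fun x => f (insert_coord ord0 t x)))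
     (fun t => integral_ucube (fun x => df (insert_coord ord0 t x))) _ _ _)).
  - by apply: eq_Rintegral => t _; congr integral_ucube; apply/funext => x; rewrite row_mx_insert.
  - exact: (mean_continuous (mean_ucube n) jf).
  - exact: (mean_continuous (mean_ucube n) jdf).
  move=> t /andP[t0 t1]; apply: (mean_derive (mean_ucube n) jf jdf).
  near=> u; move=> x cx; apply: fd => //; apply/andP; split; near: u.
    exact: near_gt0.
  exact: lt_nbhsl.
clear i; case: n IH j f df cf cdf fd => [|n] IH j f df cf cdf fd; first by case: j {fd}.
have jf := jcont_insert (i := ord0) cf; have jdf := jcont_insert (i := ord0) cdf.
have cins a : continuous (insert_coord j a : 'rV[R]_n -> 'rV[R]_n.+1).
  move=> x; have h : (fun x => (a, x)) @ x --> (a, x).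
    exact: (cvg_pair (cvg_cst a) (@cvg_id _ (nbhs x))).
  exact: (cvg_comp _ _ h (cvg_insert (i:=j) (t:=a) (x:=x))).
have ja a : jcont (fun (t : R) x => f (insert_coord ord0 t (insert_coord j a x))).
  move=> [t x].
  have h : (fun z : R * 'rV[R]_n => (z.1, insert_coord j a z.2)) @ (t, x) -->
      (t, insert_coord j a x).
    exact: (cvg_pair (@cvg_fst _ _ (nbhs t) (nbhs x) _)
      (cvg_comp _ _ (@cvg_snd _ _ (nbhs t) (nbhs x) _) (cins a x))).
  exact: (cvg_comp _ _ h (jf _)).
have ia a : lebesgue_measure.-integrable `[0, 1] (EFin \o (fun t : R =>
    integral_ucube (fun x => f (insert_coord ord0 t (insert_coord j a x))))).
  apply: continuous_compact_integrable; first exact: segment_compact.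
  by apply: continuous_subspaceT; exact: (mean_continuous (mean_ucube n) (ja a)).
have E a : integral_ucube (fun x : 'rV[R]_n.+1 => f (insert_coord (lift ord0 j) a x)) =
    \int[lebesgue_measure]_(t in `[0, 1]%classic)
      integral_ucube (fun x : 'rV[R]_n => f (insert_coord ord0 t (insert_coord j a x))).
  rewrite integral_ucubeS; apply: eq_Rintegral => t _; congr integral_ucube.
  by apply/funext => x; rewrite insert_insert.
rewrite integral_ucubeS !E -RintegralB//; try exact: ia.
apply: eq_Rintegral => t; rewrite inE/= in_itv/= => t01.
apply: (IH j (fun x => f (insert_coord ord0 t x))
  (fun x => df (insert_coord ord0 t x)) (jcont_cont (t := t) jf) (jcont_cont (t := t) jdf)).
move=> x u cx u01; have := fd (insert_coord (ord0 : 'I_n.+1) t x) u.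
rewrite insert_insert; under eq_fun do rewrite insert_insert.
by apply=> //; exact: ucube_insert.
Unshelve. all: by end_near. Qed.

End Integration.

(** * Differential spaces *)

Section Families.
Variables (T : Type) (r r' : nat) (g : 'I_r -> T) (g' : 'I_r' -> T).

Definition cat_fam (i : 'I_(r + r')) : T :=
  match fintype.split i with inl j => g j | inr j => g' j end.

Lemma cat_faml i : cat_fam (lshift r' i) = g i.
Proof. by rewrite /cat_fam (unsplitK (inl i)). Qed.

Lemma cat_famr i : cat_fam (rshift r i) = g' i.
Proof. by rewrite /cat_fam (unsplitK (inr i)). Qed.

Lemma cat_famP (P : T -> Prop) :
  (forall i, P (g i)) -> (forall i, P (g' i)) -> forall i, P (cat_fam i).
Proof. by move=> h h' i; rewrite /cat_fam; case: fintype.split. Qed.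

End Families.

Section DSpaces.
Variable R : realType.

Lemma weak_unif_continuous (T : topologicalType) (N : choiceType)
    (D : set (N -> R)) (F : T -> N) :
  (forall f, D f -> continuous (f \o F)) -> continuous (F : T -> weak_unif D).
Proof.
move=> h p; have FF : Filter (F @ nbhs p) by exact: fmap_filter.
apply/cvg_sup => i.
have : continuous (F : T -> initial_topology (val i)).
  by apply: continuous_comp_initial; apply: h; exact: set_valP.
by move/(_ p).
Qed.

(** An explicit neighbourhood filter, with finitely many generators and one radius. The bump
    functions and the rescaling of vectors used below need such a radius, which the supremum
    topology does not exhibit. *)
Definition weak_box (M : choiceType) (G : set (M -> R)) (p : M) : set_system M :=
  [set U | exists r (g : 'I_r -> M -> R) (e : R), [/\ forall i, G (g i), 0 < e &
    forall q, (forall i, `|g i q - g i p| < e) -> U q]].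

Lemma weak_box_filter (M : choiceType) (G : set (M -> R)) (p : M) : Filter (weak_box G p).
Proof.
split.
- by exists 0%N, (fun=> cst 0), 1; split=> // -[].
- move=> U V [r [g [e [Gg e0 gU]]]] [r' [g' [e' [Gg' e'0 gV]]]].
  exists (r + r')%N, (cat_fam g g'), (Num.min e e').
  split=> [i||q hq].
  + exact: cat_famP.
  + by rewrite lt_min e0.
  + split; [apply: gU => i; have := hq (lshift r' i)|apply: gV => i; have := hq (rshift r i)].
      by rewrite cat_faml lt_min => /andP[].
    by rewrite cat_famr lt_min => /andP[].
- move=> U V UV [r [g [e [Gg e0 gU]]]]; exists r, g, e; split=> // q /gU; exact: UV.
Qed.

Lemma nbhs_weak_unif (M : choiceType) (G : set (M -> R)) (p : M) :
  nbhs (p : weak_unif G) = weak_box G p.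
Proof.
apply/seteqP; split=> U.
  have FF := weak_box_filter G p.
  suff h : weak_box G p --> (p : weak_unif G) by exact: h.
  apply/cvg_sup => i V.
  rewrite nbhsE => -[W [[W' oW' <-] W'p] WV].
  have /nbhs_ballP[e e0 be] : nbhs (val i p) W' by apply: open_nbhs_nbhs.
  exists 1%N, (fun=> val i), e; split=> // [_|q /(_ ord0) hq]; first exact: set_valP.
  by apply: WV; apply: be; rewrite -ball_normE /ball_ /= distrC.
move=> [r [g [e [Gg e0 gU]]]].
have H i : nbhs (p : weak_unif G) [set q | `|g i q - g i p| < e].
  have c : continuous (g i : weak_unif G -> R) by exact: weak_fun_continuous.
  have /cvgrPdist_lt /(_ e e0) := c p.
  by apply: filterS => q; rewrite /= distrC.
have := filter_forall (nbhs_filter (p : weak_unif G)) H.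
exact: filterS.
Qed.

Lemma smooth_weak_continuous (M : choiceType) (G : set (M -> R)) r
    (g : 'I_r -> M -> R) (s : 'rV[R]_r -> R) :
  (forall i, G (g i)) -> continuous s ->
  continuous ((fun q => s (\row_i g i q)) : weak_unif G -> R).
Proof.
move=> Gg cs p.
have h : (fun q : weak_unif G => \row_i g i q) @ p --> \row_i g i p.
  apply/(@cvg_rowP _ _ _ (nbhs p) (nbhs_filter p)) => i; rewrite mxE.
  by under eq_fun do rewrite mxE; exact: weak_fun_continuous.
exact: (cvg_comp _ _ h (cs _)).
Qed.

Definition locally_smooth (M : choiceType) (G : set (M -> R)) (f : M -> R) (p : M) :=
  exists r (g : 'I_r -> M -> R) (s : 'rV[R]_r -> R), [/\ forall i, G (g i), smoothRn s &
    \forall q \near (p : weak_unif G), f q = s (\row_i g i q)].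

Lemma locally_smooth_continuous (M : choiceType) (G : set (M -> R)) (f : M -> R) :
  (forall p, locally_smooth G f p) -> continuous (f : weak_unif G -> R).
Proof.
move=> h p; have [r [g [s [Gg ss fE]]]] := h p.
have fp : f p = s (\row_i g i p) := nbhs_singleton fE.
have c : continuous ((fun q => s (\row_i g i q)) : weak_unif G -> R).
  by apply: smooth_weak_continuous => //; exact: smoothRn_continuous.
have : (fun q : weak_unif G => s (\row_i g i q)) @ p --> f p by rewrite fp; exact: c.
apply: cvg_trans; apply: (@near_eq_cvg _ _ _ (nbhs_filter p)).
by apply: filterS fE => q /= ->.
Qed.

(** Concatenating the lists of generators makes several functions depend on the same variables, so
    that they can be substituted in one smooth function. *)
Lemma locally_smooth_common (M : choiceType) (G : set (M -> R)) (p : M) n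
    (f : 'I_n -> M -> R) : (forall i, locally_smooth G (f i) p) ->
  exists r (g : 'I_r -> M -> R) (s : 'I_n -> 'rV[R]_r -> R),
    [/\ forall i, G (g i), forall i, smoothRn (s i) &
    \forall q \near (p : weak_unif G), forall i, f i q = s i (\row_j g j q)].
Proof.
elim: n f => [|n IH] f h.
  exists 0%N, (fun=> cst 0), (fun=> cst 0); split=> [[]//|[]//|].
  by near=> q; case.
have [r [g [s [Gg ss fE]]]] := IH (fun i => f (lift ord0 i)) (fun i => h _).
have [r' [g' [s' [Gg' ss' fE']]]] := h ord0.
exists (r + r')%N, (cat_fam g g').
exists (fun i => if unlift ord0 i is Some j
  then fun x => s j (\row_k x 0 (lshift r' k)) else fun x => s' (\row_k x 0 (rshift r k))).
split=> [i|i|]; first exact: cat_famP.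
  case: unlift => [j|].
    apply: (smoothRn_comp (f := fun k (x : 'rV[R]_(r + r')) => x 0 (lshift r' k)) (ss j)).
    by move=> k; exact: smoothRn_coord.
  apply: (smoothRn_comp (f := fun k (x : 'rV[R]_(r + r')) => x 0 (rshift r k)) ss').
  by move=> k; exact: smoothRn_coord.
apply: filterS2 fE fE' => q h1 h2 i.
case: (unliftP ord0 i) => [j ->|->].
  rewrite h1; congr (s j _); apply/rowP => k; rewrite !mxE.
  by rewrite cat_faml.
rewrite h2; congr (s' _); apply/rowP => k; rewrite !mxE.
by rewrite cat_famr.
Unshelve. all: by end_near. Qed.

(** The locally smooth functions form a differential structure containing [G]. The delicate clause
    is locality, where neighbourhoods are those of the topology of all locally smooth functions.
    They are neighbourhoods for [G] too, because locally smooth functions are continuous. *)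
Lemma gen_locally_smooth (M : choiceType) (G : set (M -> R)) (f : M -> R) :
  gen_struct G f -> forall p, locally_smooth G f p.
Proof.
suff sub : gen_struct G `<=` [set f | forall p, locally_smooth G f p] by exact: sub.
apply: smallest_sub => [|g Gg p]; last first.
  exists 1%N, (fun=> g), (fun x => x 0 0); split=> //; first exact: smoothRn_coord.
  by near=> q; rewrite mxE.
split=> [r s u ss hu p|u loc p].
  have [m [g [t [Gg st uE]]]] := locally_smooth_common (fun i => hu i p).
  exists m, g, (fun x => s (\row_i t i x)); split=> //; first exact: smoothRn_comp.
  apply: filterS uE => q h; congr s; apply/rowP => i; by rewrite !mxE.
have [g hg ug] := loc p; have [r [g' [s [Gg' ss gE]]]] := hg p.
exists r, g', s; split=> //.
have ci : continuous (id : weak_unif G -> weak_unif [set f | forall p, locally_smooth G f p]).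
  by apply: weak_unif_continuous => f' hf'; exact: locally_smooth_continuous.
by have := ci p _ ug; apply: filterS2 gE => q h1 h2; rewrite h2 -h1.
Unshelve. all: by end_near. Qed.

Lemma gen_continuous (M : choiceType) (G : set (M -> R)) (f : M -> R) :
  gen_struct G f -> continuous (f : weak_unif G -> R).
Proof. by move=> Gf; apply: locally_smooth_continuous; exact: gen_locally_smooth. Qed.

Lemma near_gen (M : choiceType) (G : set (M -> R)) (p : M) (U : set M) :
  nbhs (p : weak_unif (gen_struct G)) U <-> nbhs (p : weak_unif G) U.
Proof.
split=> h.
  have ci : continuous (id : weak_unif G -> weak_unif (gen_struct G)).
    by apply: weak_unif_continuous => f; exact: gen_continuous.
  exact: (ci p _ h).
have ci : continuous (id : weak_unif (gen_struct G) -> weak_unif G).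
  by apply: weak_map_continuous => f Gf; exact: gen_structS.
exact: (ci p _ h).
Qed.

(** * Derivations: locality and the chain rule *)

Section Tangent.
Variable M : dspace R.
Implicit Types (f g h : @dfun R M) (p : M).

Definition Dfun (f : M -> R) (df : dfun f) : @dfun R M := SigSub (mem_set df).

Lemma dfun_smooth r (s : 'rV[R]_r -> R) (f : 'I_r -> M -> R) :
  smoothRn s -> (forall i, dfun (f i)) -> dfun (fun p => s (\row_i f i p)).
Proof. exact: (dfunP M).1. Qed.

Lemma dfun_cst (c : R) : @dfun R M (fun=> c).
Proof.
by apply: (@dfun_smooth 0 (fun=> c) (fun=> fun=> 0) _) => [|[]//]; exact: smoothRn_cst.
Qed.

Lemma dfun_add (f g : M -> R) : dfun f -> dfun g -> dfun (fun p => f p + g p).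
Proof.
move=> df dg.
pose s (x : 'rV[R]_2) := x 0 0 + x 0 1.
have ss : smoothRn s by apply: smoothRn_add; exact: smoothRn_coord.
have := dfun_smooth (f := fun i => if i == 0 then f else g) ss.
have -> : (fun p => s (\row_i (if i == 0 then f else g) p)) = (fun p => f p + g p).
  by apply/funext => p; rewrite /s !mxE.
by apply=> i; case: ifP.
Qed.

Lemma dfun_sum (I : Type) (r : seq I) (f : I -> M -> R) :
  (forall i, dfun (f i)) -> dfun (fun p => \sum_(i <- r) f i p).
Proof.
move=> df; elim: r => [|i r IH].
  by under eq_fun do rewrite big_nil; exact: dfun_cst.
by under eq_fun do rewrite big_cons; exact: (dfun_add (df i) IH).
Qed.

Lemma dfun_prod (I : Type) (r : seq I) (f : I -> M -> R) :
  (forall i, dfun (f i)) -> dfun (fun p => \prod_(i <- r) f i p).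
Proof.
move=> df; elim: r => [|i r IH].
  by under eq_fun do rewrite big_nil; exact: dfun_cst.
by under eq_fun do rewrite big_cons; exact: (dfun_mul (df i) IH).
Qed.

Variables (p : M) (v : tangent p).

Lemma tangent_lin a b f g h : (forall q, val h q = a * val f q + b * val g q) ->
  val v h = a * val v f + b * val v g.
Proof. exact: (set_valP v).1. Qed.

Lemma tangent_leibniz f g h : (forall q, val h q = val f q * val g q) ->
  val v h = val f p * val v g + val g p * val v f.
Proof. exact: (set_valP v).2. Qed.

Lemma tangent_add f g h : (forall q, val h q = val f q + val g q) ->
  val v h = val v f + val v g.
Proof.
by move=> hE; rewrite (@tangent_lin 1 1 f g) ?mul1r// => q; rewrite !mul1r.
Qed.

Lemma tangent_cst c h : (forall q, val h q = c) -> val v h = 0.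
Proof.
move=> hE; pose one := Dfun (dfun_cst 1).
have v1 : val v one = 0.
  have := @tangent_leibniz one one one (fun q => esym (mulr1 _)).
  by rewrite mul1r => /eqP; rewrite -subr_eq0 opprD addrA subrr sub0r oppr_eq0 => /eqP.
rewrite (@tangent_lin c 0 one one) ?v1 ?mulr0 ?addr0// => q.
by rewrite hE mul0r addr0 mulr1.
Qed.

Lemma tangent_sum (I : Type) (r : seq I) (f : I -> @dfun R M) h :
  (forall q, val h q = \sum_(i <- r) val (f i) q) ->
  val v h = \sum_(i <- r) val v (f i).
Proof.
elim: r h => [|i r IH] h hE.
  by rewrite big_nil; apply: (@tangent_cst 0) => q; rewrite hE big_nil.
pose g := Dfun (dfun_sum r (fun i => set_valP (f i))).
rewrite big_cons -(IH g)//; apply: tangent_add => q.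
by rewrite hE big_cons.
Qed.

Lemma tangent_local f g :
  (\forall q \near (p : weak_unif (@dfun R M)), val f q = val g q) -> val v f = val v g.
Proof.
rewrite /prop_near1 nbhs_weak_unif => -[r [u [e [du e0 fg]]]].
have [chi [schi chi1 chi0]] := smooth_bump (\row_i u i p) e0.
pose X := Dfun (dfun_smooth schi du).
pose N := Dfun (dfun_mul (dfun_cst (-1)) (set_valP g)).
have NE q : val N q = - val g q by rewrite /= mulN1r.
pose D := Dfun (dfun_add (set_valP f) (set_valP N)).
(* [Z] is the bump times the difference, which vanishes everywhere. By the Leibniz rule at [p],
   where [X] is 1 and [D] is 0, [v] takes the same value on [Z] and on [D]. *)
pose Z := Dfun (dfun_mul (set_valP X) (set_valP D)).
have fgp : val f p = val g p.
  by apply: fg => i; rewrite subrr normr0.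
have Z0 : val v Z = 0.
  apply: (@tangent_cst 0) => q; rewrite /=.
  have [hq|] := pselect (forall i, `|u i q - u i p| < e).
    by rewrite fg// mulN1r subrr mulr0.
  move=> /existsNP[i /negP]; rewrite -leNgt => hi.
  by rewrite chi0 ?mul0r//; exists i; rewrite !mxE.
have := @tangent_leibniz X D Z (fun=> erefl).
have -> : val X p = 1 by rewrite /= chi1.
have -> : val D p = 0 by rewrite /= fgp mulN1r subrr.
rewrite Z0 mul1r mul0r addr0 => vD.
have := @tangent_add f N D (fun=> erefl); rewrite -vD.
rewrite (@tangent_lin (-1) 0 g g N) => [|q]; last by rewrite mul0r addr0 mulN1r.
by rewrite mul0r addr0 mulN1r => /eqP; rewrite eq_sym subr_eq0 => /eqP.
Qed.

(** In Hadamard's expansion at the image of [p], each product has a factor [f i - a_i] vanishing at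
    [p]. The Leibniz rule thus leaves the other factor at [p], a partial derivative of [s], times
    [v (f i)]. *)
Lemma tangent_comp r (s : 'rV[R]_r -> R) (f : 'I_r -> @dfun R M) h : smoothRn s ->
  (\forall q \near (p : weak_unif (@dfun R M)), val h q = s (\row_i val (f i) q)) ->
  val v h = \sum_i pderiv i s (\row_i val (f i) p) * val v (f i).
Proof.
move=> ss hE; pose a := \row_i val (f i) p.
have [u [su ua sE]] := hadamard a ss.
rewrite (@tangent_local h (Dfun (dfun_smooth ss (fun i => set_valP (f i)))))//.
pose c := Dfun (dfun_cst (s a)).
pose Y i := Dfun (dfun_add (set_valP (f i)) (dfun_cst (- a 0 i))).
pose H i := Dfun (dfun_smooth (su i) (fun j => set_valP (f j))).
pose YH i := Dfun (dfun_mul (set_valP (Y i)) (set_valP (H i))).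
pose S := Dfun (dfun_sum (index_enum 'I_r) (fun i => set_valP (YH i))).
rewrite (@tangent_add c S) => [|q]; last first.
  by rewrite /= sE; congr (_ + _); apply: eq_bigr => i _; rewrite mxE.
rewrite (@tangent_cst _ c (fun=> erefl)) add0r.
rewrite (@tangent_sum _ (index_enum 'I_r) YH)//.
apply: eq_bigr => i _; rewrite (@tangent_leibniz (Y i) (H i))//.
have -> : val (Y i) p = 0 by rewrite /= mxE subrr.
rewrite mul0r add0r /= ua; congr (_ * _).
rewrite (@tangent_add (f i) (Dfun (dfun_cst (- a 0 i))))//.
by rewrite (@tangent_cst _ (Dfun (dfun_cst (- a 0 i))) (fun=> erefl)) addr0.
Qed.

End Tangent.

End DSpaces.

(** * Multilinear maps *)

Section Multilinear.
Variable R : realType.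

Definition mlin k (I : Type) (W : ('I_k -> I -> R) -> R) :=
  forall i (a b : R) (u v z : 'I_k -> I -> R),
    (forall j, j != i -> u j = z j /\ v j = z j) ->
    (forall l, z i l = a * u i l + b * v i l) -> W z = a * W u + b * W v.

Definition fcons k (T : Type) (t : T) (c : 'I_k -> T) (i : 'I_k.+1) : T :=
  if unlift ord0 i is Some j then c j else t.

Lemma fcons0 k T (t : T) (c : 'I_k -> T) : fcons t c ord0 = t.
Proof. by rewrite /fcons unlift_none. Qed.

Lemma fconsS k T (t : T) (c : 'I_k -> T) i : fcons t c (lift ord0 i) = c i.
Proof. by rewrite /fcons liftK. Qed.

Lemma fconsE k T (c : 'I_k.+1 -> T) : c = fcons (c ord0) (fun j => c (lift ord0 j)).
Proof.
by apply/funext => i; case: (unliftP ord0 i) => [j ->|->]; rewrite ?fcons0 ?fconsS.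
Qed.

Lemma mlin_fcons k (I : Type) (W : ('I_k.+1 -> I -> R) -> R) t :
  mlin W -> mlin (fun c => W (fcons t c)).
Proof.
move=> mW i a b u v z h1 h2; apply: (mW (lift ord0 i)) => [j|l]; last by rewrite !fconsS.
case: (unliftP ord0 j) => [j' ->|->] ji; rewrite ?fcons0// !fconsS.
by apply: h1; apply: contraNneq ji => ->.
Qed.

Lemma mlin_scale k (I : Type) (W : ('I_k -> I -> R) -> R) (c : 'I_k -> I -> R) (a : R) :
  mlin W -> W (fun j l => a * c j l) = a ^+ k * W c.
Proof.
elim: k W c => [|k IH] W c mW.
  by rewrite mul1r; congr W; apply/funext => -[].
rewrite [X in W X]fconsE (IH (fun c' => W (fcons _ c'))); last exact: mlin_fcons.
rewrite exprSr -mulrA; congr (_ * _).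
rewrite (mW ord0 a 0 c c) ?mul0r ?addr0// => [j|l]; last by rewrite fcons0 mul0r addr0.
by case: (unliftP ord0 j) => [j' ->|->//]; rewrite fconsS.
Qed.

Lemma mlin_sum k (I : Type) (W : ('I_k.+1 -> I -> R) -> R) (J : Type) (r : seq J)
    (a : J -> R) (f : J -> I -> R) (c : 'I_k -> I -> R) : mlin W ->
  W (fcons (fun l => \sum_(i <- r) a i * f i l) c) = \sum_(i <- r) a i * W (fcons (f i) c).
Proof.
move=> mW; elim: r => [|i r IH].
  rewrite big_nil (mW ord0 0 0 (fcons (fun=> 0) c) (fcons (fun=> 0) c)) ?mul0r ?addr0//.
    by move=> j; case: (unliftP ord0 j) => [j' ->|->//]; rewrite !fconsS.
  by move=> l; rewrite !fcons0 big_nil !mul0r addr0.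
rewrite big_cons -IH -[X in _ + X]mul1r; apply: (mW ord0) => [j|l].
  by case: (unliftP ord0 j) => [j' ->|->//]; rewrite !fconsS.
by rewrite !fcons0 big_cons mul1r.
Qed.

Lemma mlin_expand k m (W : ('I_k -> 'I_m -> R) -> R) (c : 'I_k -> 'I_m -> R) : mlin W ->
  W c = \sum_(b : {ffun 'I_k -> 'I_m}) (\prod_j c j (b j)) * W (fun j l => (l == b j)%:R).
Proof.
elim: k W c => [|k IH] W c mW.
  rewrite (big_pred1 [ffun i : 'I_0 => match i with Ordinal n h => False_rect _ (notF h) end]).
    by rewrite big_ord0 mul1r; congr W; apply/funext => -[].
  by move=> b /=; apply/esym/eqP/ffunP => -[].
rewrite [in LHS](fconsE c) (IH (fun c' => W (fcons _ c'))); last exact: mlin_fcons.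
pose h (z : 'I_m * {ffun 'I_k -> 'I_m}) : {ffun 'I_k.+1 -> 'I_m} :=
  [ffun i => fcons z.1 z.2 i].
pose h' (b : {ffun 'I_k.+1 -> 'I_m}) : 'I_m * {ffun 'I_k -> 'I_m} :=
  (b ord0, [ffun j : 'I_k => b (lift ord0 j)]).
rewrite (reindex h); last first.
  exists h' => [[l b] _|b _]; rewrite /h /h' /=.
    by rewrite ffunE fcons0; congr (_, _); apply/ffunP => j; rewrite !ffunE fconsS.
  apply/ffunP => i; rewrite ffunE.
  by case: (unliftP ord0 i) => [j ->|->]; rewrite ?fcons0 ?fconsS ?ffunE.
have := pair_bigA (GRing.add : Monoid.com_law 0) (fun l b =>
  (\prod_j c j (h (l, b) j)) * W (fun j l' => (l' == h (l, b) j)%:R)).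
under [X in _ = X -> _]eq_bigr do rewrite -surjective_pairing.
move=> <-; rewrite exchange_big /=.
apply: eq_bigr => b _.
have -> : c ord0 = (fun l => \sum_i c ord0 i * (l == i)%:R).
  apply/funext => l; rewrite (bigD1 l)//= eqxx mulr1 big1 ?addr0// => i.
  by rewrite eq_sym => /negbTE ->; rewrite mulr0.
rewrite mlin_sum// mulr_sumr; apply: eq_bigr => l _.
rewrite big_ord_recl mulrCA !mulrA; congr (_ * _).
  by rewrite ffunE fcons0; congr (_ * _); apply: eq_bigr => j _; rewrite ffunE fconsS.
congr W; apply/funext => j; apply/funext => l'; rewrite ffunE.
by case: (unliftP ord0 j) => [j' ->|->]; rewrite ?fcons0 ?fconsS.
Qed.

End Multilinear.

(** * Spaces generated by coordinates *)

Section Pderiv.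
Variable R : realType.

Lemma pderiv_coord n (i j : 'I_n) (x : 'rV[R]_n) :
  pderiv i (fun y : 'rV[R]_n => y 0 j) x = (j == i)%:R.
Proof. by have [_ <-] := is_derive_coord i j x. Qed.

Lemma pderiv_add n (i : 'I_n) (f g : 'rV[R]_n -> R) x : smoothRn f -> smoothRn g ->
  pderiv i (fun y => f y + g y) x = pderiv i f x + pderiv i g x.
Proof. by move=> sf sg; apply: deriveD; exact: smoothRn_derivable. Qed.

Lemma pderiv_mul n (i : 'I_n) (f g : 'rV[R]_n -> R) x : smoothRn f -> smoothRn g ->
  pderiv i (fun y => f y * g y) x = f x * pderiv i g x + g x * pderiv i f x.
Proof. by move=> sf sg; apply: deriveM; exact: smoothRn_derivable. Qed.

Lemma pderiv_cst n (i : 'I_n) (c : R) x : pderiv i (fun _ : 'rV[R]_n => c) x = 0.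
Proof. exact: derive_cst. Qed.

Lemma smoothRn_reindex m n (u : 'I_n -> 'I_m) (s : 'rV[R]_n -> R) : smoothRn s ->
  smoothRn (fun y : 'rV[R]_m => s (\row_k y 0 (u k))).
Proof.
move=> ss; apply: (smoothRn_comp (f := fun k (y : 'rV[R]_m) => y 0 (u k)) ss) => k.
exact: smoothRn_coord.
Qed.

(** The chain rule for a substitution of variables. As [u] may be neither injective nor surjective,
    it covers both repeated coordinates and concatenated lists. *)
Lemma sum_pderiv_reindex m n (u : 'I_n -> 'I_m) (s : 'rV[R]_n -> R)
    (y : 'rV[R]_m) (w : 'I_m -> R) : smoothRn s ->
  \sum_j pderiv j (fun y : 'rV[R]_m => s (\row_k y 0 (u k))) y * w j =
  \sum_k pderiv k s (\row_k y 0 (u k)) * w (u k).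
Proof.
move=> ss.
under eq_bigr => j _.
  rewrite (pderiv_comp (f := fun k (y : 'rV[R]_m) => y 0 (u k)) j y ss); last first.
    by move=> k; exact: smoothRn_coord.
  rewrite mulr_suml; over.
rewrite exchange_big; apply: eq_bigr => k _.
rewrite (bigD1 (u k))//= pderiv_coord eqxx mulr1 big1 ?addr0// => j /negbTE juk.
by rewrite pderiv_coord eq_sym juk mulr0 mul0r.
Qed.

End Pderiv.

Section CoordinateSpace.
Variable R : realType.
Variables (N : dspace R) (I : Type) (x : I -> N -> R).
Hypothesis hx : gen_struct (range x) = @dfun R N.

(* Points such as boundary points of a cube are allowed, provided that the partial
   derivatives of a smooth function of the coordinates are determined by its values
   near the point. *)
Definition nondegenerate_coords := forall (p : N) r (g : 'I_r -> I) (s : 'rV[R]_r -> R),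
  smoothRn s ->
  (\forall q \near (p : weak_unif (range x)), s (\row_i x (g i) q) = 0) ->
  forall v : I -> R, \sum_i pderiv i s (\row_i x (g i) p) * v (g i) = 0.

Lemma dfun_coord i : dfun (x i).
Proof. by rewrite -hx; apply: gen_structS; exists i. Qed.

Definition xcoord i : @dfun R N := Dfun (dfun_coord i).

Lemma near_coord (p : N) (U : set N) :
  nbhs (p : weak_unif (@dfun R N)) U <-> nbhs (p : weak_unif (range x)) U.
Proof. by rewrite -hx; exact: near_gen. Qed.

Definition crep (p : N) (f : N -> R) r (g : 'I_r -> I) (s : 'rV[R]_r -> R) :=
  smoothRn s /\ \forall q \near (p : weak_unif (range x)), f q = s (\row_i x (g i) q).

Lemma crep_common (p : N) n (f : 'I_n -> N -> R) : (forall i, dfun (f i)) ->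
  exists r (g : 'I_r -> I) (s : 'I_n -> 'rV[R]_r -> R), forall i, crep p (f i) g (s i).
Proof.
move=> df.
have lf i : locally_smooth (range x) (f i) p by apply: gen_locally_smooth; rewrite hx.
have [r [g [s [Gg ss fE]]]] := locally_smooth_common lf.
have hg i : exists a, x a = g i by have [a _ h] := Gg i; exists a.
have [a aE] := choice hg.
exists r, a, s => i; split=> //; apply: filterS fE => q /(_ i) ->.
by congr (s i _); apply/rowP => j; rewrite !mxE aE.
Qed.

Lemma crep_ex (p : N) (f : N -> R) : dfun f ->
  exists r (g : 'I_r -> I) (s : 'rV[R]_r -> R), crep p f g s.
Proof.
move=> df; have [r [g [s h]]] := @crep_common p 1 (fun=> f) (fun=> df).
by exists r, g, (s ord0); exact: h.
Qed.

Lemma tangent_crep (p : N) (u : tangent p) (f : @dfun R N) r (g : 'I_r -> I) s :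
  crep p (val f) g s ->
  val u f = \sum_i pderiv i s (\row_i x (g i) p) * val u (xcoord (g i)).
Proof.
by move=> [ss /near_coord fE]; rewrite (tangent_comp (f := fun i => xcoord (g i)) u ss).
Qed.

Lemma tangent_determined (p : N) (u w : tangent p) :
  (forall i, val u (xcoord i) = val w (xcoord i)) -> u = w.
Proof.
move=> uw; apply: val_inj; apply/funext => f.
have [r [g [s fE]]] := crep_ex p (set_valP f).
rewrite (tangent_crep u fE) (tangent_crep w fE).
by apply: eq_bigr => i _; rewrite uw.
Qed.

Section ConstantField.
Hypothesis nondeg : nondegenerate_coords.

(** The difference of the two representations, read in the concatenated coordinates, vanishes near
    [p], so nondegeneracy applies to it. *)
Lemma nondeg_unique (p : N) (f : N -> R) r (g : 'I_r -> I) s r' (g' : 'I_r' -> I) s'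
    (v : I -> R) : crep p f g s -> crep p f g' s' ->
  \sum_i pderiv i s (\row_i x (g i) p) * v (g i) =
  \sum_i pderiv i s' (\row_i x (g' i) p) * v (g' i).
Proof.
move=> [ss fE] [ss' fE'].
pose S (y : 'rV[R]_(r + r')) := s (\row_k y 0 (lshift r' k)).
pose S' (y : 'rV[R]_(r + r')) := s' (\row_k y 0 (rshift r k)).
have sS : smoothRn S by exact: smoothRn_reindex.
have sS' : smoothRn S' by exact: smoothRn_reindex.
have sm : smoothRn (fun y => -1 * S' y) by apply: smoothRn_mul => //; exact: smoothRn_cst.
have sT : smoothRn (fun y => S y + -1 * S' y) by exact: smoothRn_add.
have El q : \row_k (\row_i x (cat_fam g g' i) q) 0 (lshift r' k) = \row_i x (g i) q.
  by apply/rowP => k; rewrite !mxE cat_faml.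
have Er q : \row_k (\row_i x (cat_fam g g' i) q) 0 (rshift r k) = \row_i x (g' i) q.
  by apply/rowP => k; rewrite !mxE cat_famr.
have := nondeg (p := p) (g := cat_fam g g') sT _ v.
have near0 : \forall q \near (p : weak_unif (range x)),
    S (\row_i x (cat_fam g g' i) q) + -1 * S' (\row_i x (cat_fam g g' i) q) = 0.
  apply: filterS2 fE fE' => q h h'.
  by rewrite /S /S' El Er -h -h' mulN1r subrr.
move=> /(_ near0).
under eq_bigr => i _.
  rewrite pderiv_add// pderiv_mul//; last exact: smoothRn_cst.
  rewrite pderiv_cst mulr0 addr0 mulrDl -mulrA; over.
rewrite big_split/= -mulr_sumr.
have -> : \sum_i pderiv i S (\row_i x (cat_fam g g' i) p) * v (cat_fam g g' i) =
    \sum_i pderiv i s (\row_i x (g i) p) * v (g i).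
  have := sum_pderiv_reindex (lshift r') (\row_i x (cat_fam g g' i) p)
    (fun i => v (cat_fam g g' i)) ss.
  by move=> ->; rewrite El; apply: eq_bigr => k _; rewrite cat_faml.
have -> : \sum_i pderiv i S' (\row_i x (cat_fam g g' i) p) * v (cat_fam g g' i) =
    \sum_i pderiv i s' (\row_i x (g' i) p) * v (g' i).
  have := sum_pderiv_reindex (@rshift r r') (\row_i x (cat_fam g g' i) p)
    (fun i => v (cat_fam g g' i)) ss'.
  by move=> ->; rewrite Er; apply: eq_bigr => k _; rewrite cat_famr.
by rewrite mulN1r => /eqP; rewrite subr_eq0 => /eqP.
Qed.

Variable v : I -> R.

(** The derivative of [f] in the direction with coordinates [v]. Every [f] has a local
    representation and all of them give the same number, so the default 0 is never the reason for
    the value. *)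
Definition cderiv (p : N) (f : @dfun R N) : R :=
  xget 0 [set d | exists r (g : 'I_r -> I) s, crep p (val f) g s /\
    d = \sum_i pderiv i s (\row_i x (g i) p) * v (g i)].

Lemma cderivE (p : N) (f : @dfun R N) r (g : 'I_r -> I) s : crep p (val f) g s ->
  cderiv p f = \sum_i pderiv i s (\row_i x (g i) p) * v (g i).
Proof.
move=> fE; rewrite /cderiv; case: xgetP => [d _ [r' [g' [s' [fE' ->]]]]|].
  exact: nondeg_unique fE' fE.
by move=> /(_ (\sum_i pderiv i s (\row_i x (g i) p) * v (g i))) []; exists r, g, s.
Qed.

Lemma crep_val (p : N) f r (g : 'I_r -> I) s : crep p f g s -> f p = s (\row_i x (g i) p).
Proof. by move=> [_ /nbhs_singleton]. Qed.

Lemma cderiv_tangent (p : N) : tangent p (cderiv p).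
Proof.
split=> [a b f g h hE|f g h hE].
  have dfg (i : 'I_2) : dfun (if i == 0 then val f else val g).
    by case: ifP => _; exact: set_valP.
  have [r [u [s sE]]] := crep_common p dfg.
  have sf : crep p (val f) u (s 0) by have := sE 0.
  have sg : crep p (val g) u (s 1) by have := sE 1.
  have sh : crep p (val h) u (fun y => a * s 0 y + b * s 1 y).
    split; first by apply: smoothRn_add; apply: smoothRn_mul; try exact: smoothRn_cst;
      [exact: sf.1|exact: sg.1].
    by apply: filterS2 sf.2 sg.2 => q h1 h2; rewrite hE h1 h2.
  rewrite (cderivE sf) (cderivE sg) (cderivE sh) !mulr_sumr -big_split/=.
  apply: eq_bigr => i _.
  have [sf1 sg1] := (sf.1, sg.1); have sc c := @smoothRn_cst R r c.
  rewrite pderiv_add; try exact: smoothRn_mul.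
  by rewrite !pderiv_mul// !pderiv_cst; ring.
have dfg (i : 'I_2) : dfun (if i == 0 then val f else val g).
  by case: ifP => _; exact: set_valP.
have [r [u [s sE]]] := crep_common p dfg.
have sf : crep p (val f) u (s 0) by have := sE 0.
have sg : crep p (val g) u (s 1) by have := sE 1.
have sh : crep p (val h) u (fun y => s 0 y * s 1 y).
  split; first by apply: smoothRn_mul; [exact: sf.1|exact: sg.1].
  by apply: filterS2 sf.2 sg.2 => q h1 h2; rewrite hE h1 h2.
rewrite (cderivE sf) (cderivE sg) (cderivE sh) !mulr_sumr -big_split/=.
rewrite (crep_val sf) (crep_val sg); apply: eq_bigr => i _.
by rewrite pderiv_mul ?mulrDl ?mulrA//; [exact: sf.1|exact: sg.1].
Qed.

Definition cvec (p : N) : tangent p := SigSub (mem_set (cderiv_tangent p)).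

Lemma dfun_local (f : N -> R) :
  (forall p : N, exists2 g, dfun g & \forall q \near (p : weak_unif (@dfun R N)), f q = g q) ->
  dfun f.
Proof. exact: (dfunP N).2. Qed.

Lemma dfun_cderiv (f : @dfun R N) : dfun (fun p => cderiv p f).
Proof.
apply: dfun_local => p; have [r [g [s [ss fE]]]] := crep_ex p (set_valP f).
exists (fun q => \sum_i pderiv i s (\row_i x (g i) q) * v (g i)).
  apply: dfun_sum => i; apply: dfun_mul; last exact: dfun_cst.
  by apply: dfun_smooth; [exact: smoothRn_pderiv|move=> j; exact: dfun_coord].
(* The representation of [f] found at [p] is also one at every nearby [q], so one formula computes
   [cderiv] on a whole neighbourhood. *)
apply/near_coord; have := near_join fE.
apply: filterS => q fq; exact: (@cderivE q f r g s).
Qed.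

Lemma cvec_smooth (F : TM N -> R) : @dfun R (tspace N) F ->
  dfun (fun p => F (tpoint (cvec p))).
Proof.
apply: (gen_struct_comp (F := fun p => tpoint (cvec p)) (dfunP N)) => _ [[g dg <-]|[f _ <-]].
  exact: dg.
exact: (dfun_cderiv f).
Qed.

Definition cfield : vfield N := VField cvec_smooth.

Lemma cfield_coord p i : val (cfield p) (xcoord i) = v i.
Proof.
rewrite /= (@cderivE p (xcoord i) 1 (fun=> i) (fun y => y 0 0)).
  by rewrite big_ord1 pderiv_coord eqxx mul1r.
split; first exact: smoothRn_coord.
by apply: (filterE (F := nbhs (p : weak_unif (range x)))) => q; rewrite mxE.
Qed.

End ConstantField.

End CoordinateSpace.

(** * Local expression of a smooth form in finitely many coordinates *)

Section FormLocal.
Variable R : realType.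
Variables (N : dspace R) (I : Type) (x : I -> N -> R).
Hypothesis hx : gen_struct (range x) = @dfun R N.
Local Notation X := (xcoord hx).

Section TkGenerators.
Variable k : nat.

Definition tkcoord (i : I) (h : tkspace k N -> R) :=
  (exists j, h = fun v => x i (projT1 (val v j))) \/
  (exists j, h = fun v => dd (X i) (val v j)).

Definition tkgens : set (tkspace k N -> R) := [set h | exists i, tkcoord i h].

(** By the chain rule the differential of any element is locally a combination of the differentials
    of coordinates, with coefficients smooth in the base point. The locality axiom then puts it in
    the structure generated by [tkgens]. *)
Lemma tkspace_gen (f : tkspace k N -> R) : dfun f -> gen_struct tkgens f.
Proof.
pose E := gen_dspace tkgens.
have base j (g : N -> R) : dfun g -> @dfun R E (fun v : tkspace k N => g (projT1 (val v j))).
  have dfE : @dfun R N g -> gen_struct (range x) g by rewrite hx.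
  move=> /dfE dg; apply: (gen_struct_comp
    (F := fun v : tkspace k N => projT1 (val v j)) (dfunP E) _ dg) => _ [i _ <-].
  by apply: gen_structS; exists i; left; exists j.
apply: (gen_struct_comp (F := id) (dfunP E)) => _ [f' pf' <-].
move: f' pf'; apply: (gen_struct_comp
  (F := (val : tkspace k N -> ('I_k -> TM N))) (dfunP E)) => _ [j [u du ->]].
move: u du; apply: (gen_struct_comp
  (F := fun v : tkspace k N => val v j) (dfunP E)) => _ [[g dg <-]|[g _ <-]].
  exact: base.
apply: (dfunP E).2 => v0; pose p := projT1 (val v0 j).
have [r [a [s [ss gE]]]] := crep_ex hx p (set_valP g).
exists (fun v : tkspace k N => \sum_i pderiv i s (\row_i x (a i) (projT1 (val v j))) *
    dd (X (a i)) (val v j)).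
  apply: (@dfun_sum R E) => i.
  apply: (@dfun_mul R E (fun v : tkspace k N => pderiv i s (\row_i x (a i) (projT1 (val v j))))
    (fun v : tkspace k N => dd (X (a i)) (val v j))).
    apply: (@dfun_smooth R E _ _ (fun i (v : tkspace k N) => x (a i) (projT1 (val v j)))) => [|l].
      exact: smoothRn_pderiv.
    by apply: base; exact: dfun_coord.
  by apply: gen_structS; exists (a i); right; exists j.
have cpi : continuous ((fun v => projT1 (val v j)) : weak_unif (@dfun R E) -> weak_unif (range x)).
  apply: weak_map_continuous => _ [i _ <-].
  by apply: base; exact: dfun_coord.
have nv : nbhs (v0 : weak_unif (@dfun R E)) _ := cpi v0 _ (near_join gE).
apply: (filterS _ nv) => v gv.
exact: (tangent_crep hx (projT2 (val v j)) (conj ss gv)).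
Qed.

End TkGenerators.

Lemma dd_tuple k (p : N) (u : 'I_k -> tangent p) f j :
  dd f (val (tuple_at u) j) = val (u j) f.
Proof. by []. Qed.

Hypothesis nondeg : nondegenerate_coords x.
Local Notation cf v := (cfield hx nondeg v).

Lemma tangent_cfield (p : N) (u : tangent p) : u = cf (fun i => val u (X i)) p.
Proof.
refine (@tangent_determined _ _ _ _ hx p u (cf (fun i => val u (X i)) p) _) => i.
by rewrite cfield_coord. Qed.

Lemma cfield_lin (p : N) (a b : R) (u v w : I -> R) (f : @dfun R N) :
  (forall i, w i = a * u i + b * v i) ->
  val (cf w p) f = a * val (cf u p) f + b * val (cf v p) f.
Proof.
move=> wE; have [r [g [s fE]]] := crep_ex hx p (set_valP f).
rewrite /= !(cderivE nondeg _ fE) !mulr_sumr -big_split/=.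
by apply: eq_bigr => i _; rewrite wE; ring.
Qed.

Variables (k : nat) (w : kform k N).

Definition wcoord (p : N) (c : 'I_k -> I -> R) : R := w (tuple_at (fun j => cf (c j) p)).

Lemma wcoordE (p : N) (u : 'I_k -> tangent p) :
  w (tuple_at u) = wcoord p (fun j i => val (u j) (X i)).
Proof.
by rewrite /wcoord; congr (w (tuple_at _)); apply/funext => j; exact: tangent_cfield.
Qed.

Lemma mlin_wcoord p : mlin (wcoord p).
Proof.
move=> i a b u v z h1 h2; apply: (form_multilinear w (i := i)) => [j ji|f].
  by have [-> ->] := h1 j ji.
exact: cfield_lin.
Qed.

(* On a neighbourhood of the zero vector over [p] the form is a smooth function of
   finitely many coordinates; homogeneity removes the smallness of the vectors. *)
Lemma wcoord_finite (p : N) : exists m (a : 'I_m -> I), injective a /\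
  \forall q \near (p : weak_unif (range x)), forall c c' : 'I_k -> I -> R,
    (forall j l, c j (a l) = c' j (a l)) -> wcoord q c = wcoord q c'.
Proof.
pose v0 : tkspace k N := tuple_at (fun _ : 'I_k => cf (fun=> 0) p).
have wg : gen_struct (@tkgens k) w by apply: tkspace_gen; exact: form_smooth.
have [r [g [s [Gg ss wE]]]] := gen_locally_smooth wg v0.
have [r' [g' [e [Gg' e0 {}wE]]]] : weak_box (@tkgens k) v0 [set v | w v = s (\row_i g i v)].
  by rewrite -nbhs_weak_unif.
have [b bP] := choice Gg; have [b' b'P] := choice Gg'.
(* The relevant indices come from the local expression of [w] ([b]) and from the neighbourhood on
   which that expression is valid ([b']). *)
pose S := undup (codom (cat_fam b b' : _ -> {classic I})).
pose a (l : 'I_(size S)) : I := tnth (in_tuple S) l.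
have inS i : exists l, cat_fam b b' i = a l.
  have : (cat_fam b b' i : {classic I}) \in S by rewrite mem_undup codom_f.
  by move=> /(tnthP (in_tuple S))[l ->]; exists l.
have inb i : exists l, b i = a l by have := inS (lshift r' i); rewrite cat_faml.
have inb' i : exists l, b' i = a l by have := inS (rshift r i); rewrite cat_famr.
exists (size S), a; split.
  by move=> l l' /(tuple_uniqP (in_tuple S) (undup_uniq _)).
rewrite /prop_near1 nbhs_weak_unif; exists (size S), (fun l => x (a l)), e.
split=> // q hq c c' cc'.
(* [B] is positive and exceeds every relevant coordinate of both tuples in absolute value, so
   scaling by [e / B] brings these coordinates below [e]. *)
pose B := 1 + \sum_j \sum_l (`|c j (a l)| + `|c' j (a l)|).
have B0 : 0 < B.
  by rewrite ltr_pwDl// sumr_ge0// => j _; rewrite sumr_ge0// => l _; rewrite addr_ge0.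
have cB (d : 'I_k -> I -> R) : (forall j l, `|d j (a l)| <= `|c j (a l)| + `|c' j (a l)|) ->
    forall j l, `|e / B * d j (a l)| < e.
  move=> hd j l; rewrite normrM gtr0_norm ?divr_gt0// -mulrA gtr_pMr// ltr_pdivrMl// mulr1.
  rewrite /B (bigD1 j)//= (bigD1 l)//=.
  apply: (@le_lt_trans _ _ (`|c j (a l)| + `|c' j (a l)|)) => //.
  rewrite -subr_gt0.
  have -> u v w' : 1 + (u + v + w') - u = 1 + (v + w') :> R by ring.
  rewrite ltr_pwDl// addr_ge0//.
    by rewrite sumr_ge0// => l' _; rewrite addr_ge0.
  by rewrite sumr_ge0// => j' _; rewrite sumr_ge0// => l' _; rewrite addr_ge0.
pose V (d : 'I_k -> I -> R) : tkspace k N :=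
  tuple_at (fun j => cf (fun i => e / B * d j i) q).
have hV (d : 'I_k -> I -> R) : (forall j l, `|d j (a l)| <= `|c j (a l)| + `|c' j (a l)|) ->
    w (V d) = s (\row_i g i (V d)).
  move=> hd; apply: wE => i; have [l bl] := inb' i.
  case: (b'P i) => -[j ->]; rewrite bl; first exact: hq.
  by rewrite !dd_tuple !cfield_coord subr0; exact: cB.
have VV : w (V c) = w (V c').
  rewrite !hV => [|j l|j l]; try by rewrite ?lerDl ?lerDr.
  congr s; apply/rowP => i; rewrite !mxE; have [l bl] := inb i.
  by case: (bP i) => -[j ->]; rewrite bl// !dd_tuple !cfield_coord cc'.
have := VV; rewrite -![w (V _)]/(wcoord q (fun j i => e / B * _ j i)).
rewrite !mlin_scale; try exact: mlin_wcoord.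
by apply: mulfI; rewrite expf_neq0// gt_eqF// divr_gt0.
Qed.

Lemma form_local_coord (p : N) : exists m (a : 'I_m -> I),
  let t (b : {ffun 'I_k -> 'I_m}) := form_on w (fun j => cf (fun i => (`[< i = a (b j) >])%:R)) in
  \forall q \near (p : weak_unif (@dfun R N)), forall u : 'I_k -> tangent q,
    w (tuple_at u) = \sum_b val (t b) q * \prod_j val (u j) (X (a (b j))).
Proof.
have [m [a [inja wE]]] := wcoord_finite p; exists m, a => t.
apply/(near_coord hx); apply: filterS wE => q wq u.
(* Extension by zero outside the finitely many indices [a l]. Near [p] the form does not distinguish
   a tuple from the one so truncated, and the latter can be expanded on a finite basis. *)
pose ext (c : 'I_k -> 'I_m -> R) j i := \sum_l c j l * (`[< i = a l >])%:R.
have exta c j l : ext c j (a l) = c j l.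
  rewrite /ext (bigD1 l)//= big1 ?addr0 => [|l' ll'].
    by rewrite asboolT// mulr1.
  rewrite asboolF ?mulr0// => /inja E; by rewrite E eqxx in ll'.
have mW : mlin (fun c => wcoord q (ext c)).
  move=> i al be c c' z h1 h2; apply: (@mlin_wcoord q i) => [j ji|i'].
    by have [E E'] := h1 j ji; rewrite /ext E E'.
  rewrite /ext !mulr_sumr -big_split/=; apply: eq_bigr => l _.
  by rewrite h2; ring.
rewrite wcoordE (wq _ (ext (fun j l => val (u j) (X (a l))))) => [|j l]; last by rewrite exta.
rewrite (mlin_expand _ mW); apply: eq_bigr => b _; rewrite mulrC; congr (_ * _).
rewrite /t/= /wcoord; congr (w (tuple_at _)); apply/funext => j.
congr (cf _ q); apply/funext => i; rewrite /ext (bigD1 (b j))//= eqxx mul1r big1 ?addr0//.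
by move=> l /negbTE lb; rewrite lb mul0r.
Qed.

(** The coordinates are forgotten here. What remains, elements [y] and [t] of the structure and the
    skew symmetry of [t], can be pulled back along any smooth map. *)
Lemma form_local (p : N) : exists m (y : 'I_m -> @dfun R N) (t : {ffun 'I_k -> 'I_m} -> @dfun R N),
  (\forall q \near (p : weak_unif (@dfun R N)), forall u : 'I_k -> tangent q,
    w (tuple_at u) = \sum_b val (t b) q * \prod_j val (u j) (y (b j))) /\
  (skew_symmetric w -> forall (b : {ffun 'I_k -> 'I_m}) (s : 'S_k) q,
    val (t [ffun j => b (s j)]) q = (-1) ^+ s * val (t b) q).
Proof.
have [m [a wE]] := form_local_coord p.
exists m, (fun l => X (a l)), (fun b : {ffun 'I_k -> 'I_m} =>
  form_on w (fun j => cf (fun i => (`[< i = a (b j) >])%:R))); split=> //.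
move=> sw b s q; rewrite /= -sw; congr (w (tuple_at _)); apply/funext => j.
by rewrite ffunE.
Qed.

End FormLocal.

(** * The exterior derivative in local form *)

Section DextFormula.
Variable R : realType.

Lemma tangent_prod (N : dspace R) (p : N) (v : tangent p) k (f : 'I_k -> @dfun R N) h :
  (forall q, val h q = \prod_j val (f j) q) ->
  val v h = \sum_c \prod_j (if j == c then val v (f j) else val (f j) p).
Proof.
elim: k f h => [|k IH] f h hE.
  by rewrite big_ord0; apply: (tangent_cst v (c := 1)) => q; rewrite hE big_ord0.
pose g := Dfun (dfun_prod (index_enum 'I_k) (fun j => set_valP (f (lift ord0 j)))).
rewrite (@tangent_leibniz _ _ _ v (f ord0) g) => [|q]; last by rewrite hE big_ord_recl.
rewrite (IH (fun j => f (lift ord0 j)))// big_ord_recl addrC; congr (_ + _).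
  by rewrite big_ord_recl eqxx mulrC; congr (_ * _); apply: eq_bigr.
rewrite mulr_sumr; apply: eq_bigr => c _; by rewrite big_ord_recl; congr (_ * _).
Qed.

Section Contraction.
Variables (k m : nat) (t : {ffun 'I_k -> 'I_m} -> R).
Hypothesis t_skew : forall (b : {ffun 'I_k -> 'I_m}) (s : 'S_k),
  t [ffun j => b (s j)] = (-1) ^+ s * t b.

Definition tcontract (u : 'I_k -> 'I_m -> R) : R := \sum_b t b * \prod_j u j (b j).

Lemma tcontract_perm u (s : 'S_k) : tcontract (fun j => u (s j)) = (-1) ^+ s * tcontract u.
Proof.
rewrite /tcontract mulr_sumr.
pose h (b : {ffun 'I_k -> 'I_m}) : {ffun 'I_k -> 'I_m} := [ffun j => b (s j)].
rewrite (reindex h); last first.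
  exists (fun b : {ffun 'I_k -> 'I_m} => [ffun j => b ((s^-1)%g j)]) => b _;
  by apply/ffunP => j; rewrite !ffunE ?permK ?permKV.
apply: eq_bigr => b _; rewrite t_skew mulrA; congr (_ * _).
rewrite [RHS](reindex_inj (@perm_inj _ s)); apply: eq_bigr => j _.
by rewrite ffunE.
Qed.

End Contraction.

Lemma tcontract_lin k m (t : {ffun 'I_k.+1 -> 'I_m} -> R) (u v : 'I_m -> R) A :
  tcontract t (fcons (fun l => u l - v l) A) =
  tcontract t (fcons u A) - tcontract t (fcons v A).
Proof.
rewrite /tcontract -sumrB; apply: eq_bigr => b _.
rewrite !big_ord_recl !fcons0 mulrBl mulrBr; congr (_ * (_ * _) - _ * (_ * _)).
  by apply: eq_bigr => j _; rewrite !fconsS.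
by apply: eq_bigr => j _; rewrite !fconsS.
Qed.

(** The permutation [lift_perm c ord0 1] moves [c] to the front and keeps the order of the other
    indices, so its sign is that of [c] transpositions. *)
Lemma tcontract_front k m (t : {ffun 'I_k.+1 -> 'I_m} -> R)
    (t_skew : forall (b : {ffun 'I_k.+1 -> 'I_m}) (s : 'S_k.+1),
       t [ffun j => b (s j)] = (-1) ^+ s * t b)
    (c : 'I_k.+1) (y : 'I_m -> R) (V : 'I_k.+1 -> 'I_m -> R) :
  tcontract t (fun j => if j == c then y else V j) =
  (-1) ^+ c * tcontract t (fcons y (fun l => V (lift c l))).
Proof.
pose s := lift_perm c ord0 1%g.
have -> : (fun j => if j == c then y else V j) =
    (fun j => fcons y (fun l => V (lift c l)) (s j)).
  apply/funext => j; case: (unliftP c j) => [l ->|->].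
    by rewrite /s lift_perm_lift perm1 fconsS eq_sym (negbTE (neq_lift _ _)).
  by rewrite eqxx /s lift_perm_id fcons0.
by rewrite tcontract_perm// odd_lift_perm odd_perm1 addbF addbF signr_odd.
Qed.

(* The terms of the exterior derivative that differentiate the vector fields cancel
   against the bracket terms. *)
Lemma tcontract_cancel k m (t : {ffun 'I_k.+1 -> 'I_m} -> R)
    (t_skew : forall (b : {ffun 'I_k.+1 -> 'I_m}) (s : 'S_k.+1),
       t [ffun j => b (s j)] = (-1) ^+ s * t b)
    (V : 'I_k.+2 -> 'I_m -> R) (Y : 'I_k.+2 -> 'I_k.+2 -> 'I_m -> R) :
  \sum_(i < k.+2) (-1) ^+ i * \sum_(c < k.+1)
     tcontract t (fun j => if j == c then Y i (lift i c) else V (lift i j)) +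
  \sum_(i < k.+2) \sum_(j < k.+2 | (i < j)%N) (-1) ^+ (i + j) *
     tcontract t (fcons (fun l => Y i j l - Y j i l)
       (fun l => V (inord (bump i (bump j.-1 l))))) = 0.
Proof.
pose A (i j : 'I_k.+2) (l : 'I_k) := V (inord (bump i (bump j.-1 l))).
(* [G i j] is the term in which field [i] differentiates field [j], moved to the front. Once [i] is
   omitted, [j] stands at position [j.-1] if [i < j] and at position [j] if [j < i], whence the two
   signs. *)
pose G (i j : 'I_k.+2) := if (i < j)%N then (-1) ^+ j.-1 * tcontract t (fcons (Y i j) (A i j))
  else (-1) ^+ j * tcontract t (fcons (Y i j) (A j i)).
have E1 (i : 'I_k.+2) : \sum_(c < k.+1)
     tcontract t (fun j => if j == c then Y i (lift i c) else V (lift i j)) =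
     \sum_(j : 'I_k.+2 | (i < j)%N) G i j + \sum_(j : 'I_k.+2 | (j < i)%N) G i j.
  have -> : \sum_(j : 'I_k.+2 | (i < j)%N) G i j + \sum_(j : 'I_k.+2 | (j < i)%N) G i j =
      \sum_(j | j != i) G i j.
    rewrite [RHS](bigID (fun j : 'I_k.+2 => (i < j)%N))/=; congr (_ + _); apply: eq_bigl => j.
      by rewrite neq_ltn; case: ltngtP.
    by rewrite neq_ltn -leqNgt; case: ltngtP.
  rewrite [RHS]big_mkcond (bigD1_ord i)//= eqxx add0r; apply: eq_bigr => c _.
  rewrite eq_sym neq_lift /G tcontract_front//.
  have [ic|ci] := leqP i c.
    have E : lift i c = c.+1 :> nat by rewrite /= /bump ic.
    rewrite E ltnS ic; congr (_ * tcontract t (fcons _ _)).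
    apply/funext => l; congr V; apply: val_inj.
    have cl := ltn_ord c; have ll := ltn_ord l.
    by rewrite /= inordK /bump; lia.
  have E : lift i c = c :> nat by rewrite /= /bump leqNgt ci.
  rewrite E ltnNge (ltnW ci) /=; congr (_ * tcontract t (fcons _ _)).
  apply/funext => l; congr V; apply: val_inj.
    have cl := ltn_ord c; have ll := ltn_ord l.
    by rewrite /= inordK /bump; lia.
under eq_bigr => i _ do rewrite E1 mulrDr !mulr_sumr.
rewrite big_split/=.
(* After this exchange each pair [i < j] collects [G i j], [G j i] and one bracket term, and these
   three cancel. *)
rewrite [X in _ + X + _](exchange_big_dep xpredT)//= -!big_split/=.
apply: big1 => i _; rewrite -!big_split/=; apply: big1 => j ij.
rewrite tcontract_lin /G ij ltnNge (ltnW ij) /=.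
rewrite -[in (-1) ^+ j](ltn_predK ij) !exprD.
have -> : (-1) ^+ j = - (-1) ^+ j.-1 :> R.
  by rewrite -[in LHS](ltn_predK ij) exprS mulN1r.
rewrite -/(A i j) exprS mulN1r; ring.
Qed.

(** The Leibniz rule applied to the local expression gives terms with a derivative of a coefficient
    [t b], which form the right-hand side, and terms with a second derivative [X_i (X_j y)]. The
    latter, with the brackets, are the sum treated in [tcontract_cancel]. A bracket occupies slot 0,
    which exists because [k > 0]. *)
Lemma dext_on_local (N : dspace R) k (w : kform k N) (p : N) m
    (y : 'I_m -> @dfun R N) (t : {ffun 'I_k -> 'I_m} -> @dfun R N)
    (X : 'I_k.+1 -> vfield N) : (0 < k)%N ->
  (\forall q \near (p : weak_unif (@dfun R N)), forall u : 'I_k -> tangent q,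
    w (tuple_at u) = \sum_b val (t b) q * \prod_j val (u j) (y (b j))) ->
  (forall (b : {ffun 'I_k -> 'I_m}) (s : 'S_k),
    val (t [ffun j => b (s j)]) p = (-1) ^+ s * val (t b) p) ->
  dext_on w X p = \sum_(i < k.+1) (-1) ^+ i *
    \sum_b val (X i p) (t b) * \prod_j val (X (lift i j) p) (y (b j)).
Proof.
case: k w t X => // k w t X _ wE t_skew.
pose V i l := val (X i p) (y l); pose Y i j l := val (X i p) (vf_app (X j) (y l)).
have T1 i : val (X i p) (form_on w (fun j => X (lift i j))) =
    \sum_b val (X i p) (t b) * \prod_j val (X (lift i j) p) (y (b j)) +
    \sum_(c < k.+1) tcontract (fun b => val (t b) p)
      (fun j => if j == c then Y i (lift i c) else V (lift i j)).
  pose F b j := vf_app (X (lift i j)) (y (b j)).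
  pose P (b : {ffun 'I_k.+1 -> 'I_m}) := 
    Dfun (dfun_prod (index_enum 'I_k.+1) (fun j => set_valP (F b j))).
  pose Q b := Dfun (dfun_mul (set_valP (t b)) (set_valP (P b))).
  pose S := Dfun (dfun_sum (index_enum {ffun 'I_k.+1 -> 'I_m}) (fun b => set_valP (Q b))).
  rewrite (@tangent_local _ _ _ (X i p) _ S); last first.
    by apply: filterS wE => q h; exact: h.
  rewrite (tangent_sum (X i p) (h := S) (f := Q) (fun=> erefl)).
  rewrite [X in _ + X]exchange_big /= -big_split/=; apply: eq_bigr => b _.
  rewrite (tangent_leibniz (X i p) (h := Q b) (f := t b) (g := P b) (fun=> erefl)).
  rewrite (tangent_prod (X i p) (h := P b) (f := F b) (fun=> erefl)).
  rewrite addrC; congr (_ + _); last exact: mulrC.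
  rewrite mulr_sumr; apply: eq_bigr => c _; congr (_ * _); apply: eq_bigr => j _.
  by case: eqP => [->|].
rewrite /dext_on; under eq_bigr => i _ do rewrite T1 mulrDr.
rewrite big_split/= -addrA [X in _ + X](_ : _ = 0) ?addr0//.
rewrite -[RHS](tcontract_cancel t_skew V Y); congr (_ + _).
apply: eq_bigr => i _; apply: eq_bigr => j _; congr (_ * _).
have := nbhs_singleton wE; move=> ->.
apply: eq_bigr => b _; congr (_ * _); apply: eq_bigr => l _.
case: (unliftP ord0 l) => [l' ->|->]; last by rewrite fcons0.
by rewrite fconsS.
Qed.

End DextFormula.

(** * Determinants *)

Section Determinants.
Variable R : realType.

(** Expanding the determinants gives one signed contraction for each of the [k!] permutations of the
    arguments, and skew symmetry makes all of them equal. *)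
Lemma tcontract_det k m (t : {ffun 'I_k -> 'I_m} -> R) (u : 'I_k -> 'I_m -> R) :
  (forall (b : {ffun 'I_k -> 'I_m}) (s : 'S_k), t [ffun j => b (s j)] = (-1) ^+ s * t b) ->
  tcontract t u = (k`!%:R)^-1 * \sum_b t b * \det (\matrix_(i, j) u j (b i)).
Proof.
move=> t_skew.
have -> : \sum_b t b * \det (\matrix_(i, j) u j (b i)) =
    \sum_(s : 'S_k) (-1) ^+ s * tcontract t (fun j => u (s j)).
  under eq_bigr => b _ do rewrite /determinant mulr_sumr.
  rewrite exchange_big; apply: eq_bigr => s _; rewrite /tcontract mulr_sumr.
  apply: eq_bigr => b _; rewrite mulrCA; congr (_ * (_ * _)).
  apply: eq_bigr => i _; exact: mxE.
under eq_bigr => s _ do rewrite tcontract_perm// mulrA -expr2 sqrr_sign mul1r.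
rewrite sumr_const card_Sn -[tcontract t u *+ _]mulr_natl mulrA mulVf ?mul1r//.
Qed.

(** After antisymmetrization, each term contains the determinant of a matrix of entries [c j (b i)].
    This matrix is a 0-1 matrix depending on [b] times the matrix of [c], so the determinant of the
    latter factors out. *)
Lemma mlin_det n (W : ('I_n -> 'I_n -> R) -> R) c : mlin W ->
  (forall c (s : 'S_n), W (fun j => c (s j)) = (-1) ^+ s * W c) ->
  W c = W (fun j l => (l == j)%:R) * \det (\matrix_(i, j) c j i).
Proof.
move=> mW sW; pose t (b : {ffun 'I_n -> 'I_n}) := W (fun j l => (l == b j)%:R).
have t_skew (b : {ffun 'I_n -> 'I_n}) (s : 'S_n) : t [ffun j => b (s j)] = (-1) ^+ s * t b.
  rewrite /t -sW; congr W; apply/funext => j; apply/funext => l.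
  by rewrite ffunE.
pose K := (n`!%:R)^-1 * \sum_b t b * \det (\matrix_(i, l < n) (l == b i)%:R : 'M[R]_n).
have WE c' : W c' = K * \det (\matrix_(i, j) c' j i).
  rewrite (mlin_expand _ mW).
  transitivity (tcontract t c').
    by apply: eq_bigr => b _; rewrite mulrC.
  rewrite tcontract_det// -mulrA mulr_suml; congr (_ * _); apply: eq_bigr => b _.
  rewrite -mulrA -det_mulmx; congr (_ * \det _); apply/matrixP => i j; rewrite !mxE.
  rewrite (bigD1 (b i))//= !mxE eqxx mul1r big1 ?addr0// => l /negbTE lb.
  by rewrite !mxE lb mul0r.
rewrite [LHS]WE [in RHS]WE [X in _ = _ * \det X * _](_ : _ = 1%:M) ?det1 ?mulr1//.
by apply/matrixP => i j; rewrite !mxE.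
Qed.

(** The change of frame in the formula for the exterior derivative. Once antisymmetrized, the
    alternating sum is the expansion along the first row of determinants whose first row is [T] and
    whose other rows are given by [Y]; passing to another frame multiplies these matrices by [A] on
    the right. *)
Lemma alternating_sum_det k m (A : 'M[R]_k.+1)
    (T : 'I_k.+1 -> {ffun 'I_k -> 'I_m} -> R) (Y : 'I_k.+1 -> 'I_m -> R)
    (T0 : 'I_k.+1 -> {ffun 'I_k -> 'I_m} -> R) (Y0 : 'I_k.+1 -> 'I_m -> R) :
  (forall i (b : {ffun 'I_k -> 'I_m}) (s : 'S_k), T0 i [ffun j => b (s j)] = (-1) ^+ s * T0 i b) ->
  (forall i b, T i b = \sum_l T0 l b * A l i) ->
  (forall i z, Y i z = \sum_l Y0 l z * A l i) ->
  \sum_(i < k.+1) (-1) ^+ i * \sum_b T i b * \prod_j Y (lift i j) (b j) =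
  (\sum_(i < k.+1) (-1) ^+ i * \sum_b T0 i b * \prod_j Y0 (lift i j) (b j)) * \det A.
Proof.
move=> T0_skew TE YE.
have T_skew i (b : {ffun 'I_k -> 'I_m}) (s : 'S_k) : T i [ffun j => b (s j)] = (-1) ^+ s * T i b.
  rewrite !TE mulr_sumr; apply: eq_bigr => l _; by rewrite T0_skew mulrA.
pose B (T : 'I_k.+1 -> {ffun 'I_k -> 'I_m} -> R) (Y : 'I_k.+1 -> 'I_m -> R)
    (b : {ffun 'I_k -> 'I_m}) : 'M[R]_k.+1 :=
  \matrix_(r < k.+1, i < k.+1) if unlift ord0 r is Some l then Y i (b l) else T i b.
have QE T1 Y1 : (forall i (b : {ffun 'I_k -> 'I_m}) (s : 'S_k),
      T1 i [ffun j => b (s j)] = (-1) ^+ s * T1 i b) ->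
    \sum_(i < k.+1) (-1) ^+ i * \sum_b T1 i b * \prod_j Y1 (lift i j) (b j) =
    (k`!%:R)^-1 * \sum_b \det (B T1 Y1 b).
  move=> sk.
  transitivity (\sum_(i < k.+1) (-1) ^+ i * tcontract (T1 i) (fun j => Y1 (lift i j))) => //.
  under eq_bigr => i _ do rewrite tcontract_det// mulrCA.
  rewrite -mulr_sumr; congr (_ * _).
  under [RHS]eq_bigr => b _ do rewrite (expand_det_row _ ord0).
  rewrite exchange_big; apply: eq_bigr => i _; rewrite mulr_sumr; apply: eq_bigr => b _.
  rewrite /cofactor add0n mulrCA mxE unlift_none; congr (_ * (_ * \det _)).
  by apply/matrixP => l j; rewrite !mxE liftK.
rewrite !QE// -mulrA mulr_suml; congr (_ * _); apply: eq_bigr => b _.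
rewrite -det_mulmx; congr (\det _); apply/matrixP => r i; rewrite !mxE.
case: (unliftP ord0 r) => [l ->|->].
  by rewrite YE; apply: eq_bigr => l' _; rewrite mxE liftK.
by rewrite TE; apply: eq_bigr => l' _; rewrite mxE unlift_none.
Qed.

End Determinants.

(** * Nondegenerate coordinates on dense subsets of the cube and on the box *)

Section Nondegeneracy.
Variable R : realType.

(** Since the derivative is known to exist, arbitrarily small increments of one sign determine it.
    At a boundary point only inward increments are available. *)
Lemma is_derive_eq0 (V : normedModType R) (f : V -> R) (x v : V) (d : R) :
  is_derive x v f d ->
  (forall e : R, 0 < e -> exists h : R, [/\ h != 0, `|h| < e & f (h *: v + x) = f x]) -> d = 0.
Proof.
move=> /is_deriveP /cvgrPdist_lt fd hz; apply/eqP; apply: contraT; rewrite -normr_gt0 => d0.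
have [e /= e0 he] := fd _ d0; have [h [h0 hlt fh]] := hz e e0.
have := he h; rewrite /ball_/= sub0r normrN => /(_ hlt h0).
by rewrite fh subrr mulr0 subr0 ltxx.
Qed.

Lemma inward_step (a b c e : R) : a < b -> a <= c <= b -> 0 < e ->
  exists h : R, [/\ h != 0, `|h| < e & a <= c + h <= b].
Proof.
move=> ab /andP[ac cb] e0.
have [cb'|bc] := ltP c b.
  have m0 : 0 < Num.min (e / 2) (b - c) by rewrite lt_min subr_gt0 cb' divr_gt0.
  exists (Num.min (e / 2) (b - c)); split; first by rewrite gt_eqF.
    by rewrite gtr0_norm// gt_min gtr_pMr// invf_lt1// ltr1n.
  rewrite (le_trans ac) ?lerDl ?(ltW m0)//=.
  by rewrite -lerBrDl ge_min lexx orbT.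
have ca : a < c by exact: lt_le_trans ab bc.
have m0 : 0 < Num.min (e / 2) (c - a) by rewrite lt_min subr_gt0 ca divr_gt0.
exists (- Num.min (e / 2) (c - a)); split; first by rewrite oppr_eq0 gt_eqF.
  by rewrite normrN gtr0_norm// gt_min gtr_pMr// invf_lt1// ltr1n.
rewrite lerBrDl -lerBrDr ge_min lexx orbT /=.
by rewrite (le_trans _ cb)// gerDl oppr_le0 ltW.
Qed.

Section RnSub.
Variables (n : nat) (D : set 'rV[R]_n).

Definition rcoord (l : 'I_n) (q : Rn_sub D) : R := val q 0 l.

Lemma rcoord_gen : gen_struct (range rcoord) = @dfun R (Rn_sub D).
Proof.
apply/seteqP; split=> f.
  apply: (gen_struct_comp (F := id) (dfunP (Rn_sub D))) => _ [l _ <-].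
  exact: coord_fun_subproof.
apply: (gen_struct_comp (F := id) (dfunP (gen_dspace (range rcoord)))) => _ [s ss <-].
have -> : s \o (val : D -> _) \o id = (fun q => s (\row_l rcoord l q)).
  by apply/funext => q /=; congr s; apply/rowP => l; rewrite mxE.
by apply: (@dfun_smooth R (gen_dspace (range rcoord))) => // l; apply: gen_structS; exists l.
Qed.

Hypothesis Dsub : D `<=` @ucube R n.
Hypothesis Ddense : @ucube R n `<=` closure D.

(** Density and continuity extend the vanishing of [rho] from the points of [D] near [p] to all
    points of the cube near [p]. There inward steps along each axis are possible, so all partial
    derivatives at [p] are zero. *)
Lemma rcoord_nondegenerate : nondegenerate_coords rcoord.
Proof.
move=> p r g s ss; rewrite /prop_near1 nbhs_weak_unif => -[r' [g' [e [Gg e0 hz]]]] v.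
pose rho (y : 'rV[R]_n) := s (\row_i y 0 (g i)).
have srho : smoothRn rho by exact: smoothRn_reindex.
have rhoD (q : Rn_sub D) : (forall l, `|val q 0 l - val p 0 l| < e) -> rho (val q) = 0.
  move=> hq; apply: hz => i; have [l _ <-] := Gg i; exact: hq.
have pU := Dsub (set_valP p).
have rhoU y : ucube y -> (forall l, `|y 0 l - val p 0 l| < e) -> rho y = 0.
  move=> /Ddense yD hy; apply: contrapT => /eqP ry.
  have nb : nbhs y [set z | rho z != 0 /\ forall l, `|z 0 l - val p 0 l| < e].
    apply: filterI.
      have cr : continuous rho by exact: smoothRn_continuous.
      exact: (cr y [set t | t != 0] (open_nbhs_nbhs (conj (@open_neq _ 0) ry))).
    apply: (filter_forall (nbhs_filter y)) => l.
    have cl : continuous (fun z : 'rV[R]_n => `|z 0 l - val p 0 l|).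
      move=> z; apply: (@continuous_comp _ _ _ (fun z : 'rV[R]_n => z 0 l - val p 0 l) Num.norm);
        last exact: norm_continuous.
      by apply: continuousB; [exact: coord_continuous|exact: cst_continuous].
    exact: (cl y _ (open_nbhs_nbhs (conj (@open_lt R e) (hy l)))).
  have [z [Dz [rz hz']]] := yD _ nb.
  by move/eqP: rz; apply; exact: (rhoD (SigSub (mem_set Dz))).
have dz l : pderiv l rho (val p) = 0.
  have dr : is_derive (val p) (delta_mx 0 l) rho (pderiv l rho (val p)).
    by apply: derivableP; exact: smoothRn_derivable.
  apply: (is_derive_eq0 dr) => d d0.
  have de0 : 0 < Num.min d e by rewrite lt_min d0.
  have [h [h0 hlt hU]] := inward_step ltr01 (pU l) de0.
  move: hlt; rewrite lt_min => /andP[hd he].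
  exists h; split=> //; rewrite !rhoU// => l'; rewrite ?subrr ?normr0// !mxE eqxx /=.
    have [->|_] := eqVneq l' l; first by rewrite mulr1 addrC.
    by rewrite mulr0 add0r; exact: pU.
  have [->|_] := eqVneq l' l; first by rewrite mulr1 addrK.
  by rewrite mulr0 add0r subrr normr0.
transitivity (\sum_k pderiv k s (\row_k (val p) 0 (g k)) * v (g k)) => //.
rewrite -sum_pderiv_reindex//.
by rewrite big1// => l _; rewrite -/rho dz mul0r.
Qed.

End RnSub.

Section Box.
Variable I : Type.

Definition bcoord (i : I) (q : box_space R I) : R := val q i.

Lemma bcoord_gen : gen_struct (range bcoord) = @dfun R (box_space R I).
Proof. by []. Qed.

Lemma bcoord_nondegenerate : nondegenerate_coords bcoord.
Proof.
move=> p r g s ss; rewrite /prop_near1 nbhs_weak_unif => -[r' [g' [e [Gg e0 hz]]]] v.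
(* The list [g] may repeat an index, in which case its entries cannot vary independently. Passing to
   the distinct indices [a l] allows one coordinate to be moved alone. *)
pose S := undup (codom (g : _ -> {classic I})).
pose a (l : 'I_(size S)) : I := tnth (in_tuple S) l.
have inja : injective a by move=> l l' /(tuple_uniqP (in_tuple S) (undup_uniq _)).
have hu i : exists l, g i = a l.
  have : (g i : {classic I}) \in S by rewrite mem_undup codom_f.
  by move=> /(tnthP (in_tuple S))[l ->]; exists l.
have [u uE] := choice hu.
pose rho (y : 'rV[R]_(size S)) := s (\row_i y 0 (u i)).
have srho : smoothRn rho by exact: smoothRn_reindex.
pose y0 : 'rV[R]_(size S) := \row_l bcoord (a l) p.
have E q : \row_i bcoord (g i) q = \row_i (\row_l bcoord (a l) q) 0 (u i).
  by apply/rowP => i; rewrite !mxE uE.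
have dz l : pderiv l rho y0 = 0.
  have dr : is_derive y0 (delta_mx 0 l) rho (pderiv l rho y0).
    by apply: derivableP; exact: smoothRn_derivable.
  apply: (is_derive_eq0 dr) => d d0.
  have de0 : 0 < Num.min d e by rewrite lt_min d0.
  have N11 : -1 < 1 :> R by lra.
  have pb : -1 <= bcoord (a l) p <= 1 by rewrite -ler_norml; exact: (set_valP p).
  have [h [h0 hlt hU]] := inward_step N11 pb de0.
  move: hlt; rewrite lt_min => /andP[hd he].
  pose qf : {ptws I -> R} := fun i => if `[< i = a l >] then val p i + h else val p i.
  have qb : unit_box qf.
    move=> i; rewrite /qf; case: asboolP => [->|_]; first by rewrite ler_norml.
    exact: (set_valP p).
  pose q : box_space R I := SigSub (mem_set qb).
  exists h; split=> //.
  have -> : h *: delta_mx 0 l + y0 = \row_l bcoord (a l) q.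
    apply/rowP => l'; rewrite !mxE eqxx /bcoord /= /qf.
    have [->|ll] := eqVneq l' l; first by rewrite asboolT// mulr1 addrC.
    by rewrite asboolF ?mulr0 ?add0r// => /inja /eqP; rewrite (negbTE ll).
  rewrite /rho -!E !hz// => i; first by rewrite subrr normr0.
  have [j _ <-] := Gg i; rewrite /bcoord /= /qf.
  by case: asboolP => _; rewrite ?subrr ?normr0// addrAC subrr add0r.
rewrite E; under eq_bigr => i _ do rewrite uE.
have := sum_pderiv_reindex u y0 (fun l => v (a l)) ss; rewrite -/y0 => <-.
by rewrite big1// => l _; rewrite -/rho dz mul0r.
Qed.

End Box.

End Nondegeneracy.

(** * Naturality *)

Section Naturality.
Variable R : realType.

Lemma smap_eq (A B : dspace R) (H1 H2 : smap A B) : (forall p, H1 p = H2 p) -> H1 = H2.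
Proof.
case: H1 H2 => [f pf] [g pg] /= /funext fg; case: _ / fg pg => pg.
by congr SMap; exact: Prop_irrelevance.
Qed.

Definition push (A B : dspace R) (F : smap A B) (p : A) (u : tangent p) : tangent (F p) :=
  SigSub (mem_set (tangent_map_subproof F u)).

Lemma tkmap_tuple k (A B : dspace R) (F : smap A B) (p : A) (u : 'I_k -> tangent p) :
  tkmap F (tuple_at u) = tuple_at (fun j => push F (u j)).
Proof. exact: val_inj. Qed.

Lemma tmap_comp (A B C : dspace R) (F : smap B C) (H : smap A B) (v : TM A) :
  tmap (comp_smap F H) v = tmap F (tmap H v).
Proof.
congr existT; apply: val_inj; apply/funext => f /=; congr (sval (projT2 v) _).
exact: val_inj.
Qed.

Lemma tkmap_comp k (A B C : dspace R) (F : smap B C) (H : smap A B) (V : tkspace k A) :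
  tkmap (comp_smap F H) V = tkmap F (tkmap H V).
Proof. by apply: val_inj; apply/funext => j; exact: tmap_comp. Qed.

Lemma dfun_tk k (A : dspace R) (j : 'I_k) (u : TM A -> R) : @dfun R (tspace A) u ->
  @dfun R (tkspace k A) (fun v => u (val v j)).
Proof.
move=> du; apply: gen_structS; exists (fun v : 'I_k -> TM A => u (v j)) => //.
by apply: gen_structS; exists j, u.
Qed.

Lemma pull_multilinear k (A B : dspace R) (F : smap A B) (w : kform k B) :
  multilinear (pull_form F w).
Proof.
move=> p i a b u v z h1 h2; rewrite /pull_form/= !tkmap_tuple.
apply: (form_multilinear w (i := i)) => [j ji|f]; last exact: h2.
by have [-> ->] := h1 j ji.
Qed.

Lemma pull_smooth k (A B : dspace R) (F : smap A B) (w : kform k B) :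
  dfun (pull_form F w).
Proof.
have := form_smooth w.
apply: (gen_struct_comp (F := tkmap F) (dfunP (tkspace k A))) => _ [f' pf' <-].
move: f' pf'; apply: (gen_struct_comp
  (F := fun v : tkspace k A => val (tkmap F v)) (dfunP (tkspace k A))) => _ [j [u du ->]].
move: u du; apply: (gen_struct_comp
  (F := fun v : tkspace k A => tmap F (val v j)) (dfunP (tkspace k A))) => _ [[g dg <-]|[g _ <-]].
  apply: (@dfun_tk k A j (fun v => g (F (projT1 v)))); apply: gen_structS; left.
  by exists (g \o F) => //; exact: smapP.
apply: (@dfun_tk k A j (dd (comp_dfun F g))); apply: gen_structS; right.
by exists (comp_dfun F g) => //; exact: set_valP.
Qed.

Definition pull_kform k (A B : dspace R) (F : smap A B) (w : kform k B) : kform k A :=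
  KForm (pull_multilinear F w) (pull_smooth F w).

Lemma pull_skew k (A B : dspace R) (F : smap A B) (w : kform k B) :
  skew_symmetric w -> skew_symmetric (pull_kform F w).
Proof.
move=> sw p s v; rewrite /= /pull_form /= !tkmap_tuple.
by rewrite -(sw _ s).
Qed.

End Naturality.

Section DextValue.
Variable R : realType.
Variables (N : dspace R) (I : Type) (x : I -> N -> R).
Hypothesis hx : gen_struct (range x) = @dfun R N.
Hypothesis nondeg : nondegenerate_coords x.

(** The right-hand side involves the fields only through their values at [p], so every choice of
    fields in [dext] gives the same number. Constant fields show that a choice exists, which
    excludes the default 0. *)
Lemma dextE k (w : kform k N) (p : N) (u : 'I_k.+1 -> tangent p) m
    (y : 'I_m -> @dfun R N) (t : {ffun 'I_k -> 'I_m} -> @dfun R N) : (0 < k)%N ->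
  (\forall q \near (p : weak_unif (@dfun R N)), forall u : 'I_k -> tangent q,
    w (tuple_at u) = \sum_b val (t b) q * \prod_j val (u j) (y (b j))) ->
  (forall (b : {ffun 'I_k -> 'I_m}) (s : 'S_k),
    val (t [ffun j => b (s j)]) p = (-1) ^+ s * val (t b) p) ->
  dext w (tuple_at u) = \sum_(i < k.+1) (-1) ^+ i *
    \sum_b val (u i) (t b) * \prod_j val (u (lift i j)) (y (b j)).
Proof.
move=> k0 wE tsk; rewrite /dext; case: xgetP => [d _ [X [p' [hX ->]]]|].
  have pp : p = p' by exact: (congr1 (@projT1 _ _) (hX ord0)).
  subst p'.
  have XE i f : val (X i p) f = val (u i) f by rewrite -[LHS]/(dd f (tpoint (X i p))) -hX.
  rewrite (dext_on_local X k0 wE tsk); apply: eq_bigr => i _; congr (_ * _).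
  by apply: eq_bigr => b _; rewrite XE; congr (_ * _); apply: eq_bigr => j _; rewrite XE.
pose X i := cfield hx nondeg (fun l => val (u i) (xcoord hx l)).
move=> /(_ (dext_on w X p)) []; exists X, p; split=> // i.
by congr tpoint; exact: tangent_cfield.
Qed.

End DextValue.

(** * Coordinate vector fields on a dense subset of the cube *)

Section RnFields.
Variable R : realType.
Variables (n : nat) (D : set 'rV[R]_n).
Hypothesis Dsub : D `<=` @ucube R n.
Hypothesis Ddense : @ucube R n `<=` closure D.

Let hx := rcoord_gen D.
Let nd := rcoord_nondegenerate Dsub Ddense.

Definition pd (l : 'I_n) : vfield (Rn_sub D) := cfield hx nd (fun i => (i == l)%:R).

Lemma coord_funE i : coord_fun D i = xcoord hx i.
Proof. exact: val_inj. Qed.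

Lemma pd_coord l q i : val (pd l q) (coord_fun D i) = (i == l)%:R.
Proof. by rewrite coord_funE; exact: cfield_coord. Qed.

Lemma tangent_pd (q : Rn_sub D) (v : tangent q) f :
  val v f = \sum_l val v (coord_fun D l) * val (pd l q) f.
Proof.
have [r [g [s fE]]] := crep_ex hx q (set_valP f).
rewrite (tangent_crep hx v fE).
under [RHS]eq_bigr => l _ do rewrite (tangent_crep hx (pd l q) fE) mulr_sumr.
rewrite exchange_big; apply: eq_bigr => i _.
rewrite (bigD1 (g i))// big1 ?addr0 => [|l lg].
  by rewrite -!coord_funE pd_coord eqxx mulr1 [RHS]addr0 mulrC.
by rewrite -coord_funE pd_coord eq_sym (negbTE lg) !mulr0.
Qed.

Lemma tangent_eq_coord (q : Rn_sub D) (u v : tangent q) :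
  (forall i, val u (coord_fun D i) = val v (coord_fun D i)) -> u = v.
Proof.
move=> uv; apply: val_inj; apply/funext => f; rewrite (tangent_pd u) (tangent_pd v).
by apply: eq_bigr => l _; rewrite uv.
Qed.

Lemma pd_bracket i j q f : val (bracket (pd i) (pd j) q) f = 0.
Proof.
rewrite tangent_pd big1// => l _.
have cst0 i' j' : val (pd i' q) (vf_app (pd j') (coord_fun D l)) = 0.
  by apply: (tangent_cst (pd i' q) (c := (l == j')%:R)) => q'; exact: pd_coord.
rewrite -[val (bracket _ _ _) _]/(val (pd i q) (vf_app (pd j) (coord_fun D l)) -
  val (pd j q) (vf_app (pd i) (coord_fun D l))).
by rewrite !cst0 subrr mul0r.
Qed.

Lemma form_top (w : kform n (Rn_sub D)) (q : Rn_sub D) (v : 'I_n -> tangent q) :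
  skew_symmetric w ->
  w (tuple_at v) = w (tuple_at (fun l => pd l q)) *
    \det (\matrix_(i, j) val (v j) (coord_fun D i)).
Proof.
move=> sw; rewrite (wcoordE hx nd) (mlin_det _ (mlin_wcoord hx nd w q)) => [|c s].
  congr (_ * \det _); apply/matrixP => i j.
  by rewrite !mxE coord_funE.
by rewrite /wcoord -sw.
Qed.

Lemma dext_on_pd k (w : kform k (Rn_sub D)) (l : 'I_k.+1 -> 'I_n) q : (0 < k)%N ->
  dext_on w (fun i => pd (l i)) q =
  \sum_(i < k.+1) (-1) ^+ i * val (pd (l i) q) (form_on w (fun j => pd (l (lift i j)))).
Proof.
case: k w l => // k w l _; rewrite /dext_on [X in _ + X](_ : _ = 0) ?addr0//.
apply: big1 => i _; apply: big1 => j _.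
set V := tuple_at _; have -> : w V = 0 * w V + 0 * w V.
  apply: (form_multilinear w (i := ord0)) => [//|f].
  by rewrite !mul0r addr0; exact: pd_bracket.
by rewrite !mul0r addr0 mulr0.
Qed.

End RnFields.

Section DextPullback.
Variable R : realType.
Variables (N : dspace R) (I : Type) (x : I -> N -> R).
Hypothesis hx : gen_struct (range x) = @dfun R N.
Hypothesis nondeg : nondegenerate_coords x.
Variables (k : nat) (D : set 'rV[R]_k.+1).
Hypothesis Dsub : D `<=` @ucube R k.+1.
Hypothesis Ddense : @ucube R k.+1 `<=` closure D.

(** Both sides are given by the local formula with the same pulled-back data [t'] and [y'], because
    a pushed-forward vector acts on [f] as the original one acts on [f \o F]. The left side is taken
    on the frame [v], the right side on the coordinate frame, and the determinant compares the
    two. *)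
Lemma dext_pull (F : smap (Rn_sub D) N) (w : kform k N) (q : Rn_sub D)
    (v : 'I_k.+1 -> tangent q) : (0 < k)%N -> skew_symmetric w ->
  dext w (tkmap F (tuple_at v)) =
  dext_on (pull_kform F w) (pd Dsub Ddense) q *
    \det (\matrix_(i, j) val (v j) (coord_fun D i)).
Proof.
move=> k0 sw; have [m [y [t [wE /(_ sw) tsk]]]] := form_local hx nondeg w (F q).
rewrite tkmap_tuple (dextE hx nondeg _ k0 wE) => [|b s]; last exact: tsk.
pose y' l := comp_dfun F (y l); pose t' b := comp_dfun F (t b).
have cF : continuous (F : weak_unif (@dfun R (Rn_sub D)) -> weak_unif (@dfun R N)).
  by apply: weak_map_continuous => f; exact: smapP.
have wE' : \forall q \near (q : weak_unif (@dfun R (Rn_sub D))), forall u : 'I_k -> tangent q,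
    pull_kform F w (tuple_at u) = \sum_b val (t' b) q * \prod_j val (u j) (y' (b j)).
  have nq : nbhs (q : weak_unif (@dfun R (Rn_sub D))) _ := cF q _ wE.
  apply: (filterS _ nq) => q' h u.
  by rewrite /= /pull_form /= tkmap_tuple; exact: h.
rewrite (dext_on_local (pd Dsub Ddense) k0 wE') => [|b s]; last exact: tsk.
apply: (alternating_sum_det (T := fun i b => val (v i) (t' b)) (Y := fun i l => val (v i) (y' l))
   (T0 := fun l b => val (pd Dsub Ddense l q) (t' b))
   (Y0 := fun l z => val (pd Dsub Ddense l q) (y' z))).
- move=> i b s.
  rewrite (tangent_lin _ (a := (-1) ^+ s) (b := 0) (f := t' b) (g := t' b)) ?mul0r ?addr0// => q'.
  by rewrite mul0r addr0; exact: tsk.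
- move=> i b; rewrite (tangent_pd Dsub Ddense); apply: eq_bigr => l _.
  by rewrite mxE mulrC.
move=> i z; rewrite (tangent_pd Dsub Ddense); apply: eq_bigr => l _.
by rewrite mxE mulrC.
Qed.

End DextPullback.

(** * Coefficients of forms on cubes *)

Section Clamp.
Variables (R : realType) (n : nat).
Local Notation U := (Rn_sub (@ucube R n)).

Lemma clamp_subproof (y : 'rV[R]_n) :
  ucube (\row_l Num.max 0 (Num.min 1 (y 0 l)) : 'rV[R]_n).
Proof. by move=> l; rewrite mxE le_max lexx ge_max ler01 ge_min lexx. Qed.

(** A continuous retraction of R^n onto the cube. It turns functions on the cube into continuous
    functions on R^n, the only ones to which the lemmas on iterated integrals apply. *)
Definition clamp (y : 'rV[R]_n) : U := SigSub (mem_set (clamp_subproof y)).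

Lemma clampE y : ucube y -> val (clamp y) = y.
Proof.
move=> yU; apply/rowP => l; rewrite mxE; have /andP[y0 y1] := yU l.
by rewrite min_r// max_r.
Qed.

Lemma clampK q : clamp (val q) = q.
Proof. by apply: val_inj; apply: clampE; exact: (set_valP q). Qed.

Local Notation wU := (weak_unif (range (@rcoord R n (@ucube R n)))).

Lemma clamp_continuous : continuous (clamp : 'rV[R]_n -> wU).
Proof.
apply: weak_unif_continuous => _ [l _ <-].
have -> : rcoord l \o clamp = (cst 0 : 'rV[R]_n -> R^o) \max
    ((cst 1 : 'rV[R]_n -> R^o) \min (fun y => y 0 l)).
  by apply/funext => y; rewrite /rcoord /= mxE.
move=> y; apply: continuous_max; first exact: cst_continuous.
by apply: continuous_min; [exact: cst_continuous|exact: coord_continuous].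
Qed.

Lemma dfun_clamp_continuous (f : U -> R) : dfun f -> continuous (f \o clamp).
Proof.
rewrite -rcoord_gen => df y.
apply: (@continuous_comp _ _ _ (clamp : 'rV[R]_n -> wU) f).
  exact: clamp_continuous.
have cf : continuous (f : wU -> R) by exact: gen_continuous.
exact: cf.
Qed.

End Clamp.

Section CubeFields.
Variables (R : realType) (n : nat).
Local Notation U := (Rn_sub (@ucube R n)).

Local Notation wU := (weak_unif (range (@rcoord R n (@ucube R n)))).

Definition cpd : 'I_n -> vfield U :=
  pd (@subset_refl _ (@ucube R n)) (@subset_closure _ (@ucube R n)).

(** Even if [x] lies on the boundary, the inserted point stays in the cube while its coordinate [i]
    varies near [t]. Hence [clamp] is the identity along this segment and an ordinary chain rule
    applies. *)
Lemma is_derive_clamp (f : @dfun R U) i (x : 'rV[R]_n.-1) (t : R) :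
  ucube x -> 0 < t < 1 ->
  is_derive t (1 : R) (fun t => val f (clamp (insert_coord i t x)))
    (val (cpd i (clamp (insert_coord i t x))) f).
Proof.
move=> xU t01; have /andP[t0 t1] := t01.
pose q := clamp (insert_coord i t x).
have [r [g [s fE]]] := crep_ex (rcoord_gen (@ucube R n)) q (set_valP f).
rewrite (tangent_crep (rcoord_gen (@ucube R n)) (cpd i q) fE).
under eq_bigr => j _ do rewrite -coord_funE pd_coord.
have [ss fnear] := fE.
have insU u : 0 < u < 1 -> ucube (insert_coord i u x).
  by move=> /andP[u0 u1]; apply: ucube_insert => //; rewrite !ltW.
have -> : \row_j rcoord (g j) q = \row_j (insert_coord i t x) 0 (g j).
  by apply/rowP => j; rewrite [LHS]mxE [RHS]mxE /rcoord clampE//; exact: insU.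
have dins (j : 'I_r) : is_derive t (1 : R) (fun u => insert_coord i u x 0 (g j)) (g j == i)%:R.
  apply/is_deriveP; apply: cvg_near_cst; near=> h.
  have h0 : h != 0 by near: h; exact: nbhs_dnbhs_neq.
  rewrite [h *: (1 : R)]mulr1 !mxE; case: unliftP => [l ->|->].
    by rewrite subrr mulr0 eq_sym (negbTE (neq_lift _ _)).
  by rewrite eqxx addrK mulVf.
apply: near_eq_is_derive (is_derive_smooth ss dins).
have cq : continuous ((fun u => clamp (insert_coord i u x)) : R -> wU).
  move=> u; apply: (@continuous_comp _ _ _ (fun u => insert_coord i u x)
    (@clamp R n : _ -> wU)); last exact: clamp_continuous.
  have h : (fun u => (u, x)) @ u --> (u, x) by exact: (cvg_pair (@cvg_id _ (nbhs u)) (cvg_cst x)).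
  exact: (cvg_comp _ _ h (cvg_insert (i:=i) (t:=u) (x:=x))).
have nt := cq t _ fnear.
near=> u.
have u01 : 0 < u < 1.
  apply/andP; split; near: u; last exact: lt_nbhsl.
  exact: near_gt0.
have fu : val f (clamp (insert_coord i u x)) = s (\row_j rcoord (g j) (clamp (insert_coord i u x))).
  by near: u; exact: nt.
rewrite fu; congr s; apply/rowP => j.
by rewrite [LHS]mxE [RHS]mxE /rcoord clampE//; exact: insU.
Unshelve. all: by end_near. Qed.

End CubeFields.
Arguments cpd {R n}.

Lemma eq_integral_ucube (R : realType) n (f g : 'rV[R]_n -> R) :
  (forall x, ucube x -> f x = g x) -> integral_ucube f = integral_ucube g.
Proof.
elim: n f g => [|n IH] f g fg; first by apply: fg => -[].
rewrite !integral_ucubeS; apply: eq_Rintegral => t; rewrite inE/= in_itv/= => t01.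
by apply: IH => x xU; apply: fg; exact: ucube_insert.
Qed.

Lemma integral_dext_on (R : realType) k (w : kform k (Rn_sub (@ucube R k.+1))) : (0 < k)%N ->
  integral_ucube (fun y => dext_on w (@cpd R k.+1) (clamp y)) =
  \sum_(i < k.+1) (-1) ^+ i *
    (integral_ucube (fun x =>
        val (form_on w (fun j => cpd (lift i j))) (clamp (insert_coord i 1 x))) -
     integral_ucube (fun x =>
        val (form_on w (fun j => cpd (lift i j))) (clamp (insert_coord i 0 x)))).
Proof.
move=> k0; pose c (i : 'I_k.+1) := form_on w (fun j : 'I_k => cpd (lift i j)).
have cc (f : @dfun R (Rn_sub (@ucube R k.+1))) : continuous (fun y => val f (clamp y)).
  exact: (dfun_clamp_continuous (set_valP f)).
transitivity (integral_ucube (fun y =>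
    \sum_(i < k.+1) (-1) ^+ i * val (vf_app (cpd i) (c i)) (clamp y))).
  by congr integral_ucube; apply/funext => y; rewrite dext_on_pd.
rewrite -(mean_sum _ _ (mean_ucube R k.+1)) => [|i]; last exact: cc.
apply: eq_bigr => i _; congr (_ * _).
apply: (integral_ucube_FTC (f := fun y => val (c i) (clamp y))) => [| |x t xU t01]; try exact: cc.
exact: is_derive_clamp.
Qed.

Section Coefficients.
Variables (R : realType) (M : dspace R).

(** On the coordinate frame the determinant is 1, so the form itself gives the coefficient on the
    domain of [phi]. Density and continuity extend the equality to the cube. *)
Lemma is_coef_ext_unique n (w : tkspace n M -> R) (phi : cube n M) c c' :
  is_coef_ext w phi c -> is_coef_ext w phi c' -> forall y, ucube y -> c y = c' y.
Proof.
move=> [cc cE] [cc' cE'] y yU.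
have onD (x : Rn_sub (cdom phi)) : c (val x) = c' (val x).
  pose X := pd (@cdom_sub _ _ _ phi) (@cdom_dense _ _ _ phi).
  have := cE x (fun l => X l x); rewrite cE'.
  have -> : (\matrix_(i, j) val (X j x) (coord_fun (cdom phi) i)) = 1%:M.
    by apply/matrixP => i j; rewrite !mxE pd_coord.
  by rewrite det1 !mulr1.
apply/eqP; apply: contraT => cy.
pose e := `|c y - c' y| / 2.
have e0 : 0 < e by rewrite divr_gt0// normr_gt0 subr_eq0.
have near1 (f : 'rV[R]_n -> R) : {within @ucube R n, continuous f} ->
    nbhs y [set z | ucube z -> `|f y - f z| < e].
  move=> /subspace_continuousP /(_ y yU) /cvgrPdist_lt /(_ e e0).
  by [].
have [z [Dz [h h']]] := @cdom_dense _ _ _ phi y yU _ (filterI (near1 _ cc) (near1 _ cc')).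
have zU := @cdom_sub _ _ _ phi z Dz.
have := onD (SigSub (mem_set Dz)); rewrite /= => cz.
have := ltrD (h zU) (h' zU).
rewrite [ltRHS](_ : _ = `|c y - c' y|); last by rewrite /e -splitr.
have -> : c y - c' y = (c y - c z) - (c' y - c' z) by rewrite cz; ring.
by rewrite ltNge ler_normB.
Qed.

(** The function chosen in [integral_cube] is determined on the cube only, which is all that the
    integral sees. *)
Lemma integral_cube_coef n (w : tkspace n M -> R) (phi : cube n M) c :
  is_coef_ext w phi c -> integral_cube w phi = integral_ucube c.
Proof.
move=> hc; rewrite /integral_cube; case: eqP => // e.
rewrite (eq_irrelevance e erefl)/=; apply: eq_integral_ucube => x xU.
case: xgetP => [c' _ hc'|/(_ c)//].
exact: is_coef_ext_unique hc' hc _ xU.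
Qed.

Lemma integral_cube_neq k n (w : tkspace k M -> R) (phi : cube n M) :
  k <> n -> integral_cube w phi = 0.
Proof. by rewrite /integral_cube; case: eqP. Qed.

Lemma integrable_cube_coef n (w : tkspace n M -> R) (phi : cube n M) c :
  is_coef_ext w phi c -> integrable_cube w phi.
Proof. by move=> hc e; exists c; rewrite (eq_irrelevance e erefl). Qed.

End Coefficients.

(** * Extension of cubes and the boundary formula *)

Section Extension.
Variables (R : realType) (M : dspace R) (G : set (M -> R)) (n : nat) (phi : cube n M).

Definition base_gen (g : G) : tgens G :=
  SigSub (mem_set (or_introl (ex_intro2 _ _ (val g) (set_valP g) erefl :
    [set g \o @projT1 _ _ | g in G] (val g \o @projT1 _ _)))).

(** On completions this is the map induced by the projection of [TM] onto [M]. *)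
Definition base_proj (z : {ptws (tgens G) -> R}) : {ptws G -> R} := fun g => z (base_gen g).

Lemma base_proj_continuous : continuous base_proj.
Proof.
move=> z; have FF : Filter (base_proj @ nbhs z) by exact: fmap_filter.
apply/cvg_sup => g.
have : continuous (base_proj : {ptws (tgens G) -> R} -> initial_topology (fun f : G -> R => f g)).
  apply: continuous_comp_initial.
  exact: (@proj_continuous {classic (tgens G)} (fun=> R) (base_gen g)).
by move/(_ z).
Qed.

Lemma base_proj_completion z : completion z -> completion (base_proj z).
Proof.
move=> hz U /base_proj_continuous /hz[_ [[v _ <-] Uv]].
by exists (base_proj (@ev R (TM M) (tgens G) v)); split=> //; exists (projT1 v).
Qed.

Lemma zero_section_subproof (x : Rn_sub (@ucube R n)) :
  cylinder (row_mx (val x) 0 : 'rV[R]_(n + n)).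
Proof. by rewrite /cylinder/= row_mxKl; exact: (set_valP x). Qed.

Definition zero_section (x : Rn_sub (@ucube R n)) : Rn_sub (@cylinder R n) :=
  SigSub (mem_set (zero_section_subproof x)).

Lemma zero_section_smooth f : dfun f -> dfun (f \o zero_section).
Proof.
apply: (gen_struct_comp (dfunP (Rn_sub (@ucube R n)))) => _ [s ss <-].
apply: gen_structS; exists (fun x : 'rV[R]_n => s (row_mx x 0)) => //.
have -> : (fun x : 'rV[R]_n => s (row_mx x 0)) =
    (fun x => s (\row_i (if fintype.split i is inl j then x 0 j else 0))).
  apply/funext => x; congr s; apply/rowP => i; rewrite !mxE.
  by case: fintype.split => j //; rewrite mxE.
apply: (smoothRn_comp (f := fun (i : 'I_(n + n)) (x : 'rV[R]_n) =>
  if fintype.split i is inl j then x 0 j else 0) ss) => i.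
by case: fintype.split => j; [exact: smoothRn_coord|exact: smoothRn_cst].
Qed.

Lemma extendable_extends : extendable_cube G phi ->
  exists F : smap (Rn_sub (@ucube R n)) (completion_space G), extends_cube phi F.
Proof.
move=> [_ [Psi [_ PsiE Psismooth]]].
pose F0 (x : Rn_sub (@ucube R n)) : completion_space G :=
  SigSub (mem_set (base_proj_completion (set_valP (Psi (zero_section x))))).
have sF : forall f, @dfun R (completion_space G) f -> dfun (f \o F0).
  apply: (gen_struct_comp (dfunP (Rn_sub (@ucube R n)))) => _ [g _ <-].
  have : dfun ((fun z : completion_space (tgens G) => val z (base_gen g)) \o Psi).
    by apply: Psismooth; apply: gen_structS; exists (base_gen g).
  by move=> /zero_section_smooth.
exists (SMap sF) => x y xy; apply: val_inj; apply/funext => g /=.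
have nd := rcoord_nondegenerate (@cdom_sub _ _ _ phi) (@cdom_dense _ _ _ phi).
(* The zero vector at [x], whose coordinates [(x, 0)] are those of the zero section at [y], so [Psi]
   is known there. *)
pose v : TM (Rn_sub (cdom phi)) := tpoint (cfield (rcoord_gen (cdom phi)) nd (fun=> 0) x).
rewrite /base_proj (PsiE v)//=.
rewrite xy /TD_coord /=; congr row_mx; apply/rowP => i; rewrite !mxE.
by rewrite coord_funE; apply/esym; exact: cfield_coord.
Qed.

End Extension.

Section PerCube.
Variables (R : realType) (M : dspace R) (G : set (M -> R)).
Hypotheses (hG : gen_struct G = @dfun R M) (hb : bounded1 G).
Variables (k : nat) (teta : kform k (box_space R G)).
Hypotheses (k0 : (0 < k)%N) (teta_skew : skew_symmetric teta).
Variables (phi : cube k.+1 M) (F : smap (Rn_sub (@ucube R k.+1)) (completion_space G)).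
Hypothesis phiF : extends_cube phi F.

Let Phi := comp_smap (compl_to_box hb) F.
Let w := pull_kform Phi teta.
Let w_skew : skew_symmetric w := pull_skew Phi teta_skew.
Let c (i : 'I_k.+1) := form_on w (fun j : 'I_k => cpd (lift i j)).

Lemma push_face (i : 'I_k.+1) (a : bool) (x : Rn_sub (@ucube R k)) (l : 'I_k) :
  push (face R i a) (cpd l x) = cpd (lift i l) (face R i a x)
    :> @tangent R (Rn_sub (@ucube R k.+1)) (face_fun i a x).
Proof.
apply: (tangent_eq_coord (@subset_refl _ (@ucube R k.+1))
  (@subset_closure _ (@ucube R k.+1))) => i'.
rewrite pd_coord /=; case: (unliftP i i') => [l' ->|->].
  rewrite (inj_eq lift_inj).
  rewrite -(pd_coord (@subset_refl _ (@ucube R k)) (@subset_closure _ (@ucube R k)) l x l').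
  congr (sval (cpd l x) _); apply: val_inj; apply/funext => y /=.
  by rewrite mxE liftK.
rewrite (negbTE (neq_lift _ _)).
apply: (tangent_cst (cpd l x) (c := a%:R)) => y /=.
by rewrite mxE unlift_none.
Qed.

(** A face map sends the coordinate fields of the face to those of the cube other than the [i]-th,
    so the coefficient over the face is [w] on the frame with that field omitted. *)
Lemma face_coef (i : 'I_k.+1) (a : bool) :
  is_coef_ext (pull_form (compl_to_box hb) teta) (full_cube (comp_smap F (face R i a)))
    (fun x => val (c i) (face R i a (clamp x))).
Proof.
split.
  apply: continuous_subspaceT; apply: (dfun_clamp_continuous (f := val (c i) \o face R i a)).
  by apply: smapP; exact: (set_valP (c i)).
move=> x v /=; rewrite clampK.
rewrite /pull_form /= -tkmap_comp.
have -> : comp_smap (compl_to_box hb) (comp_smap F (face R i a)) = comp_smap Phi (face R i a).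
  exact: smap_eq.
have := form_top (@subset_refl _ (@ucube R k)) (@subset_closure _ (@ucube R k))
  v (pull_skew (face R i a) w_skew).
rewrite /= /pull_form /= -!tkmap_comp => ->; congr (_ * _).
rewrite tkmap_comp tkmap_tuple; congr (teta (tkmap Phi (tuple_at _))).
by apply/funext => l; exact: push_face.
Qed.

Lemma cdom_incl_subproof f : dfun f ->
  dfun (f \o (fun x : Rn_sub (cdom phi) =>
    SigSub (mem_set (@cdom_sub _ _ _ phi _ (set_valP x))) : Rn_sub (@ucube R k.+1))).
Proof.
apply: (gen_struct_comp (dfunP (Rn_sub (cdom phi)))) => _ [s ss <-].
by apply: gen_structS; exists s.
Qed.

Definition cdom_incl : smap (Rn_sub (cdom phi)) (Rn_sub (@ucube R k.+1)) := SMap cdom_incl_subproof.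

Lemma dext_coef : is_coef_ext (pull_form (to_box hG hb) (dext teta)) phi
  (fun y => dext_on w cpd (clamp y)).
Proof.
split.
  apply: continuous_subspaceT.
  have -> : (fun y => dext_on w cpd (clamp y)) =
      (fun q => \sum_(i < k.+1) (-1) ^+ i * val (vf_app (cpd i) (c i)) q) \o @clamp R k.+1.
    by apply/funext => y; rewrite dext_on_pd.
  apply: dfun_clamp_continuous; apply: dfun_sum => i.
  by apply: dfun_mul; [exact: dfun_cst|exact: set_valP].
move=> x v; rewrite /pull_form /= -tkmap_comp.
(* Over its domain the cube, seen in the box, is the restriction of [Phi]. This carries the
   computation over to the full cube, where the coefficient is continuous up to the boundary. *)
have -> : comp_smap (to_box hG hb) phi = comp_smap Phi cdom_incl.
  apply: smap_eq => q; apply: val_inj => /=.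
  by rewrite (phiF (x := q)).
rewrite tkmap_comp tkmap_tuple.
rewrite (dext_pull (@bcoord_gen R G) (@bcoord_nondegenerate R G)
  (@subset_refl _ (@ucube R k.+1)) (@subset_closure _ (@ucube R k.+1)))//.
have -> : clamp (val x) = cdom_incl x by exact: (clampK (cdom_incl x)).
congr (_ * \det _).
apply/matrixP => i j; rewrite !mxE /=; congr (sval (v j) _).
exact: val_inj.
Qed.

Lemma stokes_cube :
  integral_cube (pull_form (to_box hG hb) (dext teta)) phi =
  \sum_(i < k.+1) \sum_(a : bool) (-1) ^+ (i.+1 + a) *
    integral_cube (pull_form (compl_to_box hb) teta) (full_cube (comp_smap F (face R i a))).
Proof.
rewrite (integral_cube_coef dext_coef) integral_dext_on//.
apply: eq_bigr => i _; rewrite big_bool /= !(integral_cube_coef (face_coef i _)).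
have E (a : bool) : integral_ucube (fun x => val (c i) (face R i a (clamp x))) =
    integral_ucube (fun x => val (c i) (clamp (insert_coord i a%:R x))).
  apply: eq_integral_ucube => x xU; congr (val (c i) _); apply: val_inj.
  rewrite [RHS]clampE; first by rewrite -[LHS]/(insert_coord i a%:R (val (clamp x))) clampE.
  exact: insert_ucube.
(* The sign [(-1) ^ (i.+1 + a)] equals [(-1) ^ i] on the face [a = 1] and its opposite on [a = 0],
   as the fundamental theorem of calculus requires. *)
by rewrite !E addn1 addn0 !exprS mulrBr; ring.
Qed.

End PerCube.

(** * Linear extension from cubes to chains *)

Section FormalSums.
Variables (R : realType) (K : choiceType) (V : lmodType R) (f : K -> V).
Implicit Types D : {freeg K / R}.

Lemma fglift0 : fglift f (0 : {freeg K / R}) = 0.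
Proof. by have := lift_is_additive f (0 : {freeg K / R}) 0; rewrite !subrr. Qed.

Lemma fgliftD D1 D2 : fglift f (D1 + D2) = fglift f D1 + fglift f D2.
Proof.
have addf := lift_is_additive f.
by rewrite -[D2 in LHS]opprK addf -[- D2]sub0r addf fglift0 sub0r opprK.
Qed.

Lemma fglift_sum (J : Type) (r : seq J) (F : J -> {freeg K / R}) :
  fglift f (\sum_(j <- r) F j) = \sum_(j <- r) fglift f (F j).
Proof. by apply: (big_morph _ fgliftD fglift0). Qed.

Lemma fglift_domE D : fglift f D = \sum_(z <- freeg.dom D) coeff z D *: f z.
Proof.
rewrite -[D in LHS]freeg_sumE fglift_sum; apply: eq_bigr => z _.
exact: liftU.
Qed.

Lemma fgliftZ a D : fglift f (a *: D) = a *: fglift f D.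
Proof.
rewrite [_ *: _]/(fgscale a D) /fgscale fglift_sum fglift_domE scaler_sumr.
by apply: eq_bigr => z _; rewrite liftU scalerA.
Qed.

End FormalSums.

Section Chains.
Variables (R : realType) (M : dspace R) (G : set (M -> R)).

Lemma boundary_cubeE n (phi : cube n M) : extendable_cube G phi ->
  exists F : smap (Rn_sub (@ucube R n)) (completion_space G), extends_cube phi F /\
    boundary_cube G phi = \sum_(i < n) \sum_(a : bool) (-1) ^+ (i.+1 + a) *:
      << (full_cube (comp_smap F (face R i a)) : {classic cube n.-1 (completion_space G)}) >>.
Proof.
move=> /extendable_extends ex; rewrite /boundary_cube; case: pselect => // h.
by exists (projT1 (cid h)); split=> //; exact: (projT2 (cid h)).
Qed.

(** Faces may cancel or coincide in the boundary, so its support is only contained in the set of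
    faces. Integrability over the boundary needs no more than this inclusion. *)
Lemma dom_boundary n (Phi : chain n M) (psi : cube n.-1 (completion_space G)) :
  extendable_chain G Phi -> (psi : {classic _}) \in freeg.dom (boundary G Phi) ->
  exists (phi : cube n M) (F : smap (Rn_sub (@ucube R n)) (completion_space G)) i a,
    extends_cube phi F /\ psi = full_cube (comp_smap F (face R i a)).
Proof.
move=> Phi_ext; rewrite /boundary fglift_domE => /dom_sum_subset.
move=> /flatten_mapP[phi]; rewrite mem_filter /= => phiD /domZ_subset.
have [F [phiF ->]] := boundary_cubeE (Phi_ext phi phiD).
move=> /dom_sum_subset /flatten_mapP[i _] /dom_sum_subset /flatten_mapP[a _] /domZ_subset.
rewrite domU1 inE => /eqP ->.
by exists phi, F, i, a.
Qed.

(** [J] is abstract so as to serve both the formula on cubes of dimension [k.+1] and the other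
    dimensions, where all integrals are 0. The hypothesis covers every extension [F], since
    [boundary_cube] picks one by choice. *)
Lemma integral_boundary n k (w : tkspace k (completion_space G) -> R) (Phi : chain n M)
    (J : cube n M -> R) : extendable_chain G Phi ->
  (forall (phi : cube n M) (F : smap (Rn_sub (@ucube R n)) (completion_space G)),
     extends_cube phi F -> J phi = \sum_(i < n) \sum_(a : bool) (-1) ^+ (i.+1 + a) *
       integral_cube w (full_cube (comp_smap F (face R i a)))) ->
  integral_chain w (boundary G Phi) = fglift (J : {classic cube n M} -> R^o) Phi.
Proof.
move=> Phi_ext JE; rewrite /integral_chain /boundary.
rewrite [fglift (fun phi => boundary_cube _ _) _]fglift_domE.
rewrite fglift_sum fglift_domE; apply: eq_big_seq => phi phiD.
have [F [phiF E]] := boundary_cubeE (Phi_ext phi phiD).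
rewrite fgliftZ E (JE phi F phiF); congr (_ *: _).
rewrite fglift_sum; apply: eq_bigr => i _; rewrite fglift_sum; apply: eq_bigr => a _.
by rewrite fgliftZ liftU scale1r.
Qed.

End Chains.

Theorem theorem3 (R : realType) (M : dspace R) (G : set (M -> R)) (k n : nat)
    (M_nonempty : [set: M] !=set0) (M_hausdorff : hausdorff_dspace M)
    (hG : gen_struct G = @dfun R M) (hb : bounded1 G) (k_gt0 : (0 < k)%N)
    (eta : kform k M) (eta_skew : skew_symmetric eta) (Phi : chain n M)
    (eta_ext : exists eta' : kform k (completion_space G),
       pull_form (to_compl hG) eta' = eta :> (tkspace k M -> R))
    (Phi_ext : extendable_chain G Phi)
    (teta : kform k (box_space R G)) (teta_skew : skew_symmetric teta)
    (teta_ext : pull_form (to_box hG hb) teta = eta :> (tkspace k M -> R)) :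
  [/\ integrable_chain (pull_form (compl_to_box hb) teta) (boundary G Phi),
      integrable_chain (pull_form (to_box hG hb) (dext teta)) Phi &
      integral_chain (pull_form (compl_to_box hb) teta) (boundary G Phi) =
      integral_chain (pull_form (to_box hG hb) (dext teta)) Phi].
Proof.
have [nk|nk] := eqVneq n k.+1.
  subst n; split=> [psi|phi phiD|].
  - move=> /(dom_boundary Phi_ext)[phi [F [i [a [phiF ->]]]]].
    exact: (@integrable_cube_coef R (completion_space G) k _ _ _ (face_coef hb teta_skew F i a)).
  - have [F phiF] := extendable_extends (Phi_ext phi phiD).
    exact: (@integrable_cube_coef R M k.+1 _ _ _ (dext_coef hG hb k_gt0 teta_skew phiF)).
  apply: integral_boundary => // phi F phiF.
  exact: (stokes_cube hG hb k_gt0 teta_skew phiF).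
(* For [n = 0] the predecessor is 0 again, and [k > 0] is what separates it from [k]. *)
have kn : k <> n.-1.
  move=> kn; case/eqP: nk; rewrite kn prednK//.
  by case: n kn k_gt0 {Phi Phi_ext} => // ->.
have kn' : k.+1 <> n by move=> E; case/eqP: nk.
split=> [psi _ e|phi _ e|]; [by case: kn|by case: kn'|].
apply: integral_boundary => // phi F phiF.
rewrite integral_cube_neq// big1// => i _; rewrite big1// => a _.
by rewrite integral_cube_neq// mulr0.
Qed.
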